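(* (a) For each $\rho<r<1$ there exist $\lambda(r)>0$ and $\mathcal{D}(r)\in\mathcal{M}$ satisfying $\mathcal{R}_r\mathcal{D}(r)=\lambda(r)\mathcal{D}(r)$; this pair is unique in the sense that if $\lambda>0$ and $\mathcal{D}'\in\mathcal{M}$ satisfy $\mathcal{R}_r\mathcal{D}'=\lambda\mathcal{D}'$ then $\lambda=\lambda(r)$ and $\mathcal{D}'=c\,\mathcal{D}(r)$ for some constant $c>0$. Moreover $\mathcal{D}(r)\in\mathcal{M}_S$, and $r\mapsto\lambda(r)$ is non-increasing and continuous on $(\rho,1)$. (b) There exists a unique $r\in(\rho,1)$ such that the equation $\mathcal{R}_r\mathcal{D}=r^2\mathcal{D}$ has a solution $\mathcal{D}\in\mathcal{M}$, and for this $r$ the solution is unique up to multiplication by a positive constant.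
   Context: Let $q_0=(\tfrac12,\tfrac{\sqrt3}{2})$, $q_1=(0,0)$, $q_2=(1,0)$, $\rho=\frac{\sqrt5-1}{2}$, $F_0(x)=\rho^2(x-q_0)+q_0$, $F_1(x)=\rho(x-q_1)+q_1$, $F_2(x)=\rho(x-q_2)+q_2$. For a finite word $w$ over $\{0,1,2\}$, $|w|$ is its length and $F_w=F_{w_1}\circ\cdots\circ F_{w_{|w|}}$. $W_1$ is a set of words of the form $w_1\cdots w_n0$ ($n\ge0$, $w_i\in\{1,2\}$) containing exactly one word for each distinct map $F_w$ of this form. $V_0=\{q_0,q_1,q_2\}$, $V_1=\bigcup_{w\in W_1}F_wV_0$, $\bar V_1$ its closure. $\mathcal{M}$ is the set of forms $\mathcal{D}(f,g)=\frac12\sum_{i,j}a_{ij}(f(q_i)-f(q_j))(g(q_i)-g(q_j))$ on functions on $V_0$ with $(a_{ij})$ symmetric, $a_{ii}=0$, $a_{ij}\ge0$ and irreducible; $\mathcal{M}_S\subset\mathcal{M}$ is the subset with $a_{01}=a_{02}$ (symmetric forms). For $r>0$: $\Psi_r\mathcal{D}(f,g)=\sum_{w\in W_1}r^{-|w|+1}\mathcal{D}(f\circ F_w,g\circ F_w)$ on $\mathrm{Dom}(\Psi_r\mathcal{D})=\{f:V_1\to\mathbb{R}:\Psi_r\mathcal{D}(f,f)<\infty\}$ (for $\rho<r<1$ a resistance form on $\bar V_1$). For $\rho<r<1$ the renormalization map is $\mathcal{R}_r\mathcal{D}(u)=\inf\{\Psi_r\mathcal{D}(f):f\in\mathrm{Dom}(\Psi_r\mathcal{D}),f|_{V_0}=u\}$,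 $u:V_0\to\mathbb{R}$, a form in $\mathcal{M}$. *)

(* Defs.v *)
From HB Require Import structures.
From mathcomp Require Import all_boot all_order all_algebra.
From mathcomp Require Import all_classical all_reals all_analysis.
Set Implicit Arguments. Unset Strict Implicit. Unset Printing Implicit Defensive.
Import Order.TTheory GRing.Theory Num.Theory.
Import numFieldNormedType.Exports.
Local Open Scope classical_set_scope.
Local Open Scope ring_scope.

Section Defs.
Variable R : realType.

Definition pt := (R * R)%type.

Definition rho : R := (Num.sqrt 5 - 1) / 2.

Definition q (i : 'I_3) : pt :=
  if val i == 0%N then (1 / 2, Num.sqrt 3 / 2)
  else if val i == 1%N then (0, 0) else (1, 0).

Definition ratio (i : 'I_3) : R := if val i == 0%N then rho ^+ 2 else rho.

Definition F (i : 'I_3) (x : pt) : pt :=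
  (ratio i * (x.1 - (q i).1) + (q i).1, ratio i * (x.2 - (q i).2) + (q i).2).

Definition Fw (w : seq 'I_3) : pt -> pt := foldr (fun i g => F i \o g) id w.

Definition W1shape (w : seq 'I_3) : Prop :=
  exists v : seq 'I_3, all (fun i => i != ord0) v /\ w = rcons v ord0.

Definition validW1 (W1 : set (seq 'I_3)) : Prop :=
  (forall w, W1 w -> W1shape w) /\
  (forall v, W1shape v -> exists! w, W1 w /\ Fw w = Fw v).

Definition V1 (W1 : set (seq 'I_3)) : set pt :=
  [set p | exists2 w, W1 w & exists i : 'I_3, p = Fw w (q i)].

(* The form D with coefficients a, evaluated on u : V_0 -> R (D(u) = D(u,u)) *)
Definition Dform (a : 'I_3 -> 'I_3 -> R) (u : 'I_3 -> R) : R :=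
  1 / 2 * \sum_(i < 3) \sum_(j < 3) a i j * (u i - u j) * (u i - u j).

Definition irreducible_coef (a : 'I_3 -> 'I_3 -> R) : Prop :=
  forall S : {set 'I_3}, (0 < #|S|)%N -> (#|S| < 3)%N ->
    exists i, exists j, [/\ i \in S, j \notin S & 0 < a i j].

Definition inM (a : 'I_3 -> 'I_3 -> R) : Prop :=
  [/\ forall i j, a i j = a j i,
      forall i, a i i = 0,
      forall i j, 0 <= a i j &
      irreducible_coef a].

Definition inMS (a : 'I_3 -> 'I_3 -> R) : Prop :=
  inM a /\ a ord0 (inord 1) = a ord0 (inord 2).

Definition Psi (W1 : set (seq 'I_3)) (r : R) (a : 'I_3 -> 'I_3 -> R)
    (f : pt -> R) : \bar R :=
  \esum_(w in W1) (r ^ (1 - (size w)%:Z) * Dform a (fun i => f (Fw w (q i))))%:E.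

(* f in Dom(Psi_r D) with f|_{V_0} = u.  Functions on V_1 are represented by
   functions on the plane (only their values on V_1 matter); the restriction to
   V_0 is taken through the (unique) continuous extension to the closure of V_1,
   i.e. f(x) -> u_i as x -> q_i within V_1. *)
Definition admissible (W1 : set (seq 'I_3)) (r : R) (a : 'I_3 -> 'I_3 -> R)
    (u : 'I_3 -> R) (f : pt -> R) : Prop :=
  (Psi W1 r a f < +oo)%E /\
  forall i : 'I_3, (f @ within (V1 W1) (nbhs (q i))) --> u i.

Definition Rr (W1 : set (seq 'I_3)) (r : R) (a : 'I_3 -> 'I_3 -> R)
    (u : 'I_3 -> R) : \bar R :=
  ereal_inf [set Psi W1 r a f | f in admissible W1 r a u].

Definition eigen (W1 : set (seq 'I_3)) (r lam : R) (a : 'I_3 -> 'I_3 -> R) : Prop :=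
  forall u : 'I_3 -> R, Rr W1 r a u = (lam * Dform a u)%:E.

End Defs.

(* Main.v *)
Require Import Defs.
From HB Require Import structures.
From mathcomp Require Import all_boot all_order all_algebra.
From mathcomp Require Import all_classical all_reals all_analysis.
From mathcomp Require Import ring lra zify.
Import Order.TTheory GRing.Theory Num.Theory.
Import numFieldNormedType.Exports.
Local Open Scope classical_set_scope.
Local Open Scope ring_scope.

(* A point of V_1 has height rho^n (n the level) times that of q_0 and is given by
   its horizontal shift x; the cell (n, x) joins (n, x) to (n+1, x) and to
   (n+1, x + rho^(n+2)), and Psi_r weights level n by r^(-n). As r < 1, a descending
   path gives |f(p) - f(p')|^2 <= C r^m E(f) below level m, so that minimizers exist
   and take their boundary values. As r > rho, linear interpolation below a level
   has finite energy, since the level-n part of the energy decays like (rho / r)^n.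

   Existence: for the symmetric forms (1, 1, b) the trace is again symmetric, and
   the intermediate value theorem in b applies: at b = 0 replace f by |f|; for
   large b use a function that is constant along the horizontal edges, which form
   components of at most three points. Uniqueness and monotonicity of the
   eigenvalue: take the smallest k with D <= k D' and a triple u where they touch.
   If D, D' are both eigenforms, the minimizer for u restricts on each cell to an
   affine function of u; harmonicity then determines it along the sides and at
   the words 12, 21, 122, 121, 1212, 1221, and the identifications 122 = 211 and
   12122 = 12211 give a contradiction unless D = k D'. Continuity: cut a minimizer
   at a level that carries little of its energy and interpolate below it. Finally
   lambda(r) < 1, and a path parallel to an edge of the left side gives
   lambda(31/50) > (31/50)^2, so that lambda(r) = r^2 has a solution; it is unique
   as lambda is non-increasing. *)

(** * Positions of the cells *)

(** The inequality [lambda(r) > r ^ 2] just above [rho] is the delicate one. The two sides of the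
    triangle connect the top to the corners with conductance [1 - r] each, which gives
    [lambda(r) >= 1 - r]. As [rho ^ 2 = 1 - rho], this exceeds [r ^ 2] only for [r < rho], just
    outside the admissible range. So edges off the sides have to be counted, and a small gain
    suffices at a rational parameter slightly above [rho]. Uniqueness uses two identifications of
    words for the following reason. With touching triple [(0, p, q)], the limits along the sides and
    the identification 122 = 211 exclude [p = 0] and [q = 0] and force [p = q] with equal splitting
    of the flow. Such a symmetric flow is consistent with 122 = 211. It fails at 12122 = 12211,
    because the cell 122 = 211 collects the flow of two cells, whereas 121 is fed by one. *)

Section Lattice.
Variable R : realType.
Local Notation rho := (rho R).
Implicit Types (x y z : R) (n : nat).

(** The upper bound is also the parameter [r] at which [lambda(r)] is later compared with [r ^ 2],
    so it is a rational number close to [rho]. *)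
Lemma rho_bounds : 3/5 < rho < 31/50.
Proof.
have h5 : Num.sqrt (5 : R) ^+ 2 = 5 by rewrite sqr_sqrtr.
have h0 := sqrtr_ge0 (5 : R).
by rewrite /Defs.rho; apply/andP; split; nra.
Qed.

Lemma rho_gt0 : 0 < rho.
Proof. by have /andP[] := rho_bounds; lra. Qed.

Lemma rho_sqr : rho ^+ 2 = 1 - rho.
Proof.
have h5 : Num.sqrt (5 : R) ^+ 2 = 5 by rewrite sqr_sqrtr.
rewrite /Defs.rho expr2; rewrite expr2 in h5; lra.
Qed.

Lemma rhoX_gt0 n : 0 < rho ^+ n.
Proof. exact: exprn_gt0 rho_gt0. Qed.

Lemma rhoX n : rho ^+ n = rho ^+ n.+1 + rho ^+ n.+2.
Proof. by rewrite !exprS [X in _ + X]mulrA -expr2 rho_sqr; ring. Qed.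

(* The horizontal shifts of the maps [Fw v], [v] a word of length [n] over {1, 2}.
   The shift determines the map, so that [shifts n] indexes the cells
   [Fw (rcons v 0)] of level [n]. *)
Fixpoint shifts n : seq R :=
  if n is m.+1 then undup (shifts m ++ [seq x + rho ^+ m.+2 | x <- shifts m])
  else [:: 0].

Local Notation T := shifts.

Lemma T_uniq n : uniq (T n).
Proof. by case: n => //= n; apply: undup_uniq. Qed.

Lemma memTS n y : (y \in T n.+1) = (y \in T n) || (y - rho ^+ n.+2 \in T n).
Proof.
rewrite /= mem_undup mem_cat; congr (_ || _).
apply/mapP/idP => [[x hx ->]|h]; first by rewrite addrK.
by exists (y - rho ^+ n.+2) => //; rewrite subrK.
Qed.

Lemma memT_left n x : x \in T n -> x \in T n.+1.
Proof. by rewrite memTS => ->. Qed.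

Lemma memT_right n x : x \in T n -> x + rho ^+ n.+2 \in T n.+1.
Proof. by rewrite memTS addrK => ->; rewrite orbT. Qed.

Lemma memT0 n : 0 \in T n.
Proof. by elim: n => [|n IH]; [rewrite inE|apply: memT_left]. Qed.

(** Reflection in the vertical axis: the image of the triangle under a word of length [n] over {1,
    2} has width [rho ^+ n]. *)
Lemma memT_sym n x : x \in T n -> 1 - rho ^+ n - x \in T n.
Proof.
elim: n x => [x|n IH x]; first by rewrite !inE expr0 => /eqP->; rewrite subrr subr0.
have h := rhoX n.
rewrite memTS => /orP[/IH/memT_right|/IH/memT_left].
  by rewrite (_ : _ - x + _ = 1 - rho ^+ n.+1 - x)//; lra.
by rewrite (_ : _ - (_ - _) = 1 - rho ^+ n.+1 - x)//; lra.
Qed.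

Lemma memT_last n : 1 - rho ^+ n \in T n.
Proof. by have := memT_sym _ _ (memT0 n); rewrite subr0. Qed.

Lemma T_ge0 n x : x \in T n -> 0 <= x.
Proof.
elim: n x => [x|n IH x]; first by rewrite inE => /eqP->.
by rewrite memTS => /orP[/IH//|/IH]; have := rhoX_gt0 n.+2; lra.
Qed.

Lemma T_le n x : x \in T n -> x <= 1 - rho ^+ n.
Proof. by move/memT_sym/T_ge0; lra. Qed.

Lemma T_pos n x : x \in T n -> x = 0 \/ rho ^+ n.+1 <= x.
Proof.
elim: n x => [x|n IH x]; first by rewrite inE => /eqP->; left.
have h := rhoX n.+1; have h3 := rhoX_gt0 n.+3.
rewrite memTS => /orP[/IH[]|/T_ge0]; [by left| |]; by right; lra.
Qed.

(* The gaps of [T n] have length [rho ^+ n.+2] or [rho ^+ n.+1], of sum [rho ^+ n],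
   and two short gaps are never adjacent: [y - x = 2 * rho ^+ n.+2] is excluded. *)
Lemma T_gap n x y : x \in T n -> y \in T n -> x < y ->
  [\/ y - x = rho ^+ n.+2, y - x = rho ^+ n.+1 | rho ^+ n <= y - x].
Proof.
elim: n x y => [x y|n IH x y].
  by rewrite !inE => /eqP-> /eqP->; rewrite ltxx.
have h0 := rhoX n; have h1 := rhoX n.+1; have h2 := rhoX n.+2.
have p3 := rhoX_gt0 n.+3; have p4 := rhoX_gt0 n.+4; have p5 := rhoX_gt0 n.+2.
(* Differences within one copy of [T n]: a short gap of [T n] is a long gap of [T n.+1], and a long
   gap of [T n] meets the third alternative. *)
have same u v : u \in T n -> v \in T n -> u < v ->
    [\/ v - u = rho ^+ n.+3, v - u = rho ^+ n.+2 | rho ^+ n.+1 <= v - u].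
  by move=> hu hv /IH[]// h; [constructor 2|constructor 3; lra|constructor 3; lra].
rewrite !memTS => /orP[hx|hx] /orP[hy|hy] xy.
- exact: same.
- case: (ltgtP x (y - rho ^+ n.+2)) => c.
  + by have [] := IH _ _ hx hy c => h; constructor 3; lra.
  + by have [] := IH _ _ hy hx c => h; lra.
  + by constructor 2; lra.
(* The short gaps of [T n.+1] arise here: a shifted point inside a long gap of [T n], followed by
   the right end of that gap. *)
- have c : x - rho ^+ n.+2 < y by lra.
  by have [] := IH _ _ hx hy c => h; [lra|constructor 1; lra|constructor 3; lra].
- have c : x - rho ^+ n.+2 < y - rho ^+ n.+2 by lra.
  by have := same _ _ hx hy c; rewrite (_ : y - _ - _ = y - x)//; lra.
Qed.

End Lattice.

Arguments shifts : simpl never.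

(** * Energies on the levels *)

Section Sums.
Variable R : realFieldType.

Lemma ler_sum_subseq (I : eqType) (s t : seq I) (F : I -> R) :
  uniq s -> uniq t -> {subset s <= t} -> (forall i, i \in t -> 0 <= F i) ->
  \sum_(i <- s) F i <= \sum_(i <- t) F i.
Proof.
move=> us ut st F0; rewrite [leRHS](bigID (mem s))/=.
have -> : \sum_(i <- t | i \in s) F i = \sum_(i <- s) F i.
  rewrite -big_filter; apply: perm_big; apply: uniq_perm => //.
    exact: filter_uniq.
  by move=> i; rewrite mem_filter andb_idr//; apply: st.
by rewrite lerDl big_seq_cond sumr_ge0// => i /andP[/F0].
Qed.

Lemma ler_term_sum (I : eqType) (t : seq I) (F : I -> R) j :
  uniq t -> j \in t -> (forall i, i \in t -> 0 <= F i) ->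
  F j <= \sum_(i <- t) F i.
Proof.
move=> ut jt F0; have := @ler_sum_subseq _ [:: j] t F isT ut _ F0.
by rewrite big_seq1; apply => i; rewrite inE => /eqP->.
Qed.

(* Series law for two resistances [A] and [B] carrying the drops [d] and [e]. *)
Lemma sqr_series (A B s t d e : R) : 0 <= A -> 0 <= B -> 0 <= s -> 0 <= t ->
  d ^+ 2 <= A * s -> e ^+ 2 <= B * t -> (d + e) ^+ 2 <= (A + B) * (s + t).
Proof.
move=> A0 B0 s0 t0 hd he.
have h1 : (d * e) ^+ 2 <= (A * t) * (B * s).
  rewrite exprMn (_ : A * t * (B * s) = (A * s) * (B * t)); last by ring.
  by apply: ler_pM => //; apply: sqr_ge0.
have h2 : 2 * (d * e) <= A * t + B * s.
  have p0 : 0 <= A * t by apply: mulr_ge0.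
  have q0 : 0 <= B * s by apply: mulr_ge0.
  move: (A * t) (B * s) p0 q0 (d * e) h1 => p q p0 q0 k hk.
  rewrite leNgt; apply/negP => hlt.
  have : (p + q) ^+ 2 < (2 * k) ^+ 2 by rewrite ltr_pXn2r// nnegrE; lra.
  have := sqr_ge0 (p - q); nra.
nra.
Qed.

Lemma geo_sum_le (r : R) n : 0 <= r < 1 -> \sum_(k < n) r ^+ k <= (1 - r)^-1.
Proof.
move=> /andP[r0 r1]; rewrite -[leRHS]mul1r ler_pdivlMr; last by lra.
have -> : (\sum_(k < n) r ^+ k) * (1 - r) = 1 - r ^+ n.
  by rewrite mulrC -opprB mulNr -subrX1 opprB.
by have := exprn_ge0 n r0; lra.
Qed.

End Sums.

Section Energy.
Variable R : realType.
Local Notation rho := (rho R).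
Local Notation T := (shifts R).
Implicit Types (g : nat -> R -> R) (x y z : R) (n : nat).

(** The coefficients [a], [b], [c] belong to the left, right and horizontal edge of a cell with top
    value [x] and bottom values [y], [z]. *)
Definition tri (a b c x y z : R) :=
  a * (x - y) ^+ 2 + b * (x - z) ^+ 2 + c * (y - z) ^+ 2.

(* [g n x] stands for the value at the top vertex of the cell [x] of level [n],
   whose bottom vertices are the top vertices of the cells [x] and
   [x + rho ^+ n.+2] of level [n.+1]. *)
Definition cell a b c g n x :=
  tri a b c (g n x) (g n.+1 x) (g n.+1 (x + rho ^+ n.+2)).

Definition lev a b c g n := \sum_(x <- T n) cell a b c g n x.

Definition en a b c r g N := \sum_(n < N) r ^- n * lev a b c g n.

(** Nonnegative coefficients on three points are irreducible exactly when at least two of them are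
    positive, that is, when the sum of the pairwise products is positive. *)
Definition conductances (a b c : R) :=
  [/\ 0 <= a, 0 <= b, 0 <= c & 0 < a * b + b * c + c * a].

(* A lower bound for the effective conductance between any two vertices. *)
Definition kap (a b c : R) := (a * b + b * c + c * a) / (a + b + c).

Lemma sum_conductances_gt0 a b c : conductances a b c -> 0 < a + b + c.
Proof.
move=> [a0 b0 c0 h]; rewrite lt_neqAle addr_ge0 ?addr_ge0// andbT.
apply/eqP => s; move: h; have [-> ->] : a = 0 /\ b = 0 by split; lra.
by rewrite !(mul0r, mulr0) !addr0 ltxx.
Qed.

Lemma kap_gt0 a b c : conductances a b c -> 0 < kap a b c.
Proof.
move=> h; have s0 := sum_conductances_gt0 _ _ _ h; case: h => _ _ _ h.
exact: divr_gt0.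
Qed.

Lemma tri_ge0 a b c x y z : conductances a b c -> 0 <= tri a b c x y z.
Proof. by move=> [a0 b0 c0 _]; rewrite /tri !addr_ge0// mulr_ge0// sqr_ge0. Qed.

(** Multiplied by [b + c], the form becomes a square in [z] plus
    [(a * b + b * c + c * a) * (x - y) ^+ 2]. The further factor [a] adds only nonnegative terms and
    makes the constant symmetric in the three edges. *)
Lemma kap_tri a b c x y z : conductances a b c ->
  kap a b c * (x - y) ^+ 2 <= tri a b c x y z.
Proof.
move=> h; have s0 := sum_conductances_gt0 _ _ _ h; case: h => a0 b0 c0 _.
rewrite /kap mulrAC ler_pdivrMr// /tri.
have -> : (a * (x - y) ^+ 2 + b * (x - z) ^+ 2 + c * (y - z) ^+ 2) * (a + b + c)
  = (a * b + b * c + c * a) * (x - y) ^+ 2 + a ^+ 2 * (x - y) ^+ 2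
  + ((b + c) * (x - z) - c * (x - y)) ^+ 2
  + a * b * (x - z) ^+ 2 + a * c * (y - z) ^+ 2 by ring.
rewrite -!addrA lerDl.
by do ?[apply: sqr_ge0 | apply: addr_ge0 | apply: mulr_ge0].
Qed.

Lemma kap_tri_right a b c x y z : conductances a b c ->
  kap a b c * (x - z) ^+ 2 <= tri a b c x y z.
Proof.
move=> [a0 b0 c0 h]; have h' : conductances b a c by split => //; lra.
have := kap_tri b a c x z y h'; rewrite /kap /tri.
rewrite (_ : b + a + c = a + b + c); last by ring.
rewrite (_ : b * a + a * c + c * b = a * b + b * c + c * a); last by ring.
by rewrite (_ : b * (x - z) ^+ 2 + a * (x - y) ^+ 2 + c * (z - y) ^+ 2 =
  a * (x - y) ^+ 2 + b * (x - z) ^+ 2 + c * (y - z) ^+ 2)//; ring.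
Qed.

Lemma kap_tri_bottom a b c x y z : conductances a b c ->
  kap a b c * (y - z) ^+ 2 <= tri a b c x y z.
Proof.
move=> [a0 b0 c0 h]; have h' : conductances c a b by split => //; lra.
have := kap_tri c a b y z x h'; rewrite /kap /tri.
rewrite (_ : c + a + b = a + b + c); last by ring.
rewrite (_ : c * a + a * b + b * c = a * b + b * c + c * a); last by ring.
by rewrite (_ : c * (y - z) ^+ 2 + a * (y - x) ^+ 2 + b * (z - x) ^+ 2 =
  a * (x - y) ^+ 2 + b * (x - z) ^+ 2 + c * (y - z) ^+ 2)//; ring.
Qed.

Lemma cell_ge0 a b c g n x : conductances a b c -> 0 <= cell a b c g n x.
Proof. exact: tri_ge0. Qed.

Lemma lev_ge0 a b c g n : conductances a b c -> 0 <= lev a b c g n.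
Proof. by move=> h; apply: sumr_ge0 => x _; apply: cell_ge0. Qed.

Lemma cell_le_lev a b c g n x : conductances a b c -> x \in T n ->
  cell a b c g n x <= lev a b c g n.
Proof.
by move=> h xT; apply: ler_term_sum => // [|y _]; [exact: T_uniq|exact: cell_ge0].
Qed.

Lemma en0 a b c r g : en a b c r g 0 = 0.
Proof. by rewrite /en big_ord0. Qed.

Lemma enS a b c r g N : en a b c r g N.+1 = en a b c r g N + r ^- N * lev a b c g N.
Proof. by rewrite /en big_ord_recr. Qed.

Lemma en_nondecreasing a b c r g : conductances a b c -> 0 < r ->
  {homo en a b c r g : m n / (m <= n)%N >-> m <= n}.
Proof.
move=> h r0; apply: homo_leq => // [x y z|n]; first exact: le_trans.
by rewrite enS lerDl mulr_ge0 ?lev_ge0// invr_ge0 exprn_ge0// ltW.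
Qed.

Section Path.
Variables (a b c r : R).
Hypotheses (abc : conductances a b c) (r01 : 0 < r < 1).

(** [A] selects cells from which one can ascend to [x0]: a selected cell has a selected parent, and
    at level [m] only [x0] is selected. The edges of the ascent have resistance at most
    [r ^+ (m + k) / kap a b c], and the series law adds them. *)
Lemma path_series g m x0 (A : nat -> R -> Prop) :
  (forall x, x \in T m -> A m x -> x = x0) ->
  (forall n y, y \in T n.+1 -> A n.+1 y ->
    (y \in T n /\ A n y) \/ (y - rho ^+ n.+2 \in T n /\ A n (y - rho ^+ n.+2))) ->
  forall p y, y \in T (m + p) -> A (m + p)%N y ->
  kap a b c * (g m x0 - g (m + p)%N y) ^+ 2 <=
  (\sum_(k < p) r ^+ (m + k)) * (\sum_(k < p) r ^- (m + k) * lev a b c g (m + k)).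
Proof.
move=> base step; case/andP: r01 => r0 r1; have k0 := kap_gt0 _ _ _ abc.
suff H p y : y \in T (m + p) -> A (m + p)%N y -> (g m x0 - g (m + p)%N y) ^+ 2 <=
  (\sum_(k < p) r ^+ (m + k)) *
  ((\sum_(k < p) r ^- (m + k) * lev a b c g (m + k)) / kap a b c).
  move=> p y yT Ay; have := H p y yT Ay.
  by rewrite mulrA ler_pdivlMr// mulrC.
elim: p y => [y|p IH y].
  rewrite addn0 => yT Ay; rewrite (base _ yT Ay) subrr expr0n/=.
  by rewrite !big_ord0 mul0r.
rewrite addnS => yT Ay; rewrite !big_ord_recr/= [_ / kap _ _ _]mulrDl.
have key z : z \in T (m + p) -> A (m + p)%N z ->
    kap a b c * (g (m + p)%N z - g (m + p).+1 y) ^+ 2 <= cell a b c g (m + p) z ->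
    (g m x0 - g (m + p).+1 y) ^+ 2 <= 
    (\sum_(i < p) r ^+ (m + i) + r ^+ (m + p)) *
    ((\sum_(i < p) r ^- (m + i) * lev a b c g (m + i)) / kap a b c +
     r ^- (m + p) * lev a b c g (m + p) / kap a b c).
  move=> zT Az h.
  rewrite (_ : g m x0 - _ = (g m x0 - g (m + p)%N z) +
    (g (m + p)%N z - g (m + p).+1 y)); last by rewrite addrA subrK.
  apply: sqr_series.
  - by apply: sumr_ge0 => i _; rewrite exprn_ge0// ltW.
  - by rewrite exprn_ge0// ltW.
  - rewrite divr_ge0 ?(ltW k0)//; apply: sumr_ge0 => i _.
    by rewrite mulr_ge0 ?lev_ge0// invr_ge0 exprn_ge0// ltW.
  - by rewrite divr_ge0 ?(ltW k0)// mulr_ge0 ?lev_ge0// invr_ge0 exprn_ge0// ltW.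
  - exact: IH.
  - rewrite !mulrA divff ?mul1r; last by rewrite expf_neq0// gt_eqF.
    rewrite ler_pdivlMr// mulrC; apply: le_trans h _.
    exact: cell_le_lev.
case: (step _ _ yT Ay) => -[zT Az]; apply: (key _ zT Az).
  exact: kap_tri.
by have := kap_tri_right a b c (g (m + p)%N (y - rho ^+ (m + p).+2))
  (g (m + p).+1 (y - rho ^+ (m + p).+2)) (g (m + p).+1 y) abc; rewrite /cell subrK.
Qed.

Lemma path_bound g M m n x0 y (A : nat -> R -> Prop) :
  (forall N, en a b c r g N <= M) ->
  (forall x, x \in T m -> A m x -> x = x0) ->
  (forall n y, y \in T n.+1 -> A n.+1 y ->
    (y \in T n /\ A n y) \/ (y - rho ^+ n.+2 \in T n /\ A n (y - rho ^+ n.+2))) ->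
  (m <= n)%N -> y \in T n -> A n y ->
  (g m x0 - g n y) ^+ 2 <= r ^+ m * (M / (kap a b c * (1 - r))).
Proof.
move=> hM base step /subnKC <-; move: (n - m)%N => p yT Ay.
have := path_series g m x0 A base step p y yT Ay.
have k0 := kap_gt0 _ _ _ abc; case/andP: r01 => r0 r1.
move=> h; rewrite mulrA ler_pdivlMr; last by rewrite mulr_gt0// subr_gt0.
rewrite mulrCA mulrA -ler_pdivlMr ?subr_gt0//; apply: le_trans h _.
rewrite [leRHS]mulrAC; apply: ler_pM.
- by apply: sumr_ge0 => i _; rewrite exprn_ge0// ltW.
- by apply: sumr_ge0 => i _; rewrite mulr_ge0 ?lev_ge0// invr_ge0 exprn_ge0// ltW.
- rewrite (eq_bigr (fun i : 'I_p => r ^+ m * r ^+ i)); last by move=> i _; rewrite exprD.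
  rewrite -mulr_sumr ler_pM2l ?exprn_gt0//; apply: geo_sum_le.
  by rewrite (ltW r0) r1.
- apply: le_trans (hM (m + p)%N); rewrite /en big_split_ord/= lerDr.
  by apply: sumr_ge0 => i _; rewrite mulr_ge0 ?lev_ge0// invr_ge0 exprn_ge0// ltW.
Qed.

(** Uniform in [n] and [y]; this is the compactness behind minimizing sequences. *)
Lemma root_bound g M n y : (forall N, en a b c r g N <= M) -> y \in T n ->
  (g 0%N 0 - g n y) ^+ 2 <= M / (kap a b c * (1 - r)).
Proof.
move=> hM yT; have := path_bound g M 0 n 0 y (fun _ _ => True) hM.
rewrite expr0 mul1r; apply => //; first by move=> x; rewrite inE => /eqP.
by move=> k z; rewrite memTS => /orP[]; [left|right].
Qed.

(** By [T_pos], cells with shift below [rho ^+ m.+1] descend from the leftmost cell of level [m]. *)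
Lemma left_corner_bound g M m n y : (forall N, en a b c r g N <= M) ->
  (m <= n)%N -> y \in T n -> y < rho ^+ m.+1 ->
  (g m 0 - g n y) ^+ 2 <= r ^+ m * (M / (kap a b c * (1 - r))).
Proof.
move=> hM mn yT hy; apply: (path_bound g M m n 0 y (fun _ x => x < rho ^+ m.+1)) => //.
  by move=> x /T_pos[//|]; lra.
move=> k z; rewrite memTS => /orP[]; [by left|right]; split => //.
by have := rhoX_gt0 R k.+2; lra.
Qed.

Lemma right_corner_bound g M m n y : (forall N, en a b c r g N <= M) ->
  (m <= n)%N -> y \in T n -> 1 - rho ^+ n - y < rho ^+ m.+1 ->
  (g m (1 - rho ^+ m) - g n y) ^+ 2 <= r ^+ m * (M / (kap a b c * (1 - r))).
Proof.
move=> hM mn yT hy.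
apply: (path_bound g M m n _ y (fun k x => 1 - rho ^+ k - x < rho ^+ m.+1)) => //.
  by move=> x /memT_sym/T_pos[|]; lra.
move=> k z; have := rhoX R k; have := rhoX_gt0 R k.+2.
by rewrite memTS => ? ? /orP[]; [left|right]; split => //; lra.
Qed.

End Path.
End Energy.

(** * Interpolation below a level *)

Section Interpolation.
Variable R : realType.
Local Notation rho := (rho R).
Local Notation T := (shifts R).
Implicit Types (g : nat -> R -> R) (f : R -> R) (x y : R) (n : nat).

(* Linear interpolation from [T n] to [T n.+1], constant beyond the last point:
   a new point divides a gap [rho ^+ n.+1] of [T n] in the ratio [rho]. *)
Definition ext n f y :=
  if y \in T n then f y else
  let x := y - rho ^+ n.+2 in
  if x + rho ^+ n.+1 \in T n then f x + rho * (f (x + rho ^+ n.+1) - f x) else f x.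

Definition sqL n f x :=
  if x + rho ^+ n.+1 \in T n then (f (x + rho ^+ n.+1) - f x) ^+ 2 else 0.

Definition sqS n f x :=
  if x + rho ^+ n.+2 \in T n then (f (x + rho ^+ n.+2) - f x) ^+ 2 else 0.

Definition long_energy n f := \sum_(x <- T n) sqL n f x.
Definition short_energy n f := \sum_(x <- T n) sqS n f x.

(* This combination is multiplied by at most [rho] under [ext]. *)
Definition gap_energy n f := rho * long_energy n f + short_energy n f.

Lemma sqL_ge0 n f x : 0 <= sqL n f x.
Proof. by rewrite /sqL; case: ifP => // _; apply: sqr_ge0. Qed.

Lemma sqS_ge0 n f x : 0 <= sqS n f x.
Proof. by rewrite /sqS; case: ifP => // _; apply: sqr_ge0. Qed.

Lemma long_energy_ge0 n f : 0 <= long_energy n f.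
Proof. by apply: sumr_ge0 => x _; apply: sqL_ge0. Qed.

Lemma short_energy_ge0 n f : 0 <= short_energy n f.
Proof. by apply: sumr_ge0 => x _; apply: sqS_ge0. Qed.

Lemma gap_energy_ge0 n f : 0 <= gap_energy n f.
Proof. by rewrite addr_ge0 ?short_energy_ge0// mulr_ge0 ?long_energy_ge0// ltW ?rho_gt0. Qed.

Lemma ext_old n f x : x \in T n -> ext n f x = f x.
Proof. by rewrite /ext => ->. Qed.

Lemma ext_right n f x : x \in T n ->
  (f x - ext n f (x + rho ^+ n.+2)) ^+ 2 <= sqS n f x + rho ^+ 2 * sqL n f x.
Proof.
move=> xT; rewrite /ext /sqS addrK; case: ifP => _.
  by rewrite -[leLHS]sqrrN opprB lerDl mulr_ge0 ?sqL_ge0// sqr_ge0.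
rewrite add0r /sqL; case: ifP => _; last by rewrite subrr expr0n/= mulr0.
by rewrite -exprMn -[leLHS]sqrrN opprB addrAC subrr add0r.
Qed.

(** A long gap of [T n.+1] begins at a point of [T n]: otherwise two points of [T n] would differ by
    [2 * rho ^+ n.+2]. So [ext_right] bounds the drop across it. *)
Lemma long_energy_ext n f : long_energy n.+1 (ext n f) <= short_energy n f + rho ^+ 2 * long_energy n f.
Proof.
have h0 := rhoX R n; have h1 := rhoX R n.+1; have h2 := rhoX R n.+2.
have p2 := rhoX_gt0 R n.+2; have p3 := rhoX_gt0 R n.+3; have p4 := rhoX_gt0 R n.+4.
rewrite /long_energy /short_energy mulr_sumr -big_split/= {1}/sqL -big_mkcond/= -big_filter.
apply: (@le_trans _ _ (\sum_(x <- T n) (ext n f (x + rho ^+ n.+2) - ext n f x) ^+ 2)).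
  apply: ler_sum_subseq.
  - by rewrite filter_uniq ?T_uniq.
  - exact: T_uniq.
  - move=> y; rewrite mem_filter !memTS addrK => /andP[].
    move=> /orP[h|//] /orP[//|h'].
    have : y - rho ^+ n.+2 < y + rho ^+ n.+2 by lra.
    by move=> /(T_gap R n _ _ h' h)[]; lra.
  - by move=> y _; apply: sqr_ge0.
rewrite big_seq [leRHS]big_seq; apply: ler_sum => x xT.
by rewrite [X in _ - X]ext_old// -[leLHS]sqrrN opprB; apply: ext_right.
Qed.

(** A short gap of [T n.+1] is the right part of a long gap of [T n], where interpolation leaves the
    share [1 - rho = rho ^+ 2] of the drop. *)
Lemma short_energy_ext n f : short_energy n.+1 (ext n f) <= rho ^+ 4 * long_energy n f.
Proof.
have h0 := rhoX R n; have h1 := rhoX R n.+1; have h2 := rhoX R n.+2.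
have p2 := rhoX_gt0 R n.+2; have p3 := rhoX_gt0 R n.+3; have p4 := rhoX_gt0 R n.+4.
rewrite /short_energy {1}/sqS -big_mkcond/= -big_filter.
set s := [seq _ <- _ | _].
have sP y : y \in s -> [/\ y \notin T n, y - rho ^+ n.+2 \in T n &
    y + rho ^+ n.+3 \in T n].
  rewrite mem_filter !memTS => /andP[hR hy].
  have yT : y \notin T n.
    apply/negP => yT; case/orP: hR => h.
      by have := T_gap R n _ _ yT h; case; lra.
    have : y + rho ^+ n.+3 - rho ^+ n.+2 < y by lra.
    by move=> /(T_gap R n _ _ h yT)[]; lra.
  move: hy; rewrite (negbTE yT)/= => hy; split => //.
  case/orP: hR => // h.
  have : y - rho ^+ n.+2 < y + rho ^+ n.+3 - rho ^+ n.+2 by lra.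
  by move=> /(T_gap R n _ _ hy h)[]; lra.
rewrite /long_energy mulr_sumr.
rewrite (eq_big_seq (fun y => rho ^+ 4 * sqL n f (y - rho ^+ n.+2))); last first.
  move=> y /sP[yT hy hy'].
  rewrite (ext_old _ _ _ hy') /ext (negbTE yT) /sqL.
  have -> : y - rho ^+ n.+2 + rho ^+ n.+1 = y + rho ^+ n.+3 by lra.
  rewrite hy'; set u := f _; set v := f _.
  rewrite (_ : u - _ = (1 - rho) * (u - v)); last by ring.
  by rewrite -rho_sqr exprMn -exprM.
rewrite -(big_map (fun y => y - rho ^+ n.+2) predT (fun x => rho ^+ 4 * sqL n f x)).
apply: ler_sum_subseq.
- rewrite map_inj_uniq; last by move=> ? ? /addIr.
  by rewrite filter_uniq ?T_uniq.
- exact: T_uniq.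
- by move=> x /mapP[y /sP[_ hy _] ->].
- by move=> x _; rewrite mulr_ge0 ?sqL_ge0// exprn_ge0// ltW ?rho_gt0.
Qed.

(** The row vector [(rho, 1)] is an eigenvector, with eigenvalue [rho], of the matrix of the two
    preceding bounds, because [rho ^+ 3 + rho ^+ 4 = rho ^+ 2]. *)
Lemma gap_energy_ext n f : gap_energy n.+1 (ext n f) <= rho * gap_energy n f.
Proof.
have r0 := rho_gt0 R; have r2 := rho_sqr R.
have hL := long_energy_ext n f; have hS := short_energy_ext n f.
have -> : rho * gap_energy n f = rho * (short_energy n f + rho ^+ 2 * long_energy n f) + rho ^+ 4 * long_energy n f.
  have -> : rho ^+ 4 = rho ^+ 2 * (1 - rho) by rewrite -rho_sqr -exprD.
  by rewrite /gap_energy; ring.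
by rewrite lerD// ler_pM2l.
Qed.

Fixpoint extn N f k := if k is k'.+1 then ext (N + k') (extn N f k') else f.

Definition interp N g n := if (n <= N)%N then g n else extn N (g N) (n - N).

Lemma interp_le N g n : (n <= N)%N -> interp N g n = g n.
Proof. by rewrite /interp => ->. Qed.

Lemma interpS N g n : (N <= n)%N -> interp N g n.+1 = ext n (interp N g n).
Proof.
move=> Nn; rewrite /interp ltnNge Nn/= subSn//= subnKC//; case: ifP => // nN.
have -> : n = N by apply/eqP; rewrite eqn_leq nN Nn.
by rewrite subnn.
Qed.

Lemma interp_corner_left N g n : (N <= n)%N -> interp N g n 0 = g N 0.
Proof.
elim: n => [|n IH]; first by rewrite leqn0 => /eqP->; rewrite interp_le.
rewrite leq_eqVlt => /orP[/eqP<-|]; first by rewrite interp_le.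
by rewrite ltnS => Nn; rewrite interpS// ext_old ?memT0// IH.
Qed.

(** The point [1 - rho ^+ n.+1] lies beyond all of [T n], so the last branch of [ext] copies the
    value at [1 - rho ^+ n]. *)
Lemma interp_corner_right N g n : (N <= n)%N ->
  interp N g n (1 - rho ^+ n) = g N (1 - rho ^+ N).
Proof.
elim: n => [|n IH]; first by rewrite leqn0 => /eqP->; rewrite interp_le.
rewrite leq_eqVlt => /orP[/eqP<-|]; first by rewrite interp_le.
rewrite ltnS => Nn; rewrite interpS// -IH// /ext.
have h0 := rhoX R n; have h1 := rhoX_gt0 R n.+1; have h2 := rhoX_gt0 R n.+2.
rewrite ifF; last by apply/negP => /T_le; lra.
rewrite ifF; last by apply/negP => /T_le; lra.
by congr (interp _ _ _ _); lra.
Qed.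

Lemma gap_energy_interp N g k : gap_energy (N + k) (interp N g (N + k)) <= rho ^+ k * gap_energy N (g N).
Proof.
elim: k => [|k IH]; first by rewrite addn0 interp_le// expr0 mul1r.
rewrite addnS interpS ?leq_addr//; apply: le_trans (gap_energy_ext _ _) _.
by rewrite exprS -mulrA ler_pM2l ?rho_gt0.
Qed.

Section Conductances.
Variables (a b c : R).
Hypothesis abc : conductances R a b c.
Local Notation Lev := (lev R a b c).
Local Notation En := (en R a b c).
Local Notation K := (kap R a b c).

Lemma eq_lev g h n : g n = h n -> g n.+1 = h n.+1 -> Lev g n = Lev h n.
Proof. by rewrite /lev /cell => -> ->. Qed.

(** Old values are kept, so left edges carry no drop, and the right and the horizontal edge of a
    cell carry the same one; hence the factor [b + c]. *)
Lemma lev_interp N g n : (N <= n)%N -> Lev (interp N g) n <= (b + c) * gap_energy n (interp N g n).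
Proof.
move=> Nn; have [a0 b0 c0 _] := abc; have r0 := rho_gt0 R.
have hQ : short_energy n (interp N g n) + rho ^+ 2 * long_energy n (interp N g n) <= gap_energy n (interp N g n).
  rewrite /gap_energy addrC lerD2r ler_wpM2r ?long_energy_ge0// expr2 ger_pMr//.
  by have /andP[] := rho_bounds R; lra.
apply: le_trans (ler_wpM2l _ hQ); last by rewrite addr_ge0.
rewrite /lev /short_energy /long_energy mulr_sumr -big_split/= mulr_sumr big_seq [leRHS]big_seq.
apply: ler_sum => x xT; rewrite /cell interpS// ext_old// /tri.
have h := ext_right n (interp N g n) x xT.
by rewrite subrr expr0n/= mulr0 add0r -mulrDl ler_wpM2l// addr_ge0.
Qed.

(** Long gaps of level [N.+1] are horizontal edges of cells of level [N]. Two cells across a short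
    gap share a bottom vertex, so that drop splits into a right and a left edge of level [N.+1];
    squaring the sum costs a factor 2 for each of the two families. *)
Lemma gap_energy_lev N g : gap_energy N.+1 (g N.+1) <= (Lev g N + 4 * Lev g N.+1) / K.
Proof.
have k0 := kap_gt0 R _ _ _ abc; have r0 := rho_gt0 R.
have h0 := rhoX R N; have h1 := rhoX R N.+1; have h2 := rhoX R N.+2.
have p2 := rhoX_gt0 R N.+2; have p3 := rhoX_gt0 R N.+3; have p4 := rhoX_gt0 R N.+4.
rewrite ler_pdivlMr// /gap_energy mulrDl; apply: lerD.
  apply: (@le_trans _ _ (long_energy N.+1 (g N.+1) * K)).
    rewrite ler_wpM2r ?(ltW k0)// ler_piMl ?long_energy_ge0//.
    by have /andP[] := rho_bounds R; lra.
  rewrite /long_energy /sqL -big_mkcond/= -big_filter mulr_suml.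
  apply: (@le_trans _ _ (\sum_(x <- T N) (g N.+1 (x + rho ^+ N.+2) - g N.+1 x) ^+ 2 * K)).
    apply: ler_sum_subseq.
    - by rewrite filter_uniq ?T_uniq.
    - exact: T_uniq.
    - move=> y; rewrite mem_filter !memTS addrK => /andP[].
      move=> /orP[h|//] /orP[//|h'].
      have : y - rho ^+ N.+2 < y + rho ^+ N.+2 by lra.
      by move=> /(T_gap R N _ _ h' h)[]; lra.
    - by move=> y _; rewrite mulr_ge0 ?sqr_ge0// ltW.
  apply: ler_sum => x _; rewrite mulrC -[X in _ * X]sqrrN opprB.
  exact: kap_tri_bottom.
set n := N.+1.
rewrite /short_energy mulr_suml.
apply: (@le_trans _ _ (2 * (\sum_(x <- T n) (g n x - g n.+1 (x + rho ^+ n.+2)) ^+ 2 * K)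
  + 2 * \sum_(x <- T n) (g n x - g n.+1 x) ^+ 2 * K)); last first.
  rewrite (_ : 4 * _ = 2 * Lev g n + 2 * Lev g n); last by ring.
  by apply: lerD; rewrite ler_pM2l//; apply: ler_sum => x _; rewrite mulrC;
    [exact: kap_tri_right|exact: kap_tri].
rewrite [X in X + _]mulr_sumr.
pose s := [seq x <- T n | x + rho ^+ n.+2 \in T n].
have hs : \sum_(x <- s) (g n (x + rho ^+ n.+2) - g n.+1 (x + rho ^+ n.+2)) ^+ 2 * K
   <= \sum_(x <- T n) (g n x - g n.+1 x) ^+ 2 * K.
  rewrite -(big_map (fun x => x + rho ^+ n.+2) predT
     (fun x => (g n x - g n.+1 x) ^+ 2 * K)).
  apply: ler_sum_subseq.
  - rewrite map_inj_uniq; last by move=> ? ? /addIr.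
    by rewrite filter_uniq ?T_uniq.
  - exact: T_uniq.
  - by move=> x /mapP[y]; rewrite mem_filter => /andP[hy _] ->.
  - by move=> x _; rewrite mulr_ge0 ?sqr_ge0// ltW.
rewrite -(ler_pM2l (_ : 0 < 2)) in hs => //.
apply: le_trans (lerD (lexx _) hs).
rewrite /s big_filter mulr_sumr [X in _ + X]big_mkcond -big_split/=; apply: ler_sum => x _.
rewrite /sqS; case: ifP => _; last first.
  by rewrite mul0r addr0 mulr_ge0// mulr_ge0 ?sqr_ge0// ltW.
move: K k0 (g n _) (g n x) (g n.+1 _) => k k0 u w v.
have : 0 <= (u + w - 2 * v) ^+ 2 * k by rewrite mulr_ge0 ?sqr_ge0// ltW.
by rewrite (_ : (u + w - 2 * v) ^+ 2 * k = 2 * ((w - v) ^+ 2 * k) +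
  2 * ((u - v) ^+ 2 * k) - (u - w) ^+ 2 * k) ?subr_ge0//; ring.
Qed.

Lemma en_interp r N g M : rho < r ->
  En r (interp N g) M <= En r g N + r ^- N * ((b + c) * gap_energy N (g N) / (1 - rho / r)).
Proof.
move=> rr; have p0 := rho_gt0 R; have r0 : 0 < r by apply: lt_trans rr.
have q01 : 0 <= rho / r < 1.
  by rewrite divr_ge0 ?ltW//= ltr_pdivrMr// mul1r.
have bc0 : 0 <= (b + c) * gap_energy N (g N).
  by rewrite mulr_ge0 ?gap_energy_ge0//; case: abc => *; apply: addr_ge0.
have rest0 : 0 <= r ^- N * ((b + c) * gap_energy N (g N) / (1 - rho / r)).
  apply: mulr_ge0; first by rewrite invr_ge0 exprn_ge0// ltW.
  by apply: divr_ge0 => //; case/andP: q01; lra.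
have low k : (k <= N)%N -> En r (interp N g) k = En r g k.
  move=> kN; apply: eq_bigr => i _; congr (_ * _).
  by apply: eq_lev; rewrite interp_le//; have := ltn_ord i; lia.
case: (leqP M N) => [MN|/ltnW/subnKC <-].
  by rewrite low// -[leLHS]addr0 lerD// en_nondecreasing.
rewrite /en big_split_ord/=; have := low N (leqnn N); rewrite /en => ->.
rewrite lerD2l.
apply: (@le_trans _ _ (\sum_(i < M - N) r ^- N * ((b + c) * gap_energy N (g N)) * (rho / r) ^+ i)).
  apply: ler_sum => i _.
  have h : Lev (interp N g) (N + i) <= (b + c) * (rho ^+ i * gap_energy N (g N)).
    apply: le_trans (lev_interp N g (N + i) (leq_addr _ _)) _.
    by apply: ler_wpM2l (gap_energy_interp _ _ _); case: abc => *; apply: addr_ge0.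
  apply: le_trans (ler_wpM2l _ h) _; first by rewrite invr_ge0 exprn_ge0// ltW.
  rewrite exprD invfM (expr_div_n rho); move: ((r ^+ N)^-1) ((r ^+ i)^-1) => u v.
  by rewrite le_eqVlt; apply/orP; left; apply/eqP; ring.
rewrite -mulr_sumr -mulrA; apply: ler_wpM2l.
  by rewrite invr_ge0 exprn_ge0// ltW.
by apply: ler_wpM2l => //; apply: geo_sum_le.
Qed.

End Conductances.
End Interpolation.

(** * The trace on the three corners *)

Section Limits.
Variable R : realType.

(** An ultrafilter replaces the extraction of diagonal subsequences: the values at all vertices
    converge along the same filter. *)
Lemma ultra_cvg_bounded (I : Type) (F : set_system I) (u : I -> R) (M : R) :
  UltraFilter F -> (forall k, `|u k| <= M) -> exists l : R, u @ F --> l.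
Proof.
move=> FU uM; have FP : ProperFilter F := ultra_proper.
have FM : (u @ F) `[- M, M]%classic.
  have h : [set: I] `<=` u @^-1` `[- M, M]%classic.
    by move=> k _; rewrite /= in_itv/= -ler_norml.
  by apply: filterS h _; exact: filterT.
have [l [_ lc]] := @segment_compact R (- M) M _ _ FM.
exists l => U lU; have [//|FUc] := in_ultra_setVsetC (u @^-1` U) FU.
have [x [/= xU xU']] := lc (~` U) U FUc lU.
by case: xU.
Qed.

Lemma sqr_cvg_zero (u v : nat -> R) l : v @ \oo --> (0 : R) ->
  (forall n, (u n - l) ^+ 2 <= v n) -> u @ \oo --> l.
Proof.
move=> v0 uv; apply/cvgrPdist_le => e e0.
have e20 : 0 < e ^+ 2 by apply: exprn_gt0.
have /cvgrPdist_le/(_ _ e20) := v0; apply: filterS => n.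
rewrite sub0r normrN => h; rewrite distrC -(@ler_pXn2r _ 2)// ?nnegrE ?(ltW e0)//.
by rewrite real_normK ?num_real//; apply: le_trans (uv n) (le_trans (ler_norm _) h).
Qed.

Lemma expr_cvg0 (r C : R) : 0 <= r < 1 -> (fun n => r ^+ n * C) @ \oo --> (0 : R).
Proof.
move=> /andP[r0 r1]; rewrite -[X in _ --> X](mul0r C); apply: cvgMl => /=.
by apply: cvg_expr; rewrite ger0_norm.
Qed.

End Limits.

Section Trace.
Variable R : realType.
Local Notation rho := (rho R).
Local Notation T := (shifts R).
Implicit Types (g : nat -> R -> R) (x y u : R) (n : nat).

(* For functions of finite energy these limits along the two sides are equivalent
   to the limits at [q 1] and [q 2] within [V1]. *)
Definition adm g u0 u1 u2 := [/\ g 0%N 0 = u0, (fun n => g n 0) @ \oo --> u1 &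
  (fun n => g n (1 - rho ^+ n)) @ \oo --> u2].

(** Upper bounds [M] of the partial energies stand for their supremum, which keeps all values real.
    An empty set would give the default 0 of [inf]; for [rho < r < 1] it is excluded by
    [extension]. *)
Definition tr (a b c r u0 u1 u2 : R) : R :=
  inf [set M | exists2 g, adm g u0 u1 u2 & forall N, en R a b c r g N <= M].

Lemma tr_le a b c r g u0 u1 u2 M : adm g u0 u1 u2 ->
  (forall N, en R a b c r g N <= M) -> tr a b c r u0 u1 u2 <= M.
Proof.
move=> hg hM; apply: ge_inf; last by exists g.
by exists 0 => x [h _ hM']; have := hM' 0%N; rewrite en0.
Qed.

Lemma tr_ge0 a b c r u0 u1 u2 : 0 <= tr a b c r u0 u1 u2.
Proof.
have [[M hM]|/set0P] := pselect ([set M | exists2 g, adm g u0 u1 u2 &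
  forall N, en R a b c r g N <= M] !=set0).
  apply: lb_le_inf; first by exists M.
  by move=> x [h _ hM']; have := hM' 0%N; rewrite en0.
by move=> /negP; rewrite negbK => /eqP h; rewrite /tr h inf0.
Qed.

Section Fixed.
Variables (a b c r : R).
Hypotheses (abc : conductances R a b c) (rr : rho < r < 1).
Local Notation En := (en R a b c r).
Local Notation K := (kap R a b c).

Let r01 : 0 < r < 1.
Proof. by have := rho_gt0 R; case/andP: rr => *; apply/andP; split; lra. Qed.

Definition extension_bound u0 u1 u2 :=
  tri R a b c u0 u1 u2 + 4 * (b + c) * (u1 - u2) ^+ 2 / (r - rho).

Lemma extension u0 u1 u2 : exists2 g, adm g u0 u1 u2 &
  forall N, En g N <= extension_bound u0 u1 u2.
Proof.
(* Only levels 0 and 1 matter, since the interpolation starts from level 1, whose two points are 0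
   and [rho ^+ 2]. *)
pose g := fun (n : nat) (x : R) => if n == 0%N then u0 else if x == 0 then u1 else u2.
have p0 := rho_gt0 R; have [rho35 rho1] : 3/5 < rho /\ rho < 31/50.
  by have /andP[] := rho_bounds R.
have [rr0 rr1] := andP rr; have [r0 r1] := andP r01.
exists (interp R 1 g).
  split; first by rewrite interp_le.
    apply: cvg_near_cst; near=> n; rewrite interp_corner_left; last by near: n; exists 1%N.
    by rewrite /g/= eqxx.
  apply: cvg_near_cst; near=> n; rewrite interp_corner_right; last by near: n; exists 1%N.
  by rewrite /g/= ifF// expr1; apply/eqP; lra.
move=> N; apply: le_trans (en_interp R a b c abc r 1 g N rr0) _.
have -> : En g 1 = tri R a b c u0 u1 u2.
  rewrite enS en0 add0r expr0 invr1 mul1r /lev /shifts big_seq1 /cell /g/= eqxx add0r ifF//.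
  by apply/eqP; have := rhoX_gt0 R 2; lra.
rewrite lerD2l expr1.
have d2 x y : (g 1%N y - g 1%N x) ^+ 2 <= (u1 - u2) ^+ 2.
  by rewrite /g/=; case: ifP => _; case: ifP => _; rewrite ?subrr ?expr0n/= ?sqr_ge0// -sqrrN opprB.
have sz : (size (T 1) <= 2)%N by apply: leq_trans (size_undup _) _.
have sumle F : (forall x, F x <= (u1 - u2) ^+ 2) -> \sum_(x <- T 1) F x <= 2 * (u1 - u2) ^+ 2.
  move=> hF; apply: (@le_trans _ _ (\sum_(x <- T 1) (u1 - u2) ^+ 2)).
    by apply: ler_sum.
  rewrite big_const_seq count_predT iter_addr_0 -[leLHS]mulr_natl.
  by apply: ler_wpM2r; rewrite ?sqr_ge0// ler_nat.
have hQ : gap_energy R 1 (g 1%N) <= 4 * (u1 - u2) ^+ 2.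
  have s0 := sqr_ge0 (u1 - u2).
  have hL : long_energy R 1 (g 1%N) <= 2 * (u1 - u2) ^+ 2.
    by apply: sumle => x; rewrite /sqL; case: ifP.
  have hS : short_energy R 1 (g 1%N) <= 2 * (u1 - u2) ^+ 2.
    by apply: sumle => x; rewrite /sqS; case: ifP.
  rewrite /gap_energy; have := long_energy_ge0 R 1 (g 1%N) => h.
  have : rho * long_energy R 1 (g 1%N) <= long_energy R 1 (g 1%N) by rewrite ler_piMl//; lra.
  lra.
have bc : 0 <= b + c by case: abc => *; apply: addr_ge0.
have -> : r^-1 * ((b + c) * gap_energy R 1 (g 1%N) / (1 - rho / r)) =
    (b + c) * gap_energy R 1 (g 1%N) / (r - rho).
  by field; rewrite !gt_eqF//; lra.
rewrite ler_wpM2r ?invr_ge0 ?subr_ge0 ?(ltW rr0)//.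
by rewrite [4 * _]mulrC -mulrA ler_wpM2l.
Unshelve. all: by end_near. Qed.

(** The limit of [left_corner_bound] along the corner cells. The rate depends on [g] only through
    [M], so it survives the limit of a minimizing sequence. *)
Lemma root_corner_left g u0 u1 u2 M : adm g u0 u1 u2 -> (forall N, En g N <= M) ->
  forall m, (g m 0 - u1) ^+ 2 <= r ^+ m * (M / (K * (1 - r))).
Proof.
move=> [_ h1 _] hM m.
have h : (fun n => (g m 0 - g n 0) ^+ 2) @ \oo --> (g m 0 - u1) ^+ 2.
  apply: (@cvg_comp _ _ _ (fun n => g m 0 - g n 0) (fun x => x ^+ 2)); last exact: exprn_continuous.
  by apply: cvgB => //; apply: cvg_cst.
apply: (@closed_cvg _ _ _ _ _ (fun x => x <= r ^+ m * (M / (K * (1 - r)))) _ _ _ h).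
  exact: closed_le.
near=> n; apply: left_corner_bound => //.
- by near: n; exists m.
- exact: memT0.
- exact: rhoX_gt0.
Unshelve. all: by end_near. Qed.

Lemma root_corner_right g u0 u1 u2 M : adm g u0 u1 u2 -> (forall N, En g N <= M) ->
  forall m, (g m (1 - rho ^+ m) - u2) ^+ 2 <= r ^+ m * (M / (K * (1 - r))).
Proof.
move=> [_ _ h1] hM m.
have h : (fun n => (g m (1 - rho ^+ m) - g n (1 - rho ^+ n)) ^+ 2) @ \oo
    --> (g m (1 - rho ^+ m) - u2) ^+ 2.
  apply: (@cvg_comp _ _ _ (fun n => g m (1 - rho ^+ m) - g n (1 - rho ^+ n))
    (fun x => x ^+ 2)); last exact: exprn_continuous.
  by apply: cvgB => //; apply: cvg_cst.
apply: (@closed_cvg _ _ _ _ _ (fun x => x <= r ^+ m * (M / (K * (1 - r)))) _ _ _ h).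
  exact: closed_le.
near=> n; apply: right_corner_bound => //.
- by near: n; exists m.
- exact: memT_last.
- by rewrite subrr; apply: rhoX_gt0.
Unshelve. all: by end_near. Qed.

Lemma tr_attained u0 u1 u2 : exists2 g, adm g u0 u1 u2 &
  forall N, En g N <= tr a b c r u0 u1 u2.
Proof.
have [r0 r1] := andP r01; have k0 := kap_gt0 R _ _ _ abc.
set t := tr a b c r u0 u1 u2.
have approx (k : nat) : exists g, adm g u0 u1 u2 /\ forall N, En g N <= t + k.+1%:R^-1.
  have lt : t < t + k.+1%:R^-1 by rewrite ltrDl invr_gt0.
  have [g0 g0a g0M] := extension u0 u1 u2.
  have [|M [g ga gM] Mlt] := inf_lt _ lt; first by exists (extension_bound u0 u1 u2), g0.
  by exists g; split => // N; apply: le_trans (gM N) (ltW Mlt).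
have [G hG] := choice approx.
have [F [FU Foo]] := @ultraFilterLemma nat \oo _.
have FP : ProperFilter F := ultra_proper.
have GM k N : En (G k) N <= t + 1.
  apply: le_trans ((hG k).2 N) _; rewrite lerD2l invf_le1 ?ler1n//.
(* Off [T n] nothing bounds [G k n x], so 0 takes its place there. *)
have bnd n x : exists l : R, (fun k => if x \in T n then G k n x else 0) @ F --> l.
  apply: (@ultra_cvg_bounded _ _ _ _ (`|u0| + ((t + 1) / (K * (1 - r)) + 1)) FU) => k.
  have B0 : 0 <= (t + 1) / (K * (1 - r)).
    by rewrite divr_ge0 ?addr_ge0 ?tr_ge0// mulr_ge0 ?(ltW k0)// subr_ge0 ltW.
  case: ifP => [xT|_]; last by rewrite normr0 addr_ge0// addr_ge0.
  have := root_bound R a b c r abc r01 (G k) _ n x (GM k) xT.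
  have [[-> _ _] _] := hG k; move: (G k n x) (_ / _) B0 => v B B0 h.
  rewrite -lerBlDl; apply: le_trans (lerB_dist _ _) _; rewrite distrC.
  rewrite -(@ler_pXn2r _ 2)// ?nnegrE ?addr_ge0// real_normK ?num_real//.
  by apply: le_trans h _; nra.
have [g gP] : exists g : nat -> R -> R, forall n x, x \in T n -> (fun k => G k n x) @ F --> g n x.
  have [g hg] := choice (fun nx : nat * R => bnd nx.1 nx.2).
  exists (fun n x => g (n, x)) => n x xT.
  by have := hg (n, x); rewrite /= xT.
(* A partial energy is a finite sum of continuous functions of the values, so it passes to the
   limit. *)
have gE N : En g N <= t.
  have cvgE : (fun k => En (G k) N) @ F --> En g N.
    rewrite /en; apply: cvg_big => [|i _]; first exact: add_continuous.
    apply: cvgMr; rewrite /lev big_seq.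
    under eq_fun do rewrite big_seq.
    apply: cvg_big => [|x xT]; first exact: add_continuous.
    have sq (u v : nat -> R) p q : u @ F --> p -> v @ F --> q ->
        (fun k => (u k - v k) ^+ 2) @ F --> (p - q) ^+ 2.
      move=> hu hv; apply: (@cvg_comp _ _ _ (fun k => u k - v k) (fun x => x ^+ 2)); last exact: exprn_continuous.
      exact: cvgB.
    have c0 := gP _ _ xT; have c1 := gP _ _ (memT_left _ _ _ xT).
    have c2 := gP _ _ (memT_right _ _ _ xT).
    by apply: cvgD; [apply: cvgD|]; apply: cvgMr; apply: sq.
  apply/ler_addgt0Pr => e e0.
  apply: (@closed_cvg _ _ _ _ _ (fun x => x <= t + e) _ _ _ cvgE).
    exact: closed_le.
  have : (\forall k \near \oo, k.+1%:R^-1 <= e).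
    have /cvgrPdist_le/(_ _ e0) := @cvg_harmonic R; apply: filterS => k.
    by rewrite sub0r normrN ger0_norm// /harmonic invr_ge0.
  move/Foo; apply: filterS => k hk; apply: le_trans ((hG k).2 N) _.
  by rewrite lerD2l.
(* The uniform rates at the corners pass to the limit as well; they show that [g] keeps the boundary
   values. *)
have corner0 m x u : x \in T m ->
    (forall k, (G k m x - u) ^+ 2 <= r ^+ m * ((t + 1) / (K * (1 - r)))) ->
    (g m x - u) ^+ 2 <= r ^+ m * ((t + 1) / (K * (1 - r))).
  move=> xT h.
  have hc : (fun k => (G k m x - u) ^+ 2) @ F --> (g m x - u) ^+ 2.
    apply: (@cvg_comp _ _ _ (fun k => G k m x - u) (fun x => x ^+ 2)); last exact: exprn_continuous.
    by apply: cvgB; [exact: gP|exact: cvg_cst].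
  apply: (@closed_cvg _ _ _ _ _ (fun x => x <= _) _ _ _ hc); first exact: closed_le.
  by near=> k; apply: h.
exists g => //; split.
- have h := gP 0%N 0 (memT0 _ 0).
  have h' : (fun k => G k 0%N 0) @ F --> u0.
    by apply: cvg_near_cst; near=> k; have [[]] := hG k.
  exact: (cvg_unique _ h h').
- apply: (sqr_cvg_zero _ _ _ _ (expr_cvg0 _ _ _ _)) => [|m]; last first.
    apply: corner0; first exact: memT0.
    by move=> k; apply: root_corner_left (hG k).1 (GM k) m.
  by rewrite (ltW r0) r1.
- apply: (sqr_cvg_zero _ _ _ _ (expr_cvg0 _ _ _ _)) => [|m]; last first.
    apply: (corner0 m (1 - rho ^+ m)); first exact: memT_last.
    by move=> k; apply: root_corner_right (hG k).1 (GM k) m.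
  by rewrite (ltW r0) r1.
Unshelve. all: by end_near. Qed.

End Fixed.
End Trace.

(** * The trace as a quadratic form *)

Section TraceAlgebra.
Variable R : realType.
Local Notation rho := (rho R).
Local Notation T := (shifts R).
Local Notation Tr := (tr R).
Local Notation En := (en R).
Local Notation Cell := (cell R).
Local Notation Lev := (lev R).
Implicit Types (f g h : nat -> R -> R) (x y u : R) (n : nat).

Lemma en_le_lin (a b c a' b' c' r p q : R) h f g N : 0 < r ->
  (forall n x, x \in T n -> Cell a b c h n x <=
     p * Cell a' b' c' f n x + q * Cell a' b' c' g n x) ->
  En a b c r h N <= p * En a' b' c' r f N + q * En a' b' c' r g N.
Proof.
move=> r0 H; rewrite /en !mulr_sumr -big_split/=; apply: ler_sum => i _.
rewrite mulrCA [q * _]mulrCA -mulrDr; apply: ler_wpM2l.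
  by rewrite invr_ge0 exprn_ge0// ltW.
rewrite /lev !mulr_sumr -big_split/= big_seq [leRHS]big_seq.
by apply: ler_sum => x xT; apply: H.
Qed.

Lemma en_par (a b c r : R) f g N :
  En a b c r (fun n x => f n x + g n x) N + En a b c r (fun n x => f n x - g n x) N
  = 2 * En a b c r f N + 2 * En a b c r g N.
Proof.
rewrite /en !mulr_sumr -!big_split/=; apply: eq_bigr => i _.
rewrite mulrCA [2 * _]mulrCA -!mulrDr; congr (_ * _).
rewrite mulrDr /lev !mulr_sumr -!big_split/=; apply: eq_bigr => x _.
by rewrite /cell /tri; ring.
Qed.

Lemma en_le_param (a b c r s : R) g N : conductances R a b c -> 0 < r -> r <= s ->
  En a b c s g N <= En a b c r g N.
Proof.
move=> abc r0 rs; have s0 : 0 < s by apply: lt_le_trans rs.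
apply: ler_sum => i _; apply: ler_wpM2r; first exact: lev_ge0.
by rewrite lef_pV2 ?posrE ?exprn_gt0// lerXn2r// nnegrE ltW.
Qed.

Definition reflect_fun g n x := g n (1 - rho ^+ n - x).

Lemma lev_reflect (a b c : R) g n : Lev a b c (reflect_fun g) n = Lev b a c g n.
Proof.
rewrite /lev [RHS](perm_big [seq 1 - rho ^+ n - x | x <- T n]); last first.
  apply: uniq_perm; first exact: T_uniq.
    by rewrite map_inj_uniq ?T_uniq// => x y /addrI/oppr_inj.
  move=> x; apply/idP/mapP => [xT|[y yT ->]]; last exact: memT_sym.
  by exists (1 - rho ^+ n - x); [exact: memT_sym|ring].
rewrite big_map; apply: eq_bigr => x _; have h := rhoX R n.
rewrite /cell /tri /reflect_fun.
have -> : 1 - rho ^+ n.+1 - x = 1 - rho ^+ n - x + rho ^+ n.+2 by lra.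
have -> : 1 - rho ^+ n.+1 - (x + rho ^+ n.+2) = 1 - rho ^+ n - x by lra.
by rewrite -[(g n.+1 _ - g n.+1 _) ^+ 2]sqrrN opprB; ring.
Qed.

Lemma adm_reflect g u0 u1 u2 : adm R g u0 u1 u2 -> adm R (reflect_fun g) u0 u2 u1.
Proof.
move=> [h0 h1 h2]; split; rewrite /reflect_fun.
- by rewrite expr0 subrr subr0.
- by under eq_fun do rewrite subr0.
- by under eq_fun do rewrite subrr.
Qed.

Lemma adm_comp1 (F : R -> R) g u0 u1 u2 : continuous F -> adm R g u0 u1 u2 ->
  adm R (fun n x => F (g n x)) (F u0) (F u1) (F u2).
Proof.
move=> cF [h0 h1 h2]; split; first by rewrite h0.
  by apply: (@cvg_comp _ _ _ (fun n => g n 0) F _ _ _ h1); apply: cF.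
by apply: (@cvg_comp _ _ _ (fun n => g n (1 - rho ^+ n)) F _ _ _ h2); apply: cF.
Qed.

Lemma admD g h u0 u1 u2 v0 v1 v2 : adm R g u0 u1 u2 -> adm R h v0 v1 v2 ->
  adm R (fun n x => g n x + h n x) (u0 + v0) (u1 + v1) (u2 + v2).
Proof.
by move=> [<- ? ?] [<- ? ?]; split => //; apply: cvgD.
Qed.

Lemma admB g h u0 u1 u2 v0 v1 v2 : adm R g u0 u1 u2 -> adm R h v0 v1 v2 ->
  adm R (fun n x => g n x - h n x) (u0 - v0) (u1 - v1) (u2 - v2).
Proof.
by move=> [<- ? ?] [<- ? ?]; split => //; apply: cvgB.
Qed.

Section Fixed.
Variables (a b c r : R).
Hypotheses (abc : conductances R a b c) (rr : rho < r < 1).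
Local Notation t := (Tr a b c r).

Let r0 : 0 < r.
Proof. by have := rho_gt0 R; case/andP: rr => *; lra. Qed.

Lemma tr_compare (a' b' c' k u0 u1 u2 : R) : conductances R a' b' c' -> 0 <= k ->
  (forall x y z, tri R a b c x y z <= k * tri R a' b' c' x y z) ->
  t u0 u1 u2 <= k * Tr a' b' c' r u0 u1 u2.
Proof.
move=> abc' k0 H; have [g ga gE] := tr_attained R a' b' c' r abc' rr u0 u1 u2.
apply: (tr_le R _ _ _ _ g) => // N.
apply: (@le_trans _ _ (k * En a' b' c' r g N + 0 * En a' b' c' r g N)).
  by apply: en_le_lin => // n x _; rewrite mul0r addr0; apply: H.
by rewrite mul0r addr0; apply: ler_wpM2l.
Qed.

Lemma tr_param (s u0 u1 u2 : R) : r <= s -> s < 1 ->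
  Tr a b c s u0 u1 u2 <= t u0 u1 u2.
Proof.
move=> rs s1; have [g ga gE] := tr_attained R a b c r abc rr u0 u1 u2.
apply: (tr_le R _ _ _ _ g) => // N.
by apply: le_trans (gE N); apply: en_le_param.
Qed.

Lemma tr_affine (k d u0 u1 u2 : R) : k != 0 ->
  t (k * u0 + d) (k * u1 + d) (k * u2 + d) = k ^+ 2 * t u0 u1 u2.
Proof.
have le k' d' v0 v1 v2 : t (k' * v0 + d') (k' * v1 + d') (k' * v2 + d')
    <= k' ^+ 2 * t v0 v1 v2.
  have [g ga gE] := tr_attained R a b c r abc rr v0 v1 v2.
  apply: (tr_le R _ _ _ _ (fun n x => k' * g n x + d')).
    apply: (adm_comp1 (fun x => k' * x + d')) ga.
    by move=> x; apply: cvgD; [apply: cvgMr; exact: cvg_id|exact: cvg_cst].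
  move=> N; apply: (@le_trans _ _ (k' ^+ 2 * En a b c r g N + 0 * En a b c r g N)).
    by apply: en_le_lin => // n x _; rewrite le_eqVlt /cell /tri; apply/orP; left; apply/eqP; ring.
  by rewrite mul0r addr0 ler_wpM2l ?sqr_ge0.
move=> k0; apply/eqP; rewrite eq_le le/=.
have := le k^-1 (- (d / k)) (k * u0 + d) (k * u1 + d) (k * u2 + d).
have e u : k^-1 * (k * u + d) - d / k = u by field.
rewrite !e exprVn -ler_pdivrMl ?invr_gt0 ?exprn_even_gt0// invrK.
by [].
Qed.

(** Sums and differences of minimizers give one inequality; applied to [u + v] and [u - v] it gives
    the other. *)
Lemma tr_par u0 u1 u2 v0 v1 v2 :
  t (u0 + v0) (u1 + v1) (u2 + v2) + t (u0 - v0) (u1 - v1) (u2 - v2) =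
  2 * t u0 u1 u2 + 2 * t v0 v1 v2.
Proof.
have le x0 x1 x2 y0 y1 y2 : t (x0 + y0) (x1 + y1) (x2 + y2) +
    t (x0 - y0) (x1 - y1) (x2 - y2) <= 2 * t x0 x1 x2 + 2 * t y0 y1 y2.
  have [f fa fE] := tr_attained R a b c r abc rr x0 x1 x2.
  have [g ga gE] := tr_attained R a b c r abc rr y0 y1 y2.
  set B := 2 * _ + 2 * _.
  (* The levels [N] and [N'] are unrelated, so that [tr_le] can be applied to the sum and to the
     difference one after the other. *)
  have bd N N' : En a b c r (fun n x => f n x + g n x) N +
      En a b c r (fun n x => f n x - g n x) N' <= B.
    have := en_nondecreasing R a b c r.
    pose m := maxn N N' => mono.
    apply: (@le_trans _ _ (En a b c r (fun n x => f n x + g n x) m +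
      En a b c r (fun n x => f n x - g n x) m)).
      by apply: lerD; apply: mono => //; rewrite ?leq_maxl ?leq_maxr.
    by rewrite en_par /B lerD// ler_pM2l.
  rewrite -lerBrDr; apply: (tr_le R _ _ _ _ _ _ _ _ _ (admD _ _ _ _ _ _ _ _ fa ga)) => N.
  rewrite lerBrDr addrC -lerBrDr.
  apply: (tr_le R _ _ _ _ _ _ _ _ _ (admB _ _ _ _ _ _ _ _ fa ga)) => N'.
  by rewrite lerBrDr addrC.
apply/eqP; rewrite eq_le le/=.
have := le (u0 + v0) (u1 + v1) (u2 + v2) (u0 - v0) (u1 - v1) (u2 - v2).
have e1 x y : x + y + (x - y) = 2 * x + 0 by ring.
have e2 x y : x + y - (x - y) = 2 * y + 0 by ring.
rewrite !e1 !e2 !tr_affine//; clear.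
move: (t u0 u1 u2) (t v0 v1 v2) (t (u0 + v0) _ _) (t (u0 - v0) _ _) => x y z w.
by lra.
Qed.

(** Young's inequality on every edge. In the proof of continuity, [v] is a small correction of the
    boundary values. *)
Lemma trD_le (e u0 u1 u2 v0 v1 v2 : R) : 0 < e ->
  t (u0 + v0) (u1 + v1) (u2 + v2) <= (1 + e) * t u0 u1 u2 + (1 + e^-1) * t v0 v1 v2.
Proof.
move=> e0; have i0 : 0 < e^-1 by rewrite invr_gt0.
have [f fa fE] := tr_attained R a b c r abc rr u0 u1 u2.
have [g ga gE] := tr_attained R a b c r abc rr v0 v1 v2.
apply: (tr_le R _ _ _ _ _ _ _ _ _ (admD _ _ _ _ _ _ _ _ fa ga)) => N.
apply: (@le_trans _ _ ((1 + e) * En a b c r f N + (1 + e^-1) * En a b c r g N)).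
  apply: en_le_lin => // n x _.
  have sq (k d s : R) : 0 <= k -> k * (d + s) ^+ 2 <= (1 + e) * (k * d ^+ 2) + (1 + e^-1) * (k * s ^+ 2).
    move=> k0; have : 0 <= k * (e^-1 * (e * d - s) ^+ 2).
      apply: mulr_ge0 => //; apply: mulr_ge0; first exact: ltW.
      exact: sqr_ge0.
    rewrite (_ : k * _ = (1 + e) * (k * d ^+ 2) + (1 + e^-1) * (k * s ^+ 2) -
      k * (d + s) ^+ 2) ?subr_ge0//.
    by field; rewrite gt_eqF.
  case: abc => a0 b0 c0 _; rewrite /cell /tri.
  move: (f n x) (f n.+1 x) (f n.+1 (x + rho ^+ n.+2)) (g n x) (g n.+1 x) (g n.+1 (x + rho ^+ n.+2)) => p0 p1 p2 q0 q1 q2.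
  have E (x1 y1 x2 y2 : R) : x1 + x2 - (y1 + y2) = (x1 - y1) + (x2 - y2) by ring.
  rewrite (E p0 p1 q0 q1) (E p0 p2 q0 q2) (E p1 p2 q1 q2); apply: le_trans (lerD (lerD (sq a _ _ a0) (sq b _ _ b0)) (sq c _ _ c0)) _.
  by rewrite le_eqVlt; apply/orP; left; apply/eqP; ring.
by apply: lerD; apply: ler_wpM2l => //; lra.
Qed.

Lemma tr_corner_le u0 u1 u2 : kap R a b c * (1 - r) * (u0 - u1) ^+ 2 <= t u0 u1 u2.
Proof.
have [g ga gE] := tr_attained R a b c r abc rr u0 u1 u2.
have := root_corner_left R a b c r abc rr g u0 u1 u2 _ ga gE 0.
have [-> _ _] := ga; rewrite expr0 mul1r ler_pdivlMr 1?mulrC//.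
by rewrite mulr_gt0 ?kap_gt0//; case/andP: rr => _; lra.
Qed.

Lemma tr_markov : t 0 1 1 <= t 0 1 (-1).
Proof.
have [g ga gE] := tr_attained R a b c r abc rr 0 1 (-1).
apply: (tr_le R _ _ _ _ (fun n x => `|g n x|)).
  have := adm_comp1 (fun x => `|x|) g _ _ _ (@norm_continuous _ _) ga.
  by rewrite normr0 normr1 normrN1.
move=> N; apply: (@le_trans _ _ (1 * En a b c r g N + 0 * En a b c r g N)); last first.
  by rewrite mul0r addr0 mul1r.
apply: en_le_lin => // n x _; rewrite mul0r addr0 mul1r /cell /tri.
have sq (d s : R) : (`|d| - `|s|) ^+ 2 <= (d - s) ^+ 2.
  by rewrite -[leLHS]real_normK ?num_real// -[leRHS]real_normK ?num_real// ler_pXn2r// ?nnegrE//; apply: ler_dist_dist.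
by case: abc => a0 b0 c0 _; do ?[apply: lerD]; apply: ler_wpM2l.
Qed.

End Fixed.

Lemma tr_reflect (a b c r u0 u1 u2 : R) : conductances R a b c -> rho < r < 1 ->
  Tr a b c r u0 u1 u2 = Tr b a c r u0 u2 u1.
Proof.
move=> abc rr.
have le a' b' c' v0 v1 v2 : conductances R a' b' c' ->
    Tr a' b' c' r v0 v1 v2 <= Tr b' a' c' r v0 v2 v1.
  move=> [a0 b0 c0 s0]; have abc' : conductances R b' a' c' by split => //; lra.
  have [g ga gE] := tr_attained R _ _ _ r abc' rr v0 v2 v1.
  apply: (tr_le R _ _ _ _ _ _ _ _ _ (adm_reflect _ _ _ _ ga)) => N.
  apply: le_trans (gE N); rewrite le_eqVlt; apply/orP; left; apply/eqP.
  by apply: eq_bigr => i _; rewrite lev_reflect.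
apply/eqP; rewrite eq_le !le//.
by case: abc => *; split => //; lra.
Qed.

Section Symmetric.
Variables (c r : R).
Hypotheses (c0 : 0 <= c) (rr : rho < r < 1).
Local Notation t := (Tr 1 1 c r).

Lemma conductances11 : conductances R 1 1 c.
Proof. by split => //; rewrite ?mul1r ?mulr1; have := c0; lra. Qed.

(** A triple is the sum of its even part [(u0, m, m)] and its odd part [(0, y, - y)]. Their sum and
    difference are mirror images and have the same trace, so the parallelogram law leaves no mixed
    term. *)
Lemma tr_symmetric u0 u1 u2 : t u0 u1 u2 =
  (u0 - (u1 + u2) / 2) ^+ 2 * t 1 0 0 + ((u1 - u2) / 2) ^+ 2 * t 0 1 (-1).
Proof.
have h := conductances11.
set m := (u1 + u2) / 2; set y := (u1 - u2) / 2.
have par := tr_par 1 1 c r h rr u0 m m 0 y (- y).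
have tz : t 0 0 0 = 0.
  have := tr_affine 1 1 c r h rr 2 0 0 0 0; rewrite !mulr0 !addr0 pnatr_eq0 => /(_ isT).
  by clear; move: (t 0 0 0) => *; lra.
have hom k d v0 v1 v2 : t (k * v0 + d) (k * v1 + d) (k * v2 + d) = k ^+ 2 * t v0 v1 v2.
  have [->|k0] := eqVneq k 0; last exact: tr_affine.
  rewrite !mul0r !add0r expr0n/= mul0r.
  by have := tr_affine 1 1 c r h rr 1 d 0 0 0; rewrite oner_eq0 !mulr0 !add0r tz mulr0; apply.
have e1 := hom (u0 - m) m 1 0 0; have e2 := hom y 0 0 1 (-1).
rewrite !mulr0 !mulr1 !add0r subrK in e1.
rewrite !mulr0 mulr1 mulrN1 !addr0 in e2.
rewrite addr0 subr0 opprK e1 e2 in par.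
have sym := tr_reflect 1 1 c r u0 (m - y) (m + y) h rr.
rewrite sym in par.
have m1 : m + y = u1 by rewrite /m /y; field.
have m2 : m - y = u2 by rewrite /m /y; field.
rewrite m1 m2 in par; move: par; clear.
by move: (t u0 u1 u2) (t 1 0 0) (t 0 1 (-1)) => *; lra.
Qed.

Lemma tr_flip : t 0 1 1 = t 1 0 0.
Proof.
have := tr_affine 1 1 c r conductances11 rr (-1) 1 1 0 0.
by rewrite oppr_eq0 oner_eq0 !mulr0 !add0r mulr1 addNr sqrrN expr1n mul1r; apply.
Qed.

End Symmetric.
End TraceAlgebra.

(** * Existence of a symmetric eigenform *)

Section Counting.
Variable R : realType.
Local Notation rho := (rho R).
Local Notation T := (shifts R).

(** Gaps are at least [d = rho ^+ n.+2], so rounding [x / d] down is injective on [T n]. The count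
    is at most [1 / d + 1 <= 2 / d], and [2 / rho ^+ 2 <= 6]. *)
Lemma size_T n : (size (T n))%:R <= 6 * rho ^- n :> R.
Proof.
have d0 := rhoX_gt0 R n.+2; have p0 := rho_gt0 R.
set d := rho ^+ n.+2 in d0.
pose k (x : R) := Num.truncn (x / d).
have kP x : x \in T n -> (k x)%:R * d <= x < (k x).+1%:R * d.
  move=> xT; have := truncn_itv (divr_ge0 (T_ge0 R _ _ xT) (ltW d0)).
  by rewrite ler_pdivlMr// ltr_pdivrMr.
have kinj : {in T n &, injective k}.
  have lt x y : x \in T n -> y \in T n -> k x = k y -> x < y -> False.
    move=> xT yT e xy; have /andP[h1 h2] := kP x xT; have /andP[h3 h4] := kP y yT.
    have p1 := rhoX_gt0 R n.+3; have h := rhoX R n.+1; have h' := rhoX R n.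
    rewrite e in h1 h2; rewrite -natr1 mulrDl mul1r in h2 h4.
    by have := T_gap R n _ _ xT yT xy; rewrite -/d; case; rewrite /d in h1 h2 h3 h4 *; lra.
  move=> x y xT yT e; have [xy|yx|//] := ltgtP x y.
    by case: (lt _ _ xT yT e xy).
  by case: (lt _ _ yT xT (esym e) yx).
have sz : (size (T n) <= (k 1%R).+1)%N.
  rewrite -(size_map k) -[X in (_ <= X)%N](size_iota 0); apply: uniq_leq_size.
    by rewrite map_inj_in_uniq ?T_uniq.
  move=> _ /mapP[x xT ->]; rewrite mem_iota/= add0n ltnS.
  apply: le_truncn; rewrite ler_pM2r ?invr_gt0//.
  by have := T_le R _ _ xT; have := rhoX_gt0 R n; lra.
have h1 : (k 1)%:R * d <= 1.
  have := truncn_itv (divr_ge0 ler01 (ltW d0)).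
  by rewrite ler_pdivlMr// => /andP[].
have d1 : d <= 1.
  by rewrite /d; apply: exprn_ile1; have /andP[? ?] := rho_bounds R; lra.
apply: (@le_trans _ _ (k 1).+1%:R); first by rewrite ler_nat.
rewrite ler_pdivlMr ?exprn_gt0//.
have : (k 1).+1%:R * d <= 2 by rewrite -natr1 mulrDl mul1r; lra.
rewrite /d -addn2 exprD rho_sqr mulrA.
set w := _ * rho ^+ n => hw.
have w0 : 0 <= w by rewrite mulr_ge0// exprn_ge0// ltW.
by have /andP[? ?] := rho_bounds R; nra.
Qed.

End Counting.

Section FlatFunction.
Variable R : realType.
Local Notation rho := (rho R).
Local Notation T := (shifts R).

(* The first coordinate, up to an affine change, made constant on the
   components of the horizontal edges: a component of level [n.+1] has the form
   [x], [x + rho ^+ n.+2] or [x], [x + rho ^+ n.+2], [x + 2 rho ^+ n.+2]. *)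
Definition run_start n (x : R) := if x - rho ^+ n.+2 \in T n then x - rho ^+ n.+2 else x.

Definition flat (n : nat) (y : R) : R :=
  if n is m.+1 then 1 - 2 * run_start m (if y \in T m then y else y - rho ^+ m.+2)
  else 0.

Lemma flat_horizontal n x : x \in T n -> flat n.+1 x = flat n.+1 (x + rho ^+ n.+2).
Proof.
move=> xT; rewrite /= xT; case: ifP => [xST|_]; last by rewrite addrK.
(* A further edge to the left would give two points of [T n] at distance [2 * rho ^+ n.+2], against
   [T_gap]. *)
congr (1 - 2 * _); rewrite /run_start addrK xT ifF//; apply/negP => h.
have h0 := rhoX R n; have h1 := rhoX R n.+1; have p2 := rhoX_gt0 R n.+2.
have p3 := rhoX_gt0 R n.+3; have h2 := rhoX R n.+2; have p4 := rhoX_gt0 R n.+4.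
have : x - rho ^+ n.+2 < x + rho ^+ n.+2 by lra.
by move=> /(T_gap R n _ _ h xST)[]; lra.
Qed.

Lemma run_start_bounds n x : x - rho ^+ n.+2 <= run_start n x <= x.
Proof. by have := rhoX_gt0 R n.+2; rewrite /run_start; case: ifP => _ h; apply/andP; split; lra. Qed.

Lemma flat_bounds n x : 1 - 2 * x <= flat n.+1 x <= 1 - 2 * x + 4 * rho ^+ n.+2.
Proof.
have p2 := rhoX_gt0 R n.+2.
rewrite /=; case: ifP => _; [have := run_start_bounds n x|
  have := run_start_bounds n (x - rho ^+ n.+2)]; move: (run_start _ _) => v /andP[? ?];
  apply/andP; split; lra.
Qed.

Lemma flat_vertical n x : x \in T n -> (flat n x - flat n.+1 x) ^+ 2 <= 16 * (rho ^+ n) ^+ 2.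
Proof.
move=> xT; have /andP[l1 l2] := flat_bounds n x.
suff : - (4 * rho ^+ n) <= flat n x - flat n.+1 x <= 4 * rho ^+ n.
  move: (flat n x - _) (rho ^+ n) => v w /andP[vl vu].
  have hl : 0 <= v + 4 * w by lra.
  have hu : 0 <= 4 * w - v by lra.
  have := mulr_ge0 hl hu.
  by rewrite (_ : _ * (4 * w - v) = 16 * w ^+ 2 - v ^+ 2) ?subr_ge0//; ring.
case: n xT l1 l2 => [|n] xT l1 l2.
  move: xT; rewrite inE => /eqP xE; rewrite xE in l1 l2 *.
  have h := rho_sqr R; have /andP[? ?] := rho_bounds R.
  by rewrite [flat 0 0]/= expr0; apply/andP; split; lra.
have h0 := rhoX R n.+1; have h1 := rhoX R n.+2; have p1 := rhoX_gt0 R n.+2.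
have p2 := rhoX_gt0 R n.+3; have p0 := rhoX_gt0 R n.+1.
by have /andP[? ?] := flat_bounds n x; apply/andP; split; lra.
Qed.

Lemma flat_adm : adm R flat 0 1 (-1).
Proof.
have p0 := rho_gt0 R; have /andP[_ p1] := rho_bounds R.
split => //.
  apply: cvg_near_cst; exists 1%N => // -[//|n] _; rewrite /= memT0 /run_start ifF ?mulr0 ?subr0//.
  by apply/negP => /T_ge0; have := rhoX_gt0 R n.+2; lra.
apply: (sqr_cvg_zero _ _ _ _ (expr_cvg0 _ rho 36 _)) => [|n]; first by apply/andP; split; lra.
have q0 := rhoX_gt0 R n.
have q1 : rho ^+ n <= 1 by apply: exprn_ile1; lra.
suff : 0 <= flat n (1 - rho ^+ n) - -1 <= 6 * rho ^+ n.
  move: (_ - -1) => v /andP[v0 v1].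
  apply: (@le_trans _ _ ((6 * rho ^+ n) ^+ 2)); first by rewrite ler_pXn2r// nnegrE; lra.
  by move: (rho ^+ n) q0 q1 => w q0 q1; nra.
case: n q0 q1 => [|n] q0 q1; first by rewrite /= expr0; lra.
have /andP[l1 l2] := flat_bounds n (1 - rho ^+ n.+1).
have h := rhoX R n.+1; have p3 := rhoX_gt0 R n.+3.
by apply/andP; split; lra.
Qed.

(** Horizontal edges carry nothing, so [c] does not appear in the bound. On level [i], at most
    [6 * rho ^- i] cells carry at most [32 * rho ^+ (2 * i)] each. *)
Lemma flat_energy (c r : R) N : rho < r -> en R 1 1 c r flat N <= 192 / (1 - rho / r).
Proof.
move=> rr; have p0 := rho_gt0 R; have r0 : 0 < r by lra.
have q01 : 0 <= rho / r < 1.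
  by apply/andP; split; [apply: divr_ge0; lra|rewrite ltr_pdivrMr// mul1r].
apply: (@le_trans _ _ (192 * \sum_(i < N) (rho / r) ^+ i)); last first.
  by rewrite ler_pM2l// geo_sum_le.
rewrite mulr_sumr; apply: ler_sum => i _.
have h : lev R 1 1 c flat i <= 192 * rho ^+ i.
  apply: (@le_trans _ _ (\sum_(x <- T i) 32 * (rho ^+ i) ^+ 2)).
    rewrite /lev big_seq [leRHS]big_seq; apply: ler_sum => x xT.
    have e := flat_horizontal i x xT; have v := flat_vertical i x xT.
    rewrite /cell /tri -e; move: (flat i x) (flat i.+1 x) v => p s v.
    by rewrite subrr expr0n/= mulr0 addr0 !mul1r; lra.
  rewrite big_const_seq count_predT iter_addr_0 -[leLHS]mulr_natl.
  have q0 := rhoX_gt0 R i.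
  have := size_T R i; rewrite ler_pdivlMr// => hs.
  rewrite (_ : _ * _ = 32 * rho ^+ i * ((size (T i))%:R * rho ^+ i)); last by ring.
  apply: (@le_trans _ _ (32 * rho ^+ i * 6)); first by rewrite ler_pM2l//; lra.
  lra.
apply: le_trans (ler_wpM2l _ h) _; first by rewrite invr_ge0 exprn_ge0// ltW.
by rewrite (expr_div_n rho) mulrCA [_ * rho ^+ i]mulrC.
Qed.

End FlatFunction.

Section Existence.
Variable R : realType.
Local Notation rho := (rho R).

Lemma lipschitz_continuous (f : R -> R) (L : R) : 0 <= L ->
  (forall x y, x <= y -> `|f x - f y| <= L * (y - x)) -> continuous f.
Proof.
move=> L0 lip x; apply/cvgrPdist_le => e e0.
have d0 : 0 < e / (L + 1) by apply: divr_gt0 => //; lra.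
near=> y.
have h : `|f x - f y| <= L * `|x - y|.
  have [xy|yx] := leP x y.
    by rewrite [X in L * X]distrC [X in L * X]ger0_norm ?subr_ge0//; apply: lip.
  by rewrite distrC [X in L * X]gtr0_norm ?subr_gt0//; apply: lip; apply: ltW.
apply: le_trans h _.
have : `|x - y| <= e / (L + 1) by near: y; apply: cvgr_dist_le => //; exact: cvg_id.
rewrite ler_pdivlMr; last by lra.
by have := normr_ge0 (x - y); nra.
Unshelve. all: by end_near. Qed.

Section Fixed.
Variable r : R.
Hypothesis rr : rho < r < 1.
Local Notation t c := (tr R 1 1 c r).

(** The square of [y - z] is at most twice the sum of the squared drops on the other two edges,
    which have coefficient 1 and absorb the change from [c] to [d]. *)
Lemma tr_horizontal_le c d u0 u1 u2 : 0 <= c -> c <= d ->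
  t c u0 u1 u2 <= t d u0 u1 u2 <= (1 + 2 * (d - c)) * t c u0 u1 u2.
Proof.
move=> c0 cd; have d0 : 0 <= d by apply: le_trans cd.
have hc := conductances11 R c c0; have hd := conductances11 R d d0.
apply/andP; split.
  rewrite -[leRHS]mul1r; apply: tr_compare => // x y z.
  rewrite mul1r /tri lerD2l; apply: ler_wpM2r => //; exact: sqr_ge0.
apply: tr_compare => //; first by lra.
move=> x y z; rewrite /tri -subr_ge0.
have -> : (1 + 2 * (d - c)) * (1 * (x - y) ^+ 2 + 1 * (x - z) ^+ 2 + c * (y - z) ^+ 2) -
  (1 * (x - y) ^+ 2 + 1 * (x - z) ^+ 2 + d * (y - z) ^+ 2) =
  (d - c) * ((x - y + (x - z)) ^+ 2 + 2 * (c * (y - z) ^+ 2)) by ring.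
apply: mulr_ge0; first by lra.
by do ?[apply: sqr_ge0 | apply: addr_ge0 | apply: mulr_ge0].
Qed.

(** Extends functions of [c] continuously from [[0, B]] to the line, so that no negative coefficient
    reaches the trace. *)
Definition clamp (B c : R) := Num.max 0 (Num.min c B).

Lemma clampP B c : 0 <= B -> 0 <= clamp B c <= B.
Proof.
move=> B0; rewrite /clamp le_max lexx/= ge_max B0/= ge_min lexx orbT//.
Qed.

Lemma clamp_id B c : 0 <= c <= B -> clamp B c = c.
Proof. by move=> /andP[c0 cB]; rewrite /clamp min_l// max_r. Qed.

Lemma clamp_lip B c d : c <= d -> 0 <= clamp B d - clamp B c <= d - c.
Proof.
move=> cd; rewrite /clamp /Num.max /Num.min.
by do ![case: ifP => /=]; move=> *; apply/andP; split; lra.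
Qed.

Lemma tr_clamp_continuous B u0 u1 u2 : 0 <= B ->
  continuous (fun c => t (clamp B c) u0 u1 u2).
Proof.
move=> B0; have t0 := tr_ge0 R 1 1 B r u0 u1 u2.
apply: (lipschitz_continuous _ (2 * t B u0 u1 u2)); first by rewrite mulr_ge0.
move=> c d cd /=; have /andP[l0 l1] := clamp_lip B c d cd.
have /andP[c0 cB] := clampP B c B0; have /andP[d0 dB] := clampP B d B0.
have cd' : clamp B c <= clamp B d by lra.
have /andP[h1 h2] := tr_horizontal_le _ _ u0 u1 u2 c0 cd'.
have /andP[h3 _] := tr_horizontal_le _ _ u0 u1 u2 c0 cB.
have tc0 := tr_ge0 R 1 1 (clamp B c) r u0 u1 u2.
rewrite distrC ger0_norm ?subr_ge0//.
move: h1 h2 h3 tc0 t0 l0 l1.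
move: (t (clamp B c) _ _ _) (t (clamp B d) _ _ _) (t B _ _ _) => tc td tB.
move: (clamp B c) (clamp B d) => cc cd2 *.
by nra.
Qed.

Lemma eigenform_exists : exists b lam : R, [/\ 0 <= b, 0 < lam &
  forall u0 u1 u2, t b u0 u1 u2 = lam * tri R 1 1 b u0 u1 u2].
Proof.
have [rr0 rr1] := andP rr; have p0 := rho_gt0 R.
have r01 : 0 < r < 1 by apply/andP; split; lra.
pose M := 192 / (1 - rho / r); pose m := t 0 1 0 0.
have m0 : 0 < m.
  have := tr_corner_le R 1 1 0 r (conductances11 R 0 (lexx _)) rr 1 0 0.
  rewrite -/m subr0 expr1n mulr1; apply: lt_le_trans.
  by rewrite mulr_gt0 ?kap_gt0 ?subr_gt0//; apply: conductances11.
have M0 : 0 <= M.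
  by have := flat_energy R 0 r 0 rr0; rewrite en0.
have tM c : 0 <= c -> t c 0 1 (-1) <= M.
  move=> c0; apply: (tr_le R _ _ _ _ (flat R)); first exact: flat_adm.
  by move=> N; apply: flat_energy.
have tm c : 0 <= c -> m <= t c 1 0 0.
  by move=> c0; have /andP[] := tr_horizontal_le 0 c 1 0 0 (lexx _) c0.
(* Chosen so that [2 * B * m = M]: at [B] the last term of [h] outweighs the first. *)
pose B := M / (2 * m).
have B0 : 0 <= B by rewrite divr_ge0// mulr_ge0// ltW.
(* The form with coefficients 1, 1, [c] takes the values 2 on [(1, 0, 0)] and [2 + 4 * c] on
   [(0, 1, -1)]; [h] vanishes when the trace has the same ratio [1 + 2 * c]. *)
pose h c := t (clamp B c) 0 1 (-1) - t (clamp B c) 1 0 0 - 2 * clamp B c * t (clamp B c) 1 0 0.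
have hc : continuous h.
  move=> x; apply: cvgB; first by apply: cvgB; apply: tr_clamp_continuous.
  apply: cvgM; last exact: tr_clamp_continuous.
  apply: cvgMr; apply: (lipschitz_continuous (clamp B) 1) => // c d cd.
  by have /andP[? ?] := clamp_lip B c d cd; rewrite distrC ger0_norm// mul1r.
have h0 : 0 <= h 0.
  rewrite /h clamp_id ?lexx// mulr0 mul0r subr0 subr_ge0.
  rewrite -tr_flip//; apply: tr_markov => //; exact: conductances11.
have hB : h B <= 0.
  rewrite /h clamp_id ?lexx ?B0//; have := tM B B0; have := tm B B0.
  have := tr_ge0 R 1 1 B r 1 0 0.
  have : 2 * B * m = M by rewrite /B; field; rewrite gt_eqF.
  nra.
have [||b] := @IVT R h 0 B 0 B0.
- exact: continuous_subspaceT.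
- by rewrite ge_min le_max h0 hB orbT.
rewrite in_itv/= => /andP[b0 bB]; rewrite /h clamp_id ?b0// => hb.
exists b, (t b 1 0 0 / 2); split => //.
  by apply: divr_gt0 => //; apply: lt_le_trans m0 (tm _ _).
move=> u0 u1 u2; rewrite tr_symmetric// /tri.
have -> : t b 0 1 (-1) = (1 + 2 * b) * t b 1 0 0 by lra.
by field.
Qed.

End Fixed.
End Existence.

(** * Comparison of eigenvalues *)

Section Comparison.
Variable R : realType.
Local Notation rho := (rho R).
Local Notation Tri := (tri R).
Local Notation Tr := (tr R).
Implicit Types (a b c r x y z : R).

Definition eig r lam a b c := forall u0 u1 u2, Tr a b c r u0 u1 u2 = lam * Tri a b c u0 u1 u2.

Lemma tri_gt0 a b c y z : conductances R a b c -> y != 0 \/ z != 0 -> 0 < Tri a b c 0 y z.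
Proof.
move=> h; have k0 := kap_gt0 R _ _ _ h; case=> n0.
  by apply: lt_le_trans (kap_tri R _ _ _ 0 y z h); rewrite sub0r sqrrN mulr_gt0// exprn_even_gt0.
by apply: lt_le_trans (kap_tri_right R _ _ _ 0 y z h); rewrite sub0r sqrrN mulr_gt0// exprn_even_gt0.
Qed.

Lemma tri_scale a b c k x y z : Tri a b c (k * x) (k * y) (k * z) = k ^+ 2 * Tri a b c x y z.
Proof. by rewrite /tri; ring. Qed.

Lemma tri_shift a b c x y z : Tri a b c x y z = Tri a b c 0 (y - x) (z - x).
Proof. by rewrite /tri; ring. Qed.

Lemma tri_continuous a b c (f g h : R -> R) : continuous f -> continuous g -> continuous h ->
  continuous (fun s => Tri a b c (f s) (g s) (h s)).
Proof.
move=> cf cg ch s.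
have sq (u v : R -> R) : continuous u -> continuous v ->
    (fun s => (u s - v s) ^+ 2) x @[x --> s] --> (u s - v s) ^+ 2.
  move=> hu hv; apply: (@cvg_comp _ _ _ (fun s => u s - v s) (fun x => x ^+ 2)); last exact: exprn_continuous.
  by apply: cvgB; [exact: hu|exact: hv].
by rewrite /tri; apply: cvgD; [apply: cvgD|]; apply: cvgMr; apply: sq.
Qed.

(** Modulo constants and scaling, triples form a projective line, covered by the compact charts
    [(1, s)] and [(s, 1)] with [-1 <= s <= 1]; [k] is the larger of the two maxima of the
    quotient. *)
Lemma tri_touching a b c a' b' c' : conductances R a b c -> conductances R a' b' c' ->
  exists k p q, [/\ 0 < k, 0 < Tri a' b' c' 0 p q,
    Tri a b c 0 p q = k * Tri a' b' c' 0 p q &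
    forall x y z, Tri a b c x y z <= k * Tri a' b' c' x y z].
Proof.
move=> h h'.
pose F s := Tri a b c 0 1 s / Tri a' b' c' 0 1 s.
pose G s := Tri a b c 0 s 1 / Tri a' b' c' 0 s 1.
have p1 s : 0 < Tri a' b' c' 0 1 s by apply: tri_gt0 => //; left; apply: oner_neq0.
have p2 s : 0 < Tri a' b' c' 0 s 1 by apply: tri_gt0 => //; right; apply: oner_neq0.
have cst0 (u : R) : continuous (fun _ : R => u) by move=> s; apply: cvg_cst.
have idc : continuous (fun s : R => s) by move=> s; apply: cvg_id.
have cF : continuous F.
  move=> s; apply: cvgM; first exact: tri_continuous.
  by apply: cvgV; [rewrite gt_eqF|apply: tri_continuous].
have cG : continuous G.
  move=> s; apply: cvgM; first exact: tri_continuous.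
  by apply: cvgV; [rewrite gt_eqF|apply: tri_continuous].
have l11 : -1 <= 1 :> R by lra.
have [s0 s0I hF] := EVT_max l11 (continuous_subspaceT cF).
have [s1 s1I hG] := EVT_max l11 (continuous_subspaceT cG).
have bnd k : (forall s, -1 <= s <= 1 -> F s <= k) -> (forall s, -1 <= s <= 1 -> G s <= k) ->
    forall x y z, Tri a b c x y z <= k * Tri a' b' c' x y z.
  move=> bF bG x y z; rewrite tri_shift [in leRHS]tri_shift.
  move: (y - x) (z - x) => {x y z} y z.
  have key (w v : R) : `|v| <= `|w| -> w != 0 -> -1 <= w^-1 * v <= 1.
    move=> vw w0; have : `|w^-1 * v| <= 1.
      have e : w * (w^-1 * v) = v by rewrite mulrA divff// mul1r.
      have w0' : 0 < `|w| by rewrite normr_gt0.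
      by move: vw; rewrite -{1}e normrM -[leRHS]mulr1 ler_pM2l.
    by rewrite ler_norml.
  have [yz|zy] := leP `|z| `|y|.
    have [y0|y0] := eqVneq y 0.
      move: yz; rewrite y0 normr0 normr_le0 => /eqP->.
      by rewrite /tri !subrr !expr0n/= !mulr0 !addr0 mulr0.
    have := bF _ (key _ _ yz y0); rewrite /F ler_pdivrMr// => hk.
    have -> : z = y * (y^-1 * z) by rewrite mulrA divff// mul1r.
    rewrite -[in X in Tri a b c X]( mulr0 y) -[X in Tri a b c _ X _](mulr1 y).
    rewrite -[in X in Tri a' b' c' X]( mulr0 y) -[X in Tri a' b' c' _ X _](mulr1 y).
    by rewrite !tri_scale mulrCA; apply: ler_wpM2l => //; apply: sqr_ge0.
  have z0 : z != 0 by rewrite -normr_gt0; apply: le_lt_trans zy.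
  have := bG _ (key _ _ (ltW zy) z0); rewrite /G ler_pdivrMr// => hk.
  have -> : y = z * (z^-1 * y) by rewrite mulrA divff// mul1r.
  rewrite -[in X in Tri a b c X]( mulr0 z) -[X in Tri a b c _ _ X](mulr1 z).
  rewrite -[in X in Tri a' b' c' X]( mulr0 z) -[X in Tri a' b' c' _ _ X](mulr1 z).
  by rewrite !tri_scale mulrCA; apply: ler_wpM2l => //; apply: sqr_ge0.
have [FG|GF] := leP (F s0) (G s1).
  exists (G s1), s1, 1; split => //.
  - by apply: divr_gt0 => //; apply: tri_gt0 => //; right; apply: oner_neq0.
  - by rewrite /G divfK// gt_eqF.
  - by apply: bnd => s sI; [apply: le_trans FG; apply: hF|apply: hG]; rewrite in_itv.
exists (F s0), 1, s0; split => //.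
- by apply: divr_gt0 => //; apply: tri_gt0 => //; left; apply: oner_neq0.
- by rewrite /F divfK// gt_eqF.
- by apply: bnd => s sI; [apply: hF|apply: le_trans (ltW GF); apply: hG]; rewrite in_itv.
Qed.

Section Eigenvalue.
Variables (r lam a b c a' b' c' : R).
Hypotheses (rr : rho < r < 1) (abc : conductances R a b c)
  (abc' : conductances R a' b' c') (el : eig r lam a b c).

(** A bound of Collatz-Wielandt type. Write [D], [D'] for the two forms. At a touching triple
    [lam * k * D' = lam * D] is the trace of [D], hence at most [k] times the trace of [D'], hence
    at most [k * mu * D']. *)
Lemma eig_le_of_trace_le mu :
  (forall u0 u1 u2, Tr a' b' c' r u0 u1 u2 <= mu * Tri a' b' c' u0 u1 u2) -> lam <= mu.
Proof.
move=> hmu; have [k [p [q [k0 t0 e le]]]] := tri_touching _ _ _ _ _ _ abc abc'.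
have := tr_compare R a b c r rr a' b' c' k 0 p q abc' (ltW k0) le.
rewrite el e => h; have := le_trans h (ler_wpM2l (ltW k0) (hmu 0 p q)).
by rewrite mulrCA ler_pM2l// ler_pM2r.
Qed.

Lemma eig_ge_of_trace_ge mu :
  (forall u0 u1 u2, mu * Tri a' b' c' u0 u1 u2 <= Tr a' b' c' r u0 u1 u2) -> mu <= lam.
Proof.
move=> hmu; have [k [p [q [k0 t0 e le]]]] := tri_touching _ _ _ _ _ _ abc' abc.
have := tr_compare R a' b' c' r rr a b c k 0 p q abc (ltW k0) le.
rewrite el => h; have := le_trans (hmu 0 p q) h.
by rewrite e mulrCA ler_pM2l// ler_pM2r.
Qed.

End Eigenvalue.

Lemma eig_unique r lam lam' a b c a' b' c' : rho < r < 1 ->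
  conductances R a b c -> conductances R a' b' c' ->
  eig r lam a b c -> eig r lam' a' b' c' -> lam = lam'.
Proof.
move=> rr h h' e e'; apply/eqP; rewrite eq_le.
apply/andP; split; first by apply: (eig_le_of_trace_le r lam a b c a' b' c') => // *; rewrite e'.
by apply: (eig_le_of_trace_le r lam' a' b' c' a b c) => // *; rewrite e.
Qed.

Lemma eig_nonincreasing r s lam mu a b c a' b' c' : rho < r -> r <= s -> s < 1 ->
  conductances R a b c -> conductances R a' b' c' ->
  eig r lam a b c -> eig s mu a' b' c' -> mu <= lam.
Proof.
move=> r0 rs s1 h h' e e'.
have rr : rho < r < 1 by apply/andP; split; lra.
have ss : rho < s < 1 by apply/andP; split; lra.
apply: (eig_le_of_trace_le s mu a' b' c' a b c) => // u0 u1 u2.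
by rewrite -e; apply: tr_param.
Qed.

End Comparison.

(** * Uniqueness of the eigenform *)

Section Harmonic.
Variable R : realType.
Local Notation rho := (rho R).
Local Notation T := (shifts R).
Local Notation Tr := (tr R).
Local Notation En := (en R).
Local Notation Lev := (lev R).
Implicit Types (x y : R) (n m : nat) (g : nat -> R -> R).

Lemma big_indicator (I : eqType) (s : seq I) (G : I -> R) (y : I) : uniq s ->
  \sum_(x <- s) (x == y)%:R * G x = (y \in s)%:R * G y.
Proof.
move=> us; have [ys|ys] := boolP (y \in s).
  rewrite (bigD1_seq y)//= eqxx big1 ?addr0// => x /negbTE->.
  by rewrite mul0r.
rewrite mul0r big_seq big1// => x xs; case: eqP => [e|_]; last by rewrite mul0r.
by move: ys; rewrite -e xs.
Qed.

Section Fixed.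
Variables (a b c r : R).
Hypotheses (abc : conductances R a b c) (rr : rho < r < 1).

(** Half the derivative of the energy of a cell in its top value; [flow1] and [flow2] belong to the
    bottom vertices, and the three sum to 0. *)
Definition flow0 g n x := a * (g n x - g n.+1 x) + b * (g n x - g n.+1 (x + rho ^+ n.+2)).
Definition flow1 g n x :=
  a * (g n.+1 x - g n x) + c * (g n.+1 x - g n.+1 (x + rho ^+ n.+2)).
Definition flow2 g n x :=
  b * (g n.+1 (x + rho ^+ n.+2) - g n x) + c * (g n.+1 (x + rho ^+ n.+2) - g n.+1 x).

(** The vertex [y] of level [m.+1] can be the left bottom vertex of the cell [y] and the right one
    of [y - rho ^+ m.+2]; it is both where words are identified. *)
Definition inflow g m y :=
  (y \in T m)%:R * flow1 g m y + (y - rho ^+ m.+2 \in T m)%:R * flow2 g m (y - rho ^+ m.+2).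

Definition perturb m y (e : R) g n x :=
  g n x + if (n == m) && (x == y) then e else 0.

Lemma perturb_other m y e g n : n != m -> perturb m y e g n =1 g n.
Proof. by move=> /negbTE nm x; rewrite /perturb nm addr0. Qed.

Lemma quadratic_pos (L C : R) : 0 <= C ->
  (forall e, 0 <= 2 * e * L + C * e ^+ 2) -> L = 0.
Proof.
move=> C0 h; have := h (- L / (C + 1)).
have C1 : 0 < C + 1 by lra.
have -> : 2 * (- L / (C + 1)) * L + C * (- L / (C + 1)) ^+ 2 =
  - ((C + 2) * L ^+ 2) / (C + 1) ^+ 2 by field; rewrite gt_eqF.
rewrite pmulr_lge0; last by rewrite invr_gt0 exprn_gt0.
have := sqr_ge0 L; rewrite oppr_ge0 => h1 h2.
by apply/eqP; rewrite -sqrf_eq0; apply/eqP; nra.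
Qed.

Lemma lev_perturb_below m y e g :
  Lev a b c (perturb m.+1 y e g) m <= Lev a b c g m + 2 * e * inflow g m y
    + 2 * (a + b + 2 * c) * e ^+ 2.
Proof.
have [a0 b0 c0 _] := abc.
have Cge : 0 <= a + b + 2 * c by rewrite addr_ge0 ?addr_ge0// mulr_ge0.
pose d1 x : R := (x == y)%:R; pose d2 x : R := (x == y - rho ^+ m.+2)%:R.
have E x : cell R a b c (perturb m.+1 y e g) m x <= cell R a b c g m x +
    (2 * e * (d1 x * flow1 g m x + d2 x * flow2 g m x)
     + (a + b + 2 * c) * e ^+ 2 * (d1 x * 1 + d2 x * 1)).
  have b1 : perturb m.+1 y e g m.+1 x = g m.+1 x + e * d1 x.
    by rewrite /perturb eqxx/= /d1; case: ifP => _; rewrite ?mulr1 ?mulr0.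
  have b2 : perturb m.+1 y e g m.+1 (x + rho ^+ m.+2) = g m.+1 (x + rho ^+ m.+2) + e * d2 x.
    by rewrite /perturb eqxx/= /d2 eq_sym -subr_eq eq_sym; case: ifP => _; rewrite ?mulr1 ?mulr0.
  rewrite /cell b1 b2 perturb_other; last by rewrite neq_ltn ltnSn.
  have d11 : d1 x ^+ 2 = d1 x by rewrite /d1; case: eqP; rewrite ?expr1n ?expr0n.
  have d22 : d2 x ^+ 2 = d2 x by rewrite /d2; case: eqP; rewrite ?expr1n ?expr0n.
  have d1p : 0 <= d1 x by rewrite /d1 ler0n.
  have d2p : 0 <= d2 x by rewrite /d2 ler0n.
  rewrite /flow1 /flow2 -subr_ge0 /tri.
  move: (g m x) (g m.+1 x) (g m.+1 (x + rho ^+ m.+2)) (d1 x) (d2 x) d11 d22 d1p d2p =>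
    p0 p1 p2 s1 s2 d11 d22 d1p d2p.
  rewrite [X in 0 <= X](_ : _ = e ^+ 2 * (b * s1 + a * s2 + c * (s1 + s2) ^+ 2
     + (a + 2 * c) * (s1 - s1 ^+ 2) + (b + 2 * c) * (s2 - s2 ^+ 2))); last by ring.
  apply: mulr_ge0; first exact: sqr_ge0.
  by rewrite d11 d22 !subrr !mulr0 !addr0;
    do ?[apply: sqr_ge0 | apply: addr_ge0 | apply: mulr_ge0].
rewrite /lev -addrA; apply: le_trans (ler_sum _ (fun x _ => E x)) _.
rewrite big_split/= lerD2l big_split/= -!mulr_sumr !big_split/=.
rewrite !big_indicator ?T_uniq// /inflow lerD2l.
have i1 (B : bool) : B%:R <= 1 :> R by case: B.
have -> : 2 * (a + b + 2 * c) * e ^+ 2 = (a + b + 2 * c) * e ^+ 2 * 2 by ring.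
apply: ler_wpM2l; first by rewrite mulr_ge0 ?sqr_ge0.
by have := i1 (y \in T m); have := i1 (y - rho ^+ m.+2 \in T m); rewrite !mulr1; lra.
Qed.

Lemma lev_perturb_at m y e g : y \in T m ->
  Lev a b c (perturb m y e g) m <= Lev a b c g m + 2 * e * flow0 g m y + (a + b) * e ^+ 2.
Proof.
move=> yT; rewrite /lev -addrA.
rewrite (bigD1_seq y) ?T_uniq//= [X in _ <= X + _](bigD1_seq y) ?T_uniq//=.
rewrite [leRHS]addrAC; apply: lerD.
  rewrite le_eqVlt; apply/orP; left; apply/eqP.
  rewrite /cell !(perturb_other _ _ _ _ m.+1) ?neq_ltn ?ltnSn ?orbT//.
  by rewrite /perturb !eqxx/= /tri /flow0; ring.
apply: ler_sum => x xy; rewrite /cell !(perturb_other _ _ _ _ m.+1) ?neq_ltn ?ltnSn ?orbT//.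
by rewrite /perturb (negbTE xy) andbF addr0.
Qed.

(** Changing one value affects two levels only, of weights [r ^- m = r * r ^- m.+1] and [r ^- m.+1],
    and leaves the limits at the corners unchanged. The first variation must vanish. *)
Lemma minimizer_harmonic g u0 u1 u2 m y : adm R g u0 u1 u2 ->
  (forall N, En a b c r g N <= Tr a b c r u0 u1 u2) -> y \in T m.+1 ->
  r * inflow g m y + flow0 g m.+1 y = 0.
Proof.
move=> ga gE yT; have [a0 b0 c0 _] := abc; have p0 := rho_gt0 R.
have r0 : 0 < r by case/andP: rr; lra.
pose C := r * (2 * (a + b + 2 * c)) + (a + b).
have C0 : 0 <= C.
  have h : 0 <= a + b + 2 * c by rewrite addr_ge0 ?addr_ge0// mulr_ge0.
  apply: addr_ge0; last exact: addr_ge0.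
  by apply: mulr_ge0; [exact: ltW|exact: mulr_ge0].
apply: (quadratic_pos _ C C0) => e.
set X := 2 * e * _ + _.
have X_en N : En a b c r (perturb m.+1 y e g) (m + 2 + N) <=
    En a b c r g (m + 2 + N) + r ^- m.+1 * X.
  elim: N => [|N IH].
    rewrite addn0 addn2 !enS.
    have -> : En a b c r (perturb m.+1 y e g) m = En a b c r g m.
      apply: eq_bigr => i _; congr (_ * _); apply: eq_bigr => x _; rewrite /cell.
      have im : (i < m)%N := ltn_ord i.
      by rewrite !perturb_other// neq_ltn ltnS ?(ltnW im)// ltnS im.
    have h1 := lev_perturb_below m y e g; have h2 := lev_perturb_at m.+1 y e g yT.
    have i1 : 0 <= r ^- m.+1 by rewrite invr_ge0 exprn_ge0// ltW.
    have rm : r ^- m = r * r ^- m.+1.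
      by rewrite exprS invfM mulrA divff ?mul1r// gt_eqF.
    rewrite rm; move: (r ^- m.+1) i1 => w w0.
    have w1 : 0 <= r * w by rewrite mulr_ge0// ltW.
    apply: le_trans (lerD (lerD (lexx _) (ler_wpM2l w1 h1)) (ler_wpM2l w0 h2)) _.
    by rewrite le_eqVlt; apply/orP; left; apply/eqP; rewrite /X /C; ring.
  rewrite addnS !enS.
  have -> : Lev a b c (perturb m.+1 y e g) (m + 2 + N) = Lev a b c g (m + 2 + N).
    have mN : (m.+1 < m + 2 + N)%N by rewrite addn2 leq_addr.
    apply: eq_bigr => x _.
    by rewrite /cell !perturb_other ?gtn_eqF// ltnS ltnW.
  by rewrite addrAC lerD2r.
have adm' : adm R (perturb m.+1 y e g) u0 u1 u2.
  case: ga => [h0 h1 h2]; split.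
  - by rewrite perturb_other.
  - apply: cvg_trans h1; apply: near_eq_cvg; exists m.+2 => // n /= hn.
    by rewrite perturb_other// neq_ltn hn orbT.
  - apply: cvg_trans h2; apply: near_eq_cvg; exists m.+2 => // n /= hn.
    by rewrite perturb_other// neq_ltn hn orbT.
have : Tr a b c r u0 u1 u2 <= Tr a b c r u0 u1 u2 + r ^- m.+1 * X.
  apply: (tr_le R _ _ _ _ _ _ _ _ _ adm') => N.
  apply: (@le_trans _ _ (En a b c r (perturb m.+1 y e g) (m + 2 + N))).
    by apply: en_nondecreasing => //; apply: leq_addl.
  by apply: le_trans (X_en N) _; rewrite lerD2r.
by rewrite lerDl pmulr_rge0// invr_gt0 exprn_gt0.
Qed.

End Fixed.
End Harmonic.

(** * Propagation of a touching minimizer and the two word identifications *)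

Section Rigidity.
Variable R : realType.
Local Notation rho := (rho R).
Local Notation T := (shifts R).
Implicit Types (x y : R) (n m : nat).

Section Propagation.
Variables (a b c r p q : R) (f B : nat -> R -> R).
Hypotheses (abc : conductances R a b c) (rr : rho < r < 1).
Hypothesis left_value : forall n x, x \in T n -> f n.+1 x = f n x + B n x * p.
Hypothesis right_value : forall n x, x \in T n ->
  f n.+1 (x + rho ^+ n.+2) = f n x + B n x * q.
Hypothesis harmonic : forall m y, y \in T m.+1 ->
  r * inflow R a b c f m y + flow0 R a b f m.+1 y = 0.
Hypothesis adm_f : adm R f 0 p q.
Hypothesis pq0 : p != 0 \/ q != 0.

(** Flows at the vertices of a cell with values [0, p, q]; on the cell [x] of level [n] they are
    multiplied by the amplitude [B n x]. *)
Let h0 := - (a * p + b * q).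
Let h1 := a * p + c * (p - q).
Let h2 := b * q + c * (q - p).

Let r0 : 0 < r.
Proof. by have := rho_gt0 R; case/andP: rr; lra. Qed.

Let r1 : r < 1.
Proof. by case/andP: rr. Qed.

Lemma flow0E n x : x \in T n -> flow0 R a b f n x = B n x * h0.
Proof. by move=> xT; rewrite /flow0 (left_value _ _ xT) (right_value _ _ xT) /h0; ring. Qed.

Lemma flow1E n x : x \in T n -> flow1 R a c f n x = B n x * h1.
Proof. by move=> xT; rewrite /flow1 (left_value _ _ xT) (right_value _ _ xT) /h1; ring. Qed.

Lemma flow2E n x : x \in T n -> flow2 R b c f n x = B n x * h2.
Proof. by move=> xT; rewrite /flow2 (left_value _ _ xT) (right_value _ _ xT) /h2; ring. Qed.

Lemma node_left m y : y \in T m -> y - rho ^+ m.+2 \notin T m ->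
  r * (B m y * h1) + B m.+1 y * h0 = 0.
Proof.
move=> yT yN; have yT' := memT_left R _ _ yT; have := harmonic m y yT'.
by rewrite /inflow yT (negbTE yN) mul0r addr0 mul1r flow0E// flow1E.
Qed.

Lemma node_right m x : x \in T m -> x + rho ^+ m.+2 \notin T m ->
  r * (B m x * h2) + B m.+1 (x + rho ^+ m.+2) * h0 = 0.
Proof.
move=> xT xN; have xT' := memT_right R _ _ xT; have := harmonic m _ xT'.
by rewrite /inflow addrK xT (negbTE xN) mul0r add0r mul1r flow0E// flow2E.
Qed.

Lemma node_both m x : x \in T m -> x + rho ^+ m.+2 \in T m ->
  r * (B m (x + rho ^+ m.+2) * h1 + B m x * h2) + B m.+1 (x + rho ^+ m.+2) * h0 = 0.
Proof.
move=> xT yT; have xT' := memT_right R _ _ xT; have := harmonic m _ xT'.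
by rewrite /inflow addrK xT yT !mul1r flow0E// flow1E// flow2E.
Qed.

Lemma left_side n : r * (B n 0 * h1) + B n.+1 0 * h0 = 0.
Proof.
apply: node_left; first exact: memT0.
by apply/negP => /T_ge0; have := rhoX_gt0 R n.+2; lra.
Qed.

Lemma last_succ n : 1 - rho ^+ n.+1 = 1 - rho ^+ n + rho ^+ n.+2.
Proof. by have := rhoX R n; lra. Qed.

Lemma right_side n : r * (B n (1 - rho ^+ n) * h2) + B n.+1 (1 - rho ^+ n.+1) * h0 = 0.
Proof.
rewrite last_succ; apply: node_right; first exact: memT_last.
by apply/negP => /T_le; have := rhoX_gt0 R n.+2; lra.
Qed.

Lemma left_side_step n : f n.+1 0 = f n 0 + B n 0 * p.
Proof. by rewrite left_value// memT0. Qed.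

Lemma right_side_step n :
  f n.+1 (1 - rho ^+ n.+1) = f n (1 - rho ^+ n) + B n (1 - rho ^+ n) * q.
Proof. by rewrite last_succ right_value// memT_last. Qed.

Lemma cvg_const_steps (u : nat -> R) l : u @ \oo --> l ->
  u 0%N = 0 -> (forall n, u n.+1 = u n) -> l = 0.
Proof.
move=> ul u0 us; have e n : u n = 0 by elim: n => // n IH; rewrite us.
apply/esym; apply: (cvg_unique _ _ ul) => //.
by apply: cvg_near_cst; apply: nearW.
Qed.

(** If [h0 = 0], then [h2 = - h1], nonzero because the energy of [(0, p, q)] is positive. The
    balance along each side then forces zero amplitudes, so [f] is constant there and
    [p = q = 0]. *)
Lemma h0_neq0 : h0 != 0.
Proof.
apply/eqP => z0; have [f0 f1 f2] := adm_f.
have rn : r != 0 by rewrite gt_eqF.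
have E0 : 0 < p * h1 + q * h2.
  have := tri_gt0 R a b c p q abc pq0; rewrite /h1 /h2 /tri.
  by rewrite (_ : p * _ + _ = a * (0 - p) ^+ 2 + b * (0 - q) ^+ 2 + c * (p - q) ^+ 2)//; ring.
have hs : h2 = - h1.
  have s0 : h0 + h1 + h2 = 0 by rewrite /h0 /h1 /h2; ring.
  by move: s0; rewrite z0 add0r => /eqP; rewrite addrC addr_eq0 => /eqP.
have h1n : h1 != 0 by apply/eqP => z; move: E0; rewrite hs z oppr0 !mulr0 addr0 ltxx.
have h2n : h2 != 0 by rewrite hs oppr_eq0.
have p0 : p = 0.
  apply: (cvg_const_steps _ _ f1 f0) => n; have := left_side n.
  rewrite z0 mulr0 addr0 => /eqP; rewrite !mulf_eq0 (negbTE rn) (negbTE h1n) orbF/=.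
  by move=> /eqP e; rewrite left_side_step e mul0r addr0.
have q0 : q = 0.
  apply: (cvg_const_steps _ _ f2) => [|n]; first by rewrite expr0 subrr.
  have := right_side n.
  rewrite z0 mulr0 addr0 => /eqP; rewrite !mulf_eq0 (negbTE rn) (negbTE h2n) orbF/=.
  by move=> /eqP e; rewrite right_side_step e mul0r addr0.
by case: pq0; rewrite ?p0 ?q0 eqxx.
Qed.

Let al := - h1 / h0.
Let be := - h2 / h0.

Lemma al_be : al + be = 1.
Proof.
have e : - h1 + - h2 = h0 by rewrite /h0 /h1 /h2; ring.
by rewrite /al /be -mulrDl e divff// h0_neq0.
Qed.

(* [al] and [be] are the shares of the flow through a cell that leave by its
   left and by its right bottom vertex. *)
Lemma solve_flow s t : r * s + t * h0 = 0 -> t = - (r * s) / h0.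
Proof. by have n0 := h0_neq0 => h; apply: (mulIf n0); rewrite divfK//; lra. Qed.

Lemma step_left m y : y \in T m -> y - rho ^+ m.+2 \notin T m ->
  B m.+1 y = r * al * B m y.
Proof. by move=> h h'; rewrite (solve_flow _ _ (node_left _ _ h h')) /al; ring. Qed.

Lemma step_right m x : x \in T m -> x + rho ^+ m.+2 \notin T m ->
  B m.+1 (x + rho ^+ m.+2) = r * be * B m x.
Proof. by move=> h h'; rewrite (solve_flow _ _ (node_right _ _ h h')) /be; ring. Qed.

Lemma step_both m x : x \in T m -> x + rho ^+ m.+2 \in T m ->
  B m.+1 (x + rho ^+ m.+2) = r * (al * B m (x + rho ^+ m.+2) + be * B m x).
Proof. by move=> h h'; rewrite (solve_flow _ _ (node_both _ _ h h')) /al /be; ring. Qed.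

(** Shifting by one step gives [u n.+1 = w 0 * l + z * u n], and the limit of this relation
    determines [w 0]. *)
Lemma geometric_limit (u w : nat -> R) (z l : R) : l != 0 -> u 0%N = 0 ->
  (forall n, u n.+1 = u n + w n * l) -> (forall n, w n.+1 = z * w n) ->
  u @ \oo --> l -> w 0%N = 1 - z /\ w 0%N != 0.
Proof.
move=> l0 u0 us ws ul.
have e n : u n.+1 = w 0%N * l + z * u n.
  elim: n => [|n IH]; first by rewrite us u0 mulr0 addr0 add0r.
  by rewrite us ws [in RHS]us mulrDr addrA -IH mulrA.
have ul' : (fun n => u n.+1) @ \oo --> l by rewrite (@cvg_shiftS _ u).
have : (fun n => w 0%N * l + z * u n) @ \oo --> w 0%N * l + z * l.
  by apply: cvgD; [exact: cvg_cst|apply: cvgMr].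
under eq_fun do rewrite -e.
move=> hw; have E := cvg_unique (@Rhausdorff R) ul' hw; have wE : w 0%N = 1 - z.
  by apply: (mulIf l0); rewrite mulrBl mul1r; apply/eqP; rewrite eq_sym subr_eq; apply/eqP; exact: E.
split => //; apply/eqP => w00.
move: l0; rewrite (cvg_const_steps u l ul u0) ?eqxx// => n.
have -> : u n.+1 = u n + w n * l by [].
suff -> : w n = 0 by rewrite mul0r addr0.
by elim: n => // n IH; rewrite ws IH mulr0.
Qed.

Lemma left_series : p != 0 -> B 0 0 = 1 - r * al /\ B 0 0 != 0.
Proof.
move=> p0; have [f0 f1 f2] := adm_f.
apply: (geometric_limit (fun n => f n 0) (fun n => B n 0) _ p) => // n.
  exact: left_side_step.
rewrite (solve_flow _ _ (left_side n)) /al; ring.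
Qed.

Lemma right_series : q != 0 -> B 0 0 = 1 - r * be /\ B 0 0 != 0.
Proof.
move=> q0; have [f0 f1 f2] := adm_f.
have := geometric_limit (fun n => f n (1 - rho ^+ n)) (fun n => B n (1 - rho ^+ n)) (r * be) q.
rewrite expr0 subrr; apply => // n.
  exact: right_side_step.
rewrite (solve_flow _ _ (right_side n)) /be; ring.
Qed.

Let rho_powers : [/\ rho ^+ 2 = rho ^+ 3 + rho ^+ 4, rho ^+ 3 = rho ^+ 4 + rho ^+ 5,
  rho ^+ 4 = rho ^+ 5 + rho ^+ 6, 0 < rho ^+ 6 & rho ^+ 6 < rho ^+ 5].
Proof.
have h := rhoX R 5; have p7 := rhoX_gt0 R 7.
by split; [exact: (rhoX R 2)|exact: (rhoX R 3)|exact: (rhoX R 4)|exact: rhoX_gt0|lra].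
Qed.

Let T0 : 0 \in T 0 := memT0 R 0.
Let T1l : 0 \in T 1 := memT0 R 1.

Let T1r : rho ^+ 2 \in T 1.
Proof. by have := memT_right R _ _ T0; rewrite add0r. Qed.

Let T2r : rho ^+ 3 \in T 2.
Proof. by have := memT_right R _ _ T1l; rewrite add0r. Qed.

Let T2m : rho ^+ 2 \in T 2 := memT_left R _ _ T1r.

(** Here and below the index is the word of the cell; a letter 2 at place [j] contributes
    [rho ^+ j.+1] to the shift. *)
Lemma B_1 : B 1 0 = r * al * B 0 0.
Proof.
apply: step_left => //; apply/negP => /T_ge0.
by have := rhoX_gt0 R 2; lra.
Qed.

Lemma B_2 : B 1 (rho ^+ 2) = r * be * B 0 0.
Proof.
rewrite -[rho ^+ 2]add0r; apply: step_right => //.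
by rewrite add0r inE gt_eqF// rhoX_gt0.
Qed.

Lemma B_12 : B 2 (rho ^+ 3) = r * be * B 1 0.
Proof.
rewrite -[rho ^+ 3]add0r; apply: step_right => //.
by have [? ? ? ? ?] := rho_powers; apply/negP => /T_pos[]; lra.
Qed.

Lemma B_21 : B 2 (rho ^+ 2) = r * al * B 1 (rho ^+ 2).
Proof.
by apply: step_left => //; have [? ? ? ? ?] := rho_powers; apply/negP => /T_pos[]; lra.
Qed.

Lemma B_122 : B 3 (rho ^+ 2) = r * (al * B 2 (rho ^+ 2) + be * B 2 (rho ^+ 3)).
Proof.
have [e _ _ _ _] := rho_powers; rewrite e.
by apply: step_both => //; rewrite -e.
Qed.

Lemma B_121 : B 3 (rho ^+ 3) = r * al * B 2 (rho ^+ 3).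
Proof.
by apply: step_left => //; have [? ? ? ? ?] := rho_powers; apply/negP => /T_pos[]; lra.
Qed.

Let T3r : rho ^+ 3 \in T 3 := memT_left R _ _ T2r.
Let T3m : rho ^+ 2 \in T 3 := memT_left R _ _ T2m.

Lemma B_1212 : B 4 (rho ^+ 3 + rho ^+ 5) = r * be * B 3 (rho ^+ 3).
Proof.
apply: step_right => //; apply/negP => h.
have [e2 e3 e4 p5 p6] := rho_powers.
(* A cell there would leave a gap [rho ^+ 6] before [rho ^+ 2], shorter than every gap of [T 3]. *)
have lt : rho ^+ 3 + rho ^+ 5 < rho ^+ 2 by lra.
by have := T_gap R 3 _ _ h T3m lt; case; lra.
Qed.

Lemma B_1221 : B 4 (rho ^+ 2) = r * al * B 3 (rho ^+ 2).
Proof.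
apply: step_left => //; apply/negP => h.
have [e2 e3 e4 p5 p6] := rho_powers.
have lt : rho ^+ 3 < rho ^+ 2 - rho ^+ 5 by lra.
by have := T_gap R 3 _ _ T3r h lt; case; lra.
Qed.

(* The words 122 and 211 lead to the same point. *)
Lemma root_loop : B 0 0 * p + B 1 0 * q + B 2 (rho ^+ 3) * q =
  B 0 0 * q + B 1 (rho ^+ 2) * p + B 2 (rho ^+ 2) * p.
Proof.
have [e2 e3 e4 p5 p6] := rho_powers; have [f0 _ _] := adm_f.
have l1 : f 1 0 = f 0 0 + B 0 0 * p := left_value 0 0 T0.
have l2 : f 1 (0 + rho ^+ 2) = f 0 0 + B 0 0 * q := right_value 0 0 T0.
have m1 : f 2 (0 + rho ^+ 3) = f 1 0 + B 1 0 * q := right_value 1 0 T1l.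
have m2 : f 2 (rho ^+ 2) = f 1 (rho ^+ 2) + B 1 (rho ^+ 2) * p := left_value 1 _ T1r.
have n1 : f 3 (rho ^+ 3 + rho ^+ 4) = f 2 (rho ^+ 3) + B 2 (rho ^+ 3) * q :=
  right_value 2 _ T2r.
have n2 : f 3 (rho ^+ 2) = f 2 (rho ^+ 2) + B 2 (rho ^+ 2) * p := left_value 2 _ T2m.
by rewrite add0r in l2; rewrite add0r in m1; rewrite -e2 in n1; lra.
Qed.

(* The words 12122 and 12211 lead to the same point. *)
Lemma second_loop : B 2 (rho ^+ 3) * p + B 3 (rho ^+ 3) * q + B 4 (rho ^+ 3 + rho ^+ 5) * q =
  B 2 (rho ^+ 3) * q + B 3 (rho ^+ 2) * p + B 4 (rho ^+ 2) * p.
Proof.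
have [e2 e3 e4 p5 p6] := rho_powers.
have T4r := memT_right R _ _ T3r; have T4m := memT_left R _ _ T3m.
have l1 : f 3 (rho ^+ 3) = f 2 (rho ^+ 3) + B 2 (rho ^+ 3) * p := left_value 2 _ T2r.
have l2 : f 3 (rho ^+ 3 + rho ^+ 4) = f 2 (rho ^+ 3) + B 2 (rho ^+ 3) * q :=
  right_value 2 _ T2r.
have m1 : f 4 (rho ^+ 3 + rho ^+ 5) = f 3 (rho ^+ 3) + B 3 (rho ^+ 3) * q :=
  right_value 3 _ T3r.
have m2 : f 4 (rho ^+ 2) = f 3 (rho ^+ 2) + B 3 (rho ^+ 2) * p := left_value 3 _ T3m.
have n1 : f 5 (rho ^+ 3 + rho ^+ 5 + rho ^+ 6) =
  f 4 (rho ^+ 3 + rho ^+ 5) + B 4 (rho ^+ 3 + rho ^+ 5) * q := right_value 4 _ T4r.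
have n2 : f 5 (rho ^+ 2) = f 4 (rho ^+ 2) + B 4 (rho ^+ 2) * p := left_value 4 _ T4m.
have e : rho ^+ 3 + rho ^+ 5 + rho ^+ 6 = rho ^+ 2 by lra.
by rewrite -e2 in l2; rewrite e in n1; lra.
Qed.

Lemma rigidity : False.
Proof.
have [a0 b0 c0 _] := abc; have n0 := h0_neq0; have ab := al_be.
have loop := root_loop; rewrite B_12 B_21 B_1 B_2 in loop.
set v := B 0 0 in loop *.
have [p0|p0] := eqVneq p 0.
  have qn : q != 0 by case: pq0 => //; rewrite p0 eqxx.
  have [_ vn] := right_series qn; rewrite -/v in vn.
  (* With [p = 0] the loop reads [r * al * (1 + r * be) = 1], but [al = - (c / b) <= 0] and
     [be = 1 - al >= 1]. *)
  have E : r * al + r * be * (r * al) = 1.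
    apply: (mulIf vn); apply: (mulIf qn); rewrite p0 in loop; lra.
  have al_le : al <= 0.
    have bn : b != 0 by apply: contra n0 => /eqP bz; rewrite /h0 p0 bz mulr0 mul0r addr0 oppr0.
    have bp : 0 < b by rewrite lt_neqAle eq_sym bn b0.
    rewrite /al /h1 /h0 p0 mulr0 sub0r.
    have -> : - (0 + c * - q) / - (0 + b * q) = - (c / b) by field; rewrite qn bn.
    by rewrite oppr_le0 divr_ge0.
  have be_ge : 1 <= be by lra.
  have : r * al * (1 + r * be) = 1 by lra.
  have r0' := r0; have : 0 <= 1 + r * be by rewrite addr_ge0// mulr_ge0; lra.
  have : r * al <= 0 by rewrite pmulr_rle0.
  nra.
have [q0|q0] := eqVneq q 0.
  have [_ vn] := left_series p0; rewrite -/v in vn.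
  have E : r * be + r * al * (r * be) = 1.
    apply: (mulIf vn); apply: (mulIf p0); rewrite q0 in loop; lra.
  have be_le : be <= 0.
    have an : a != 0 by apply: contra n0 => /eqP az; rewrite /h0 q0 az mulr0 mul0r addr0 oppr0.
    have ap : 0 < a by rewrite lt_neqAle eq_sym an a0.
    rewrite /be /h2 /h0 q0 mulr0 sub0r addr0.
    have -> : - (0 + c * - p) / - (a * p) = - (c / a) by field; rewrite p0 an.
    by rewrite oppr_le0 divr_ge0.
  have al_ge : 1 <= al by lra.
  have : r * be * (1 + r * al) = 1 by lra.
  have r0' := r0; have : 0 <= 1 + r * al by rewrite addr_ge0// mulr_ge0; lra.
  have : r * be <= 0 by rewrite pmulr_rle0.
  nra.
have [v1 vn] := left_series p0; have [v2 _] := right_series q0.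
rewrite -/v in vn v1 v2.
have rn : r != 0 by rewrite gt_eqF// r0.
(* Both sides determine the same root amplitude: [v = 1 - r * al = 1 - r * be]. *)
have abE : al = be by apply: (mulfI rn); lra.
have alE : al = 2^-1 by lra.
have beE : be = 2^-1 by lra.
have r0' := r0; have r1' := r1.
rewrite alE beE in loop.
have pq : p = q.
  have : v * (1 - r / 2 - r ^+ 2 / 4) * (p - q) = 0.
    by move/eqP: loop; rewrite -subr_eq0 => /eqP <-; field.
  move=> /eqP; rewrite !mulf_eq0 (negbTE vn)/= => /orP[/eqP|]; first by nra.
  by rewrite subr_eq0 => /eqP.
(* The cell 122 is fed by two cells: its amplitude [v * r ^+ 3 / 4] is twice that of 121, and the
   amplitude of 1221 is likewise twice that of 1212. The two ways around the loop therefore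
   differ. *)
have := second_loop; rewrite B_1212 B_1221 B_121 B_122 B_21 B_12 B_1 B_2 -/v alE beE pq => E.
have : v * r ^+ 3 * (2 + r) * q = 0.
  apply: (mulfI (_ : - 16^-1 != 0 :> R)); first by rewrite oppr_eq0 invr_eq0.
  by rewrite mulr0; move/eqP: E; rewrite -subr_eq0 => /eqP <-; field.
apply/eqP; rewrite !mulf_neq0// ?expf_neq0//; last by rewrite gt_eqF//; lra.
Qed.

End Propagation.

(** A nonzero nonnegative form on triples modulo constants has a null space of dimension at most 1:
    two independent null vectors would make it vanish, as positivity kills the mixed term. *)
Lemma psd_null (a b c p q : R) : (forall y z, 0 <= tri R a b c 0 y z) ->
  tri R a b c 0 p q = 0 -> (a != 0) || (b != 0) || (c != 0) ->
  forall y z, tri R a b c 0 y z = 0 -> y * q = z * p.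
Proof.
move=> psd pq0 nz y z yz0; apply/eqP; rewrite -subr_eq0; apply/negPn/negP => d0.
set d := y * q - z * p in d0.
have comb s t : tri R a b c 0 (s * y + t * p) (s * z + t * q) =
    t ^+ 2 * tri R a b c 0 p q + s ^+ 2 * tri R a b c 0 y z +
    2 * s * t * (a * y * p + b * z * q + c * (y - z) * (p - q)).
  by rewrite /tri; ring.
have zero s t : tri R a b c 0 (s * y + t * p) (s * z + t * q) = 0.
  rewrite comb pq0 yz0 !mulr0 !addr0.
  set w := a * y * p + _ + _; suff -> : w = 0 by rewrite mulr0 addr0.
  (* For [s = 1] and [t = - w], positivity reads [0 <= - 2 * w ^+ 2]. *)
  have := psd (1 * y + (- w) * p) (1 * z + (- w) * q).
  rewrite comb pq0 yz0 !mulr0 !addr0 -/w mulr1 add0r => h.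
  by apply/eqP; rewrite -sqrf_eq0; apply/eqP; have := sqr_ge0 w; nra.
have all0 y' z' : tri R a b c 0 y' z' = 0.
  have := zero ((y' * q - z' * p) / d) ((z' * y - y' * z) / d).
  have -> : (y' * q - z' * p) / d * y + (z' * y - y' * z) / d * p = y'.
    by rewrite /d; field.
  have -> : (y' * q - z' * p) / d * z + (z' * y - y' * z) / d * q = z'.
    by rewrite /d; field.
  by [].
have := all0 1 0; have := all0 0 1; have := all0 1 1; rewrite /tri => e1 e2 e3.
have [ea eb ec] : [/\ a = 0, b = 0 & c = 0] by split; lra.
by move: nz; rewrite ea eb ec eqxx.
Qed.

Lemma eig_proportional (r lam a b c a' b' c' : R) : rho < r < 1 ->
  conductances R a b c -> conductances R a' b' c' ->
  eig R r lam a b c -> eig R r lam a' b' c' ->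
  exists2 k, 0 < k & [/\ a = k * a', b = k * b' & c = k * c'].
Proof.
move=> rr h h' e e'; have p0 := rho_gt0 R.
have r0 : 0 < r by case/andP: rr; lra.
have [k [p [q [k0 t0 touch le]]]] := tri_touching R a b c a' b' c' h h'.
exists k => //.
have [f fa fE] := tr_attained R a' b' c' r h' rr 0 p q.
(* With equal eigenvalues, the traces at the touching triple also have the exact ratio [k], so the
   minimizer [f] leaves no room for an excess on any cell. *)
pose ex n x := k * cell R a' b' c' f n x - cell R a b c f n x.
have ex0 n x : 0 <= ex n x by rewrite subr_ge0; apply: le.
have exz n x : x \in T n -> ex n x = 0.
  move=> xT; apply/eqP; rewrite eq_le ex0 andbT.
  have rn : 0 < r ^- n by rewrite invr_gt0 exprn_gt0.
  rewrite -(ler_pM2l rn) mulr0.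
  suff : tr R a b c r 0 p q <= k * tr R a' b' c' r 0 p q - r ^- n * ex n x.
    by rewrite e e' touch; lra.
  apply: (tr_le R _ _ _ _ f) => // N.
  apply: (@le_trans _ _ (en R a b c r f (N + n.+1))).
    by apply: en_nondecreasing => //; apply: leq_addr.
  have hE := ler_wpM2l (ltW k0) (fE (N + n.+1)%N).
  rewrite lerBrDr; apply: le_trans hE; rewrite -lerBrDl.
  have -> : k * en R a' b' c' r f (N + n.+1) - en R a b c r f (N + n.+1) =
      \sum_(i < N + n.+1) r ^- i * \sum_(x <- T i) ex i x.
    rewrite /en mulr_sumr -sumrB; apply: eq_bigr => i _.
    by rewrite mulrCA -mulrBr; congr (_ * _); rewrite /lev mulr_sumr -sumrB.
  have nN : (n < N + n.+1)%N by lia.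
  rewrite (bigD1 (Ordinal nN))//=.
  apply: (@le_trans _ _ (r ^- n * \sum_(x <- T n) ex n x)).
    rewrite ler_pM2l//; apply: ler_term_sum => //; exact: T_uniq.
  rewrite lerDl; apply: sumr_ge0 => i _; apply: mulr_ge0.
    by rewrite invr_ge0 exprn_ge0// ltW.
  exact: sumr_ge0.
apply: contrapT => notprop.
have nz : (k * a' - a != 0) || (k * b' - b != 0) || (k * c' - c != 0).
  rewrite -!negb_and; apply/negP => /andP[/andP[]]; rewrite !subr_eq0.
  by move=> /eqP ea /eqP eb /eqP ec; apply: notprop.
have triB x y z : tri R (k * a' - a) (k * b' - b) (k * c' - c) x y z =
    k * tri R a' b' c' x y z - tri R a b c x y z by rewrite /tri; ring.
have psd y z : 0 <= tri R (k * a' - a) (k * b' - b) (k * c' - c) 0 y z.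
  by rewrite triB subr_ge0.
have null0 : tri R (k * a' - a) (k * b' - b) (k * c' - c) 0 p q = 0.
  by rewrite triB touch subrr.
(* Zero excess puts the values of each cell, up to a constant, on the null line of the difference
   form, spanned by [(0, p, q)]; [B] below is the multiple. *)
have line := psd_null _ _ _ p q psd null0 nz.
have pq : p != 0 \/ q != 0.
  apply/orP; rewrite -negb_and; apply/negP => /andP[/eqP pz /eqP qz].
  by move: t0; rewrite pz qz /tri !subrr expr0n/= !mulr0 !addr0 ltxx.
have s0 : p ^+ 2 + q ^+ 2 != 0.
  by case: pq => n0; rewrite gt_eqF//; [apply: ltr_pwDl|apply: ltr_wpDl];
    rewrite ?sqr_ge0// exprn_even_gt0.
pose B n x := ((f n.+1 x - f n x) * p + (f n.+1 (x + rho ^+ n.+2) - f n x) * q) /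
  (p ^+ 2 + q ^+ 2).
have cellline n x : x \in T n ->
    (f n.+1 x - f n x) * q = (f n.+1 (x + rho ^+ n.+2) - f n x) * p.
  by move=> xT; apply: line; rewrite -tri_shift triB; apply: exz.
apply: (rigidity a' b' c' r p q f B) => //.
- move=> n x xT; have := cellline n x xT; rewrite /B.
  move: (f n.+1 (x + rho ^+ n.+2)) (f n.+1 x) (f n x) => w u v E.
  suff <- : u - v = ((u - v) * p + (w - v) * q) / (p ^+ 2 + q ^+ 2) * p by ring.
  apply: (mulIf s0); rewrite mulrAC divfK//.
  rewrite [RHS](_ : _ = (u - v) * p ^+ 2 + (w - v) * p * q); last by ring.
  by rewrite -E; ring.
- move=> n x xT; have := cellline n x xT; rewrite /B.
  move: (f n.+1 (x + rho ^+ n.+2)) (f n.+1 x) (f n x) => w u v E.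
  suff <- : w - v = ((u - v) * p + (w - v) * q) / (p ^+ 2 + q ^+ 2) * q by ring.
  apply: (mulIf s0); rewrite mulrAC divfK//.
  rewrite [RHS](_ : _ = (u - v) * q * p + (w - v) * q ^+ 2); last by ring.
  by rewrite E; ring.
- by move=> m y yT; apply: (minimizer_harmonic R a' b' c' r h' rr f 0 p q).
Qed.

End Rigidity.

(** * Continuity of the eigenvalue *)

Section Continuity.
Variable R : realType.
Local Notation rho := (rho R).
Local Notation T := (shifts R).
Local Notation Tr := (tr R).
Local Notation En := (en R).
Local Notation Lev := (lev R).
Local Notation Q := (gap_energy R).
Implicit Types (x y : R) (n m : nat).

Lemma pigeonhole_sum (v : nat -> R) (J K : nat) (M : R) :
  \sum_(i < K.+1) v (J + i)%N <= M -> exists2 i : 'I_K.+1, True & v (J + i)%N <= M / K.+1%:R.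
Proof.
move=> h; apply: contrapT => no; move: h; apply/negP; rewrite -ltNge.
have -> : M = \sum_(i < K.+1) M / K.+1%:R.
  by rewrite sumr_const card_ord -[RHS]mulr_natr divfK// pnatr_eq0.
apply: ltr_sum => [|i _]; first by apply/hasP; exists ord0; rewrite ?mem_index_enum.
by rewrite ltNge; apply/negP => h; apply: no; exists i.
Qed.

Section Fixed.
Variables (a b c r1 r2 : R).
Hypotheses (abc : conductances R a b c) (r1p : rho < r1) (r2p : r2 < 1).
Local Notation K' := (kap R a b c).

(** The first summand bounds the energy of the interpolation below the cut, the second the cost of
    restoring the boundary values, uniformly for parameters in [[r1, r2]]. *)
Definition modulus := 8 * (b + c) / (K' * (1 - rho / r1)) +
  (a + b + 2 * c + 8 * (b + c) / (r1 - rho)) * (2 / (K' * (1 - r2))).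

Lemma modulus_parts_ge0 : 0 <= 8 * (b + c) / (K' * (1 - rho / r1)) /\
  0 <= (a + b + 2 * c + 8 * (b + c) / (r1 - rho)) * (2 / (K' * (1 - r2))).
Proof.
have k0 := kap_gt0 R _ _ _ abc; have [a0 b0 c0 _] := abc; have p0 := rho_gt0 R.
have r10 : 0 < r1 by apply: lt_trans r1p.
have bc : 0 <= 8 * (b + c) by rewrite mulr_ge0// addr_ge0.
have q1 : rho / r1 < 1 by rewrite ltr_pdivrMr// mul1r.
split; first by apply: divr_ge0 => //; rewrite mulr_ge0 ?(ltW k0)// subr_ge0 ltW.
apply: mulr_ge0; last first.
  by apply: divr_ge0 => //; rewrite mulr_ge0 ?(ltW k0)// subr_ge0 ltW.
apply: addr_ge0; first by rewrite addr_ge0 ?addr_ge0// mulr_ge0.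
by rewrite divr_ge0// subr_ge0 ltW.
Qed.

(* A minimizer for [s] has finite energy for [s]; cutting it at a level between
   [J] and [J + K.+1] that carries at most the share [2 / K.+1] of this energy
   gives a competitor for [r], up to a small change of the boundary values. *)
Lemma trace_modulus r s (J K : nat) e u0 u1 u2 : r1 <= r -> r <= s -> s <= r2 -> 0 < e ->
  Tr a b c r u0 u1 u2 <=
  (1 + e) * ((s / r) ^+ (J + K.+1) * (1 + modulus / K.+1%:R) * Tr a b c s u0 u1 u2) +
  (1 + e^-1) * (modulus * r2 ^+ J * Tr a b c s u0 u1 u2).
Proof.
move=> r1r rs sr2 e0; have k0 := kap_gt0 R _ _ _ abc; have [a0 b0 c0 _] := abc.
have p0 := rho_gt0 R; have [C10 C20] := modulus_parts_ge0.
have r1p' := r1p; have r2p' := r2p.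
have r10 : 0 < r1 by lra.
have r0 : 0 < r by lra.
have s0 : 0 < s by lra.
have r20 : 0 < r2 by lra.
have rr : rho < r < 1 by apply/andP; split; lra.
have ss : rho < s < 1 by apply/andP; split; lra.
have s01 : 0 < s < 1 by apply/andP; split; lra.
set M := Tr a b c s u0 u1 u2; have M0 : 0 <= M := tr_ge0 R _ _ _ _ _ _ _.
have [g ga gE] := tr_attained R a b c s abc ss u0 u1 u2; rewrite -/M in gE.
pose w n := s ^- n * Lev a b c g n.
have w0 n : 0 <= w n by rewrite mulr_ge0 ?lev_ge0// invr_ge0 exprn_ge0// ltW.
have wM N : \sum_(n < N) w n <= M by apply: gE.
have wtail m N : \sum_(i < N) w (m + i)%N <= M.
  apply: le_trans (wM (m + N)%N); rewrite big_split_ord/= lerDr.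
  by apply: sumr_ge0.
(* Pairs of consecutive levels are needed because [gap_energy_lev] involves two levels; their total
   is at most [2 * M]. *)
have [i _ hi] : exists2 i : 'I_K.+1, True &
    w (J + i)%N + w (J + i).+1 <= (2 * M) / K.+1%:R.
  apply: (pigeonhole_sum (fun n => w n + w n.+1) J K); rewrite big_split/=.
  rewrite (_ : 2 * M = M + M); last by ring.
  apply: lerD; first exact: wtail.
  apply: le_trans (wtail J.+1 K.+1); rewrite le_eqVlt; apply/orP; left; apply/eqP.
  by apply: eq_bigr => j _; rewrite addSn.
set N := (J + i)%N in hi.
have NJ : (J <= N)%N by apply: leq_addr.
have NK : (N.+1 <= J + K.+1)%N by rewrite -addnS leq_add2l; apply: ltn_ord.
(* Passing from [s] to [r] multiplies the weight of level [n] by [th ^+ n], at most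
   [th ^+ (J + K.+1)] down to the cut. *)
set th := s / r; have th1 : 1 <= th by rewrite ler_pdivlMr// mul1r.
have thn n m : (n <= m)%N -> th ^+ n <= th ^+ m by move=> nm; apply: ler_weXn2l.
have rn n : r ^- n = th ^+ n * s ^- n.
  by rewrite /th expr_div_n mulrAC divff ?mul1r// expf_neq0// gt_eqF.
set h := interp R N.+1 g.
have hE N' : En a b c r h N' <=
    th ^+ (J + K.+1) * (1 + modulus / K.+1%:R) * M.
  apply: le_trans (en_interp R a b c abc r N.+1 g N' _) _; first by case/andP: rr.
  rewrite [leRHS](_ : _ = th ^+ (J + K.+1) * M +
    th ^+ (J + K.+1) * (modulus / K.+1%:R * M)); last by ring.
  apply: lerD.
    rewrite /en; apply: (@le_trans _ _ (\sum_(n < N.+1) th ^+ (J + K.+1) * w n)).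
      apply: ler_sum => n _; rewrite rn -mulrA; apply: ler_wpM2r; first exact: w0.
      by apply: thn; apply: leq_trans (ltnW (ltn_ord n)) NK.
    by rewrite -mulr_sumr; apply: ler_wpM2l => //; rewrite exprn_ge0// ltW// (lt_le_trans _ th1).
  have q1 : 1 - rho / r1 <= 1 - rho / r.
    by rewrite lerB// ler_pM2l// lef_pV2 ?posrE.
  have q0 : 0 < 1 - rho / r1 by rewrite subr_gt0 ltr_pdivrMr// mul1r.
  have thJ : 0 <= th ^+ (J + K.+1) by rewrite exprn_ge0// ltW// (lt_le_trans _ th1).
  rewrite rn -[leLHS]mulrA; apply: ler_pM.
  - by rewrite exprn_ge0// ltW// (lt_le_trans _ th1).
  - apply: mulr_ge0; first by rewrite invr_ge0 exprn_ge0// ltW.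
    apply: mulr_ge0; last by rewrite invr_ge0; apply: le_trans q1; exact: ltW.
    by apply: mulr_ge0; [exact: addr_ge0|exact: gap_energy_ge0].
  - exact: thn.
  - have hQ : s ^- N.+1 * Q N.+1 (g N.+1) <= 8 * M / K.+1%:R / K'.
      apply: le_trans (ler_wpM2l _ (gap_energy_lev R a b c abc N g)) _.
        by rewrite invr_ge0 exprn_ge0// ltW.
      rewrite mulrA ler_pM2r ?invr_gt0//.
      have hs : s ^- N.+1 * (Lev a b c g N + 4 * Lev a b c g N.+1) = s^-1 * w N + 4 * w N.+1.
        by rewrite /w exprS invfM; ring.
      rewrite hs; apply: (@le_trans _ _ (4 * (w N + w N.+1))).
        rewrite mulrDr lerD2r; apply: ler_wpM2r => //.
        rewrite -[leRHS]invrK lef_pV2 ?posrE ?invr_gt0//.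
        by have /andP[? _] := rho_bounds R; lra.
      apply: le_trans (ler_wpM2l _ hi) _ => //.
      by rewrite le_eqVlt; apply/orP; left; apply/eqP; ring.
    have Q0 := gap_energy_ge0 R N.+1 (g N.+1).
    have mod1 : 8 * (b + c) / (K' * (1 - rho / r1)) <= modulus by rewrite lerDl.
    apply: (@le_trans _ _ (8 * (b + c) / (K' * (1 - rho / r1)) * (K.+1%:R^-1 * M))); last first.
      by rewrite -[leRHS]mulrA; apply: ler_wpM2r => //; rewrite mulr_ge0 ?invr_ge0.
    rewrite (_ : s ^- N.+1 * _ = (b + c) * (1 - rho / r)^-1 * (s ^- N.+1 * Q N.+1 (g N.+1)));
      last by ring.
    apply: (@le_trans _ _ ((b + c) * (1 - rho / r1)^-1 * (8 * M / K.+1%:R / K'))).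
      apply: ler_pM => //.
      + by rewrite mulr_ge0 ?addr_ge0// invr_ge0; apply: le_trans q1; exact: ltW.
      + by rewrite mulr_ge0// invr_ge0 exprn_ge0// ltW.
      + apply: ler_wpM2l; first exact: addr_ge0.
        by rewrite lef_pV2 ?posrE// (lt_le_trans q0).
      + by rewrite (invfM K') le_eqVlt; apply/orP; left; apply/eqP; ring.
have ha : adm R h u0 (g N.+1 0) (g N.+1 (1 - rho ^+ N.+1)).
  have [g0 _ _] := ga; split; first by rewrite /h interp_le.
    by apply: cvg_near_cst; exists N.+1 => // n /= hn; rewrite /h interp_corner_left.
  by apply: cvg_near_cst; exists N.+1 => // n /= hn; rewrite /h interp_corner_right.
have main := tr_le R _ _ _ _ _ _ _ _ _ ha hE.
set v1 := g _ _ in ha main; set v2 := g _ _ in ha main.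
have d1 := root_corner_left R a b c s abc ss g _ _ _ M ga gE N.+1.
have d2 := root_corner_right R a b c s abc ss g _ _ _ M ga gE N.+1.
rewrite -/v1 in d1; rewrite -/v2 in d2.
have hD : s ^+ N.+1 * (M / (K' * (1 - s))) <= r2 ^+ J * (M / (K' * (1 - r2))).
  have s1 : 0 < 1 - s by lra.
  have r21 : 0 < 1 - r2 by lra.
  apply: ler_pM.
  - by rewrite exprn_ge0// ltW.
  - by apply: divr_ge0 => //; apply: mulr_ge0; exact: ltW.
  - apply: (@le_trans _ _ (s ^+ J)); last by rewrite lerXn2r// nnegrE ltW.
    apply: ler_wiXn2l; [exact: ltW|by lra|exact: leq_trans NJ _].
  - have ks : 0 < K' * (1 - s) by apply: mulr_gt0.
    have k2 : 0 < K' * (1 - r2) by apply: mulr_gt0.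
    by apply: ler_wpM2l => //; rewrite lef_pV2 ?posrE// ler_pM2l//; lra.
(* The interpolation is constant along the sides below the cut, so its limits are [v1] and [v2]; [z]
   restores [u1] and [u2] at a cost of order [r2 ^+ J]. *)
have [z za zE] := extension R a b c r abc rr 0 (u1 - v1) (u2 - v2).
have rest : Tr a b c r 0 (u1 - v1) (u2 - v2) <= modulus * r2 ^+ J * M.
  apply: le_trans (tr_le R _ _ _ _ _ _ _ _ _ za zE) _.
  rewrite -sqrrN opprB in d1; rewrite -sqrrN opprB in d2.
  move: (u1 - v1) (u2 - v2) d1 d2 => x y d1 d2.
  pose D := r2 ^+ J * (M / (K' * (1 - r2))).
  have dx : x ^+ 2 <= D := le_trans d1 hD.
  have dy : y ^+ 2 <= D := le_trans d2 hD.
  have xy : (x - y) ^+ 2 <= 4 * D by have := sqr_ge0 (x + y); nra.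
  apply: (@le_trans _ _ ((a + b + 2 * c + 8 * (b + c) / (r1 - rho)) * (2 * D))).
    rewrite /extension_bound /tri !sub0r !sqrrN.
    have rr1 : 0 < r1 - rho by lra.
    have i1 : 4 * (b + c) * (x - y) ^+ 2 / (r - rho) <= 4 * (b + c) * (4 * D) / (r1 - rho).
      apply: ler_pM.
      - by rewrite mulr_ge0 ?sqr_ge0// mulr_ge0// addr_ge0.
      - by rewrite invr_ge0; lra.
      - by apply: ler_wpM2l => //; rewrite mulr_ge0// addr_ge0.
      - by rewrite lef_pV2 ?posrE; lra.
    have D0 : 0 <= D by apply: le_trans dx; apply: sqr_ge0.
    have i2 := ler_wpM2l a0 dx; have i3 := ler_wpM2l b0 dy; have i4 := ler_wpM2l c0 xy.
    have i5 := mulr_ge0 a0 D0; have i6 := mulr_ge0 b0 D0.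
    apply: le_trans (lerD (lerD (lerD i2 i3) i4) i1) _.
    rewrite -subr_ge0 (_ : _ - _ = a * D + b * D); first exact: addr_ge0.
    by ring.
  have mod2 : (a + b + 2 * c + 8 * (b + c) / (r1 - rho)) * (2 / (K' * (1 - r2))) <= modulus.
    by rewrite lerDr.
  rewrite -[leRHS]mulrA; apply: le_trans (ler_wpM2r _ mod2); last first.
    by rewrite mulr_ge0// exprn_ge0// ltW.
  by rewrite /D le_eqVlt; apply/orP; left; apply/eqP; ring.
have := trD_le R a b c r abc rr e u0 v1 v2 0 (u1 - v1) (u2 - v2) e0.
rewrite addr0 !subrKC => /le_trans; apply; apply: lerD.
  by apply: ler_wpM2l main; lra.
have i0 : 0 < e^-1 by rewrite invr_gt0.
by apply: ler_wpM2l rest; lra.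
Qed.

Lemma expr1D_le (x : R) m : 0 <= x <= 1 -> (1 + x) ^+ m <= 1 + 3 ^+ m * x.
Proof.
move=> /andP[x0 x1]; elim: m => [|m IH]; first by rewrite !expr0; lra.
rewrite exprS; apply: le_trans (ler_wpM2l _ IH) _; first lra.
have : 1 <= 3 ^+ m :> R by apply: exprn_ege1; lra.
rewrite [3 ^+ m.+1]exprS; move: (3 ^+ m) => k k1.
have := mulr_ge0 (_ : 0 <= k) x0; nra.
Qed.

(** The order of choices matters: [K] makes the interpolation cheap, then [J] makes the boundary
    correction cheap, and last [d] keeps [(s / r) ^+ (J + K.+1)] near 1. *)
Lemma trace_continuity e : r1 <= r2 -> 0 < e -> exists2 d, 0 < d &
  forall r s u0 u1 u2, r1 <= r -> r <= s -> s <= r2 -> s - r <= d ->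
  Tr a b c r u0 u1 u2 <= (1 + e) * Tr a b c s u0 u1 u2.
Proof.
move=> r12 e0; have p0 := rho_gt0 R; have [C10 C20] := modulus_parts_ge0.
have r1p' := r1p; have r2p' := r2p.
have C0 : 0 <= modulus by apply: addr_ge0.
(* The final estimate is [(1 + y) ^+ 3 + y <= 1 + 8 * y], valid for [0 <= y <= 1 / 8]. *)
pose y := Num.min e 1 / 8.
have y0 : 0 < y by rewrite divr_gt0// lt_min e0 ltr01.
have y1 : y <= 1 / 8 by rewrite ler_pM2r// ge_min lexx orbT.
have ye : 8 * y <= e by rewrite /y mulrC divfK ?pnatr_eq0// ge_min lexx.
have [K hK] : exists K : nat, modulus / K.+1%:R <= y.
  exists (Num.truncn (modulus / y)); rewrite ler_pdivrMr// mulrC -ler_pdivrMr//.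
  by apply: ltW; apply: truncnS_gt.
have [J hJ] : exists J : nat, (1 + y^-1) * (modulus * r2 ^+ J) <= y.
  have r201 : 0 <= r2 < 1 by apply/andP; split; lra.
  have /cvgrPdist_le/(_ _ y0) := expr_cvg0 R r2 ((1 + y^-1) * modulus) r201.
  move=> [J _ hJ]; exists J; have := hJ J (leqnn J).
  rewrite /= sub0r normrN => hJ'; rewrite mulrA mulrC.
  exact: le_trans (ler_norm _) hJ'.
(* As [r > 1 / 2], a difference [s - r <= d] gives [s / r <= 1 + 2 * d], whose power [expr1D_le]
   bounds by [1 + y]. *)
pose d := Num.min 1 (y / 3 ^+ (J + K.+1)) / 2.
have m0 : 0 < 3 ^+ (J + K.+1) :> R by apply: exprn_gt0.
exists d; first by rewrite divr_gt0// lt_min ltr01/= divr_gt0.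
move=> r s u0 u1 u2 r1r rs sr2 srd.
have := trace_modulus r s J K y u0 u1 u2 r1r rs sr2 y0.
set t := Tr a b c s u0 u1 u2; have t0 : 0 <= t := tr_ge0 R _ _ _ _ _ _ _.
move=> /le_trans; apply.
have r0 : 0 < r by lra.
have th : (s / r) ^+ (J + K.+1) <= 1 + y.
  have d1 : 2 * d <= 1 by rewrite /d mulrC divfK ?pnatr_eq0// ge_min lexx.
  have d2 : 2 * d <= y / 3 ^+ (J + K.+1).
    by rewrite /d mulrC divfK ?pnatr_eq0// ge_min lexx orbT.
  have d0 : 0 <= d by apply: le_trans srd; lra.
  have sr : s / r <= 1 + 2 * d.
    rewrite ler_pdivrMr//; have /andP[? _] := rho_bounds R; nra.
  apply: (@le_trans _ _ ((1 + 2 * d) ^+ (J + K.+1))).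
    by rewrite lerXn2r// nnegrE; [rewrite divr_ge0//; lra|lra].
  apply: le_trans (expr1D_le _ _ _) _; first by apply/andP; split; lra.
  by rewrite lerD2l mulrC -ler_pdivlMr.
have th0 : 0 <= (s / r) ^+ (J + K.+1) by rewrite exprn_ge0// divr_ge0//; lra.
have mk0 : 0 <= modulus / K.+1%:R by rewrite divr_ge0.
have A : (s / r) ^+ (J + K.+1) * (1 + modulus / K.+1%:R) <= (1 + y) * (1 + y).
  by apply: ler_pM; [exact: th0|exact: addr_ge0|exact: th|rewrite lerD2l].
rewrite !mulrA -mulrDl; apply: ler_wpM2r => //.
rewrite -[X in X + _ <= _]mulrA -[X in _ + X <= _]mulrA.
have y1p : 0 <= 1 + y by lra.
apply: le_trans (lerD (ler_wpM2l y1p A) hJ) _.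
have y2 : y * y <= 1 / 8 * y by apply: ler_wpM2r => //; exact: ltW.
have y3 : y * (y * y) <= y * (1 / 8 * y) by apply: ler_wpM2l => //; exact: ltW.
lra.
Qed.

End Fixed.

(** The eigenform at [r0] is the test form for all nearby [r]: its trace changes by a factor close
    to 1, and the two comparison lemmas carry this over to [lam r]. *)
Lemma eigenvalue_continuous (lam bb : R -> R) :
  (forall r, rho < r < 1 -> [/\ 0 <= bb r, 0 < lam r & eig R r (lam r) 1 1 (bb r)]) ->
  forall r0, rho < r0 < 1 -> {for r0, continuous lam}.
Proof.
move=> H r0 rr; have [b0 l0 e0] := H r0 rr; have h0 := conductances11 R _ b0.
have [rr0 rr1] := andP rr.
pose r1 := (rho + r0) / 2; pose r2 := (1 + r0) / 2.
have r1r : rho < r1 by rewrite /r1; lra.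
have r2r : r2 < 1 by rewrite /r2; lra.
have r12 : r1 <= r2 by rewrite /r1 /r2; lra.
have q1 : r1 <= r0 by rewrite /r1; lra.
have q2 : r0 <= r2 by rewrite /r2; lra.
apply/cvgrPdist_le => e ep.
have e'p : 0 < e / lam r0 by apply: divr_gt0.
have [d d0 hd] := trace_continuity 1 1 (bb r0) r1 r2 h0 r1r r2r _ r12 e'p.
have d'0 : 0 < Num.min d ((1 - rho) / 2 * 0 + Num.min (r0 - r1) (r2 - r0)).
  by rewrite mulr0 add0r !lt_min d0 /r1 /r2; apply/andP; split; lra.
near=> r.
have : `|r0 - r| <= Num.min d (Num.min (r0 - r1) (r2 - r0)).
  near: r; rewrite mulr0 add0r in d'0; apply: cvgr_dist_le => //; exact: cvg_id.
rewrite !le_min !ler_norml => /and3P[/andP[n1 n2] /andP[n3 n4] /andP[n5 n6]].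
have k1 : r1 <= r by lra.
have k2 : r <= r2 by lra.
have k3 : r - r0 <= d by lra.
have rI : rho < r < 1 by rewrite (lt_le_trans r1r k1) (le_lt_trans k2 r2r).
have [br lr er] := H r rI; have hr := conductances11 R _ br.
have [rle|rge] := leP r r0.
  have mono := eig_nonincreasing R r r0 _ _ _ _ _ _ _ _ (andP rI).1 rle rr1 hr h0 er e0.
  have := eig_le_of_trace_le R r _ _ _ _ _ _ _ rI hr h0 er ((1 + e / lam r0) * lam r0).
  have up0 u0 u1 u2 : Tr 1 1 (bb r0) r u0 u1 u2 <=
      (1 + e / lam r0) * lam r0 * tri R 1 1 (bb r0) u0 u1 u2.
    by rewrite -mulrA -e0; apply: hd.
  move=> /(_ up0); rewrite mulrDl mul1r divfK ?gt_eqF// => up.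
  by apply/andP; split; lra.
have mono := eig_nonincreasing R r0 r _ _ _ _ _ _ _ _ rr0 (ltW rge) (andP rI).2 h0 hr e0 er.
have pos : 0 < 1 + e / lam r0 by lra.
have := eig_ge_of_trace_ge R r _ _ _ _ _ _ _ rI hr h0 er ((1 + e / lam r0)^-1 * lam r0).
have lo0 u0 u1 u2 : (1 + e / lam r0)^-1 * lam r0 * tri R 1 1 (bb r0) u0 u1 u2 <=
    Tr 1 1 (bb r0) r u0 u1 u2.
  by rewrite -mulrA ler_pdivrMl// -e0; apply: hd => //; exact: ltW.
move=> /(_ lo0); rewrite ler_pdivrMl// mulrDl mul1r mulrAC => lo.
have : e * lam r / lam r0 <= e by rewrite ler_pdivrMr// ler_pM2l.
by move=> h; apply/andP; split; lra.
Unshelve. all: by end_near. Qed.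

End Continuity.

(** * Bounds for the eigenvalue *)

Section EigenvalueBounds.
Variable R : realType.
Local Notation rho := (rho R).
Local Notation T := (shifts R).
Local Notation En := (en R).
Implicit Types (x y : R) (n m : nat).

Section Fixed.
Variables (c r lam : R).
Hypotheses (c0 : 0 <= c) (rr : rho < r < 1) (el : eig R r lam 1 1 c).

Let r0 : 0 < r.
Proof. by have := rho_gt0 R; case/andP: rr; lra. Qed.

Let tr100 : tr R 1 1 c r 1 0 0 = 2 * lam.
Proof. by rewrite el /tri; ring. Qed.

(** Test function: 1 at the top, [r / 4] on level 1, 0 below. It has no horizontal drops and gives
    [2 * lam <= 2 * (1 - r / 4) ^+ 2 + r / 4 < 2]. *)
Lemma eig_lt1 : lam < 1.
Proof.
have r0' := r0; have r1 : r < 1 by case/andP: rr.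
pose e := r / 4.
pose g (n : nat) (x : R) := if n is 0%N then 1 else if n is 1%N then e else 0.
have sz : (size (T 1) <= 2)%N by apply: leq_trans (size_undup _) _.
have bound N : En 1 1 c r g N <= 2 * (1 - e) ^+ 2 + r^-1 * (4 * e ^+ 2).
  apply: (@le_trans _ _ (En 1 1 c r g (2 + N))).
    by apply: en_nondecreasing => //; [exact: conductances11|exact: leq_addl].
  elim: N => [|N IH].
    rewrite !enS en0 add0r expr0 invr1 mul1r expr1; apply: lerD.
      by rewrite /lev /shifts big_seq1 /cell /tri /=; rewrite subrr; lra.
    apply: ler_wpM2l; first by rewrite invr_ge0 ltW.
    rewrite /lev /cell /tri /= subrr subr0 expr0n/= mulr0 addr0 !mul1r.
    rewrite big_const_seq count_predT iter_addr_0 -[leLHS]mulr_natl.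
    have : (size (T 1))%:R <= 2 :> R by rewrite ler_nat.
    by have := sqr_ge0 e; nra.
  rewrite addnS enS [lev _ _ _ _ _ _]big1 ?mulr0 ?addr0// => x _.
  by rewrite /cell /tri /= !subrr expr0n/= !mulr0 !addr0.
have ga : adm R g 1 0 0.
  by split => //; apply: cvg_near_cst; exists 2%N => // -[|[|n]].
have := tr_le R _ _ _ _ _ _ _ _ _ ga bound; rewrite tr100 /e.
have -> : r^-1 * (4 * (r / 4) ^+ 2) = r / 4 by field; rewrite gt_eqF.
nra.
Qed.

Section Lower.
Variable g : nat -> R -> R.

Let dl n := g n 0 - g n.+1 0.
Let dr n := g n (1 - rho ^+ n) - g n.+1 (1 - rho ^+ n.+1).
Let sl n x := (g n x - g n.+1 x) ^+ 2.
Let sr n x := (g n x - g n.+1 (x + rho ^+ n.+2)) ^+ 2.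

Lemma dr_sqr n : sr n (1 - rho ^+ n) = dr n ^+ 2.
Proof. by rewrite /sr /dr (last_succ R n). Qed.

Lemma lev_split n : \sum_(x <- T n) sl n x + \sum_(x <- T n) sr n x <= lev R 1 1 c g n.
Proof.
rewrite -big_split/=; apply: ler_sum => x _; rewrite /cell /tri /sl /sr !mul1r lerDl.
by rewrite mulr_ge0// sqr_ge0.
Qed.

Lemma sum_one n x (s : nat -> R -> R) : (forall x, 0 <= s n x) -> x \in T n ->
  s n x <= \sum_(x <- T n) s n x.
Proof. by move=> s0 xT; apply: ler_term_sum => //; apply: T_uniq. Qed.

Lemma sum_two n x y (s : nat -> R -> R) : (forall x, 0 <= s n x) ->
  x \in T n -> y \in T n -> x < y -> s n x + s n y <= \sum_(x <- T n) s n x.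
Proof.
move=> s0 xT yT xy; have := @ler_sum_subseq R R [:: x; y] (T n) (s n).
rewrite big_cons big_seq1; apply => //.
- by rewrite /= inE andbT lt_eqF.
- exact: T_uniq.
- by move=> z; rewrite !inE => /orP[] /eqP->.
Qed.

Let sl0 n x : 0 <= sl n x. Proof. exact: sqr_ge0. Qed.
Let sr0 n x : 0 <= sr n x. Proof. exact: sqr_ge0. Qed.

Lemma lev_sides n : dl n ^+ 2 + dr n ^+ 2 <= lev R 1 1 c g n.
Proof.
apply: le_trans (lev_split n); rewrite -dr_sqr; apply: lerD.
  exact: (sum_one n 0 sl (sl0 n) (memT0 R n)).
exact: (sum_one n _ sr (sr0 n) (memT_last R n)).
Qed.

(* The path 1, 12, 121, 1211 = 1122, 112, 11 is parallel to the edge from 1 to 11. *)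
Lemma parallel_path : r <= 1 -> 
  r^-1 * (dl 1 ^+ 2 + dr 1 ^+ 2) + r ^- 2 * (dl 2 ^+ 2 + dr 2 ^+ 2) +
  r ^- 3 * (dl 3 ^+ 2 + dr 3 ^+ 2) + r^-1 * (dl 1 ^+ 2 / 5) <=
  r^-1 * lev R 1 1 c g 1 + r ^- 2 * lev R 1 1 c g 2 + r ^- 3 * lev R 1 1 c g 3.
Proof.
move=> r1; have r0' := r0.
have p0 := rho_gt0 R; have [rho35 rho1] : 3/5 < rho /\ rho < 31/50.
  by have /andP[] := rho_bounds R.
have h0 := rhoX R 0; have h1 := rhoX R 1; have h2 := rhoX R 2; have h3 := rhoX R 3.
have p5 := rhoX_gt0 R 5; have p3 := rhoX_gt0 R 3; have p4 := rhoX_gt0 R 4.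
rewrite expr0 expr1 in h0; rewrite expr1 in h1.
have T2r : rho ^+ 3 \in T 2.
  by have := memT_right R _ _ (memT0 R 1); rewrite add0r.
have T3r : rho ^+ 3 \in T 3 by apply: memT_left.
have T3m : rho ^+ 4 \in T 3.
  by have := memT_right R _ _ (memT0 R 2); rewrite add0r.
have L1 := sum_one 1 0 sl (sl0 1) (memT0 R 1).
have M1 : sr 1 0 + sr 1 (1 - rho ^+ 1) <= \sum_(x <- T 1) sr 1 x.
  apply: (sum_two 1 _ _ sr (sr0 1) (memT0 R 1) (memT_last R 1)).
  by rewrite expr1; lra.
have L2 := sum_two 2 _ _ sl (sl0 2) (memT0 R 2) T2r p3.
have M2 : sr 2 0 + sr 2 (1 - rho ^+ 2) <= \sum_(x <- T 2) sr 2 x.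
  by apply: (sum_two 2 _ _ sr (sr0 2) (memT0 R 2) (memT_last R 2)); lra.
have L3 := sum_two 3 _ _ sl (sl0 3) (memT0 R 3) T3r p3.
have M3 : sr 3 (rho ^+ 4) + sr 3 (1 - rho ^+ 3) <= \sum_(x <- T 3) sr 3 x.
  by apply: (sum_two 3 _ _ sr (sr0 3) T3m (memT_last R 3)); lra.
have S1 := lev_split 1; have S2 := lev_split 2; have S3 := lev_split 3.
rewrite dr_sqr in M1; rewrite dr_sqr in M2; rewrite dr_sqr in M3.
pose X1 := sr 1 0; pose X2 := sl 2 (rho ^+ 3) + sr 2 0; pose X3 := sl 3 (rho ^+ 3) + sr 3 (rho ^+ 4).
have D1 : dl 1 ^+ 2 + dr 1 ^+ 2 + X1 <= lev R 1 1 c g 1.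
  have e : sl 1 0 = dl 1 ^+ 2 by [].
  by rewrite e in L1; rewrite /X1; lra.
have D2 : dl 2 ^+ 2 + dr 2 ^+ 2 + X2 <= lev R 1 1 c g 2.
  have e : sl 2 0 = dl 2 ^+ 2 by [].
  by rewrite e in L2; rewrite /X2; lra.
have D3 : dl 3 ^+ 2 + dr 3 ^+ 2 + X3 <= lev R 1 1 c g 3.
  have e : sl 3 0 = dl 3 ^+ 2 by [].
  by rewrite e in L3; rewrite /X3; lra.
have X20 : 0 <= X2 by apply: addr_ge0.
have X30 : 0 <= X3 by apply: addr_ge0.
(* The five signed drops of the path sum to [dl 1]; this is the Cauchy-Schwarz inequality for
   them. *)
have cycle : dl 1 ^+ 2 / 5 <= X1 + X2 + X3.
  have E1 : sr 1 0 = (g 1 0 - g 2 (rho ^+ 3)) ^+ 2 by rewrite /sr add0r.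
  have E2 : sl 2 (rho ^+ 3) = (g 2 (rho ^+ 3) - g 3 (rho ^+ 3)) ^+ 2 by [].
  have E3 : sr 2 0 = (g 2 0 - g 3 (rho ^+ 4)) ^+ 2 by rewrite /sr add0r.
  have E4 : sl 3 (rho ^+ 3) = (g 3 (rho ^+ 3) - g 4 (rho ^+ 3)) ^+ 2 by [].
  have E5 : sr 3 (rho ^+ 4) = (g 3 (rho ^+ 4) - g 4 (rho ^+ 3)) ^+ 2 by rewrite /sr h3.
  rewrite /X1 /X2 /X3 E1 E2 E3 E4 E5 /dl.
  rewrite (_ : g 1 0 - g 2 0 = (g 1 0 - g 2 (rho ^+ 3)) + (g 2 (rho ^+ 3) - g 3 (rho ^+ 3))
    + (g 3 (rho ^+ 3) - g 4 (rho ^+ 3)) - (g 3 (rho ^+ 4) - g 4 (rho ^+ 3))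
    - (g 2 0 - g 3 (rho ^+ 4))); last by ring.
  move: (g 1 0 - _) (g 2 (rho ^+ 3) - _) (g 3 (rho ^+ 3) - _) (g 3 (rho ^+ 4) - _) (g 2 0 - _).
  move=> s1 s2 s3 s4 s5.
  rewrite -subr_ge0 (_ : _ - _ = ((s1 - s2) ^+ 2 + (s1 - s3) ^+ 2 + (s1 + s4) ^+ 2 + (s1 + s5) ^+ 2
    + (s2 - s3) ^+ 2 + (s2 + s4) ^+ 2 + (s2 + s5) ^+ 2 + (s3 + s4) ^+ 2 + (s3 + s5) ^+ 2
    + (s4 - s5) ^+ 2) / 5); last by field.
  by rewrite divr_ge0// !addr_ge0// sqr_ge0.
have i1 : 0 <= r^-1 by rewrite invr_ge0 ltW.
have i12 : r^-1 <= r ^- 2.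
  by rewrite lef_pV2 ?posrE ?exprn_gt0// expr2 ger_pMr.
have i13 : r^-1 <= r ^- 3.
  rewrite lef_pV2 ?posrE ?exprn_gt0// exprS ger_pMr//.
  by rewrite expr2; nra.
have P1 := ler_wpM2l i1 D1.
have P2 := ler_wpM2l (le_trans i1 i12) D2.
have P3 := ler_wpM2l (le_trans i1 i13) D3.
have C1 := ler_wpM2l i1 cycle.
have C2 := ler_wpM2r X20 i12.
have C3 := ler_wpM2r X30 i13.
move: P1 P2 P3 C1 C2 C3; clear.
move: (lev R 1 1 c g 1) (lev R 1 1 c g 2) (lev R 1 1 c g 3) => v1 v2 v3.
move: X1 X2 X3 (dl 1 ^+ 2) (dl 2 ^+ 2) (dl 3 ^+ 2) (dr 1 ^+ 2) (dr 2 ^+ 2) (dr 3 ^+ 2).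
move: (r^-1) (r ^- 2) (r ^- 3) => k1 k2 k3 X1 X2 X3 s1 s2 s3 t1 t2 t3 *.
lra.
Qed.

End Lower.

(* Without the parallel path the resistance of the left side is [(1 - r)^-1]; the
   path lowers the part [r] of the edge from 1 to 11 to at most [5 r / 6]. *)
Lemma eig_lower k : 0 <= k -> k * ((1 - r)^-1 - r / 6) <= 1 -> k + (1 - r) <= 2 * lam.
Proof.
move=> k0 hk; have r0' := r0; have r1 : r < 1 by case/andP: rr.
have h := conductances11 R c c0.
have [g ga gE] := tr_attained R 1 1 c r h rr 1 0 0; rewrite tr100 in gE.
pose dl n := g n 0 - g n.+1 0.
pose dr n := g n (1 - rho ^+ n) - g n.+1 (1 - rho ^+ n.+1).
(* The last term is the energy of the parallel path, credited to the left side. *)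
pose EL N := \sum_(n < N) r ^- n * dl n ^+ 2 + r^-1 * (dl 1 ^+ 2 / 5).
pose ER N := \sum_(n < N) r ^- n * dr n ^+ 2.
have rn0 n : 0 <= r ^- n by rewrite invr_ge0 exprn_ge0// ltW.
have energy N : EL (4 + N)%N + ER (4 + N)%N <= 2 * lam.
  apply: le_trans (gE (4 + N)%N); rewrite /EL /ER; elim: N => [|N IH].
    rewrite addn0 !enS en0 !big_ord_recr !big_ord0/= expr0 invr1 !expr1 !mul1r.
    have S0 := lev_sides g 0; have := parallel_path g (ltW r1).
    rewrite -/(dl 0) -/(dr 0) in S0.
    rewrite -/(dl 1) -/(dr 1) -/(dl 2) -/(dr 2) -/(dl 3) -/(dr 3).
    move: (lev R 1 1 c g 0) (lev R 1 1 c g 1) (lev R 1 1 c g 2) (lev R 1 1 c g 3) S0.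
    move: (dl 0 ^+ 2) (dl 1 ^+ 2) (dl 2 ^+ 2) (dl 3 ^+ 2).
    move: (dr 0 ^+ 2) (dr 1 ^+ 2) (dr 2 ^+ 2) (dr 3 ^+ 2).
    by move: (r^-1) (r ^- 2) (r ^- 3) => *; lra.
  rewrite addnS enS [X in X + _ + _ <= _]big_ord_recr/= [X in _ + X <= _]big_ord_recr/=.
  have := ler_wpM2l (rn0 (4 + N)%N) (lev_sides g (4 + N)).
  rewrite -/(dl (4 + N)%N) -/(dr (4 + N)%N) mulrDr.
  move: IH.
  move: (_ * dl _ ^+ 2) (_ * dr _ ^+ 2) (_ * lev _ _ _ _ _ _) => p s t.
  by move: (\sum_(_ < _) _ * dl _ ^+ 2) (\sum_(_ < _) _ * dr _ ^+ 2) => *; lra.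
have left N : (g 0%N 0 - g (2 + N)%N 0) ^+ 2 <=
    (\sum_(n < 2 + N) r ^+ n - r / 6) * EL (2 + N)%N.
  elim: N => [|N IH].
    rewrite addn0 /EL !big_ord_recr !big_ord0/= expr0 invr1 !expr1 !add0r mul1r.
    rewrite (_ : 1 + r - r / 6 = 1 + 5 / 6 * r); last by field.
    rewrite (_ : _ + r^-1 * _ = dl 0 ^+ 2 + 6 / 5 * (r^-1 * dl 1 ^+ 2)); last by field; rewrite gt_eqF.
    rewrite (_ : g 0%N 0 - g 2 0 = dl 0 + dl 1); last by rewrite /dl; ring.
    apply: sqr_series; rewrite ?mul1r//.
    - by rewrite mulr_ge0// ltW.
    - exact: sqr_ge0.
    - by rewrite mulr_ge0// mulr_ge0 ?sqr_ge0// invr_ge0 ltW.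
    - by rewrite le_eqVlt; apply/orP; left; apply/eqP; field; rewrite gt_eqF.
  rewrite addnS /EL [X in (X - _) * _]big_ord_recr/= [X in _ * (X + _)]big_ord_recr/=.
  rewrite (_ : g 0%N 0 - g (2 + N).+1 0 = (g 0%N 0 - g (2 + N)%N 0) + dl (2 + N)%N); last first.
    by rewrite /dl; ring.
  rewrite (_ : \sum_(_ < _) r ^+ _ + _ - _ = \sum_(n < 2 + N) r ^+ n - r / 6 + r ^+ (2 + N));
    last by ring.
  rewrite (_ : _ + _ + r^-1 * _ = EL (2 + N)%N + r ^- (2 + N) * dl (2 + N)%N ^+ 2);
    last by rewrite /EL; ring.
  apply: sqr_series => //.
  - rewrite big_ord_recl expr0/= big_ord_recl/= /bump/= expr1.
    have : 0 <= \sum_(i < N) r ^+ bump 0 (bump 0 i).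
      by apply: sumr_ge0 => i _; rewrite exprn_ge0// ltW.
    rewrite /bump/=; lra.
  - by rewrite exprn_ge0// ltW.
  - apply: addr_ge0; last by rewrite mulr_ge0 ?invr_ge0 ?(ltW r0')// divr_ge0// sqr_ge0.
    by apply: sumr_ge0 => i _; rewrite mulr_ge0 ?sqr_ge0.
  - by rewrite mulr_ge0 ?sqr_ge0.
  - by rewrite mulrA divff ?mul1r// expf_neq0// gt_eqF.
have right N : (g 0%N 0 - g N (1 - rho ^+ N)) ^+ 2 <= (\sum_(n < N) r ^+ n) * ER N.
  elim: N => [|N IH].
    by rewrite expr0 subrr subrr expr0n/= /ER !big_ord0 mul0r.
  rewrite /ER !big_ord_recr/=.
  rewrite (_ : g 0%N 0 - g N.+1 (1 - rho ^+ N.+1) = (g 0%N 0 - g N (1 - rho ^+ N)) + dr N);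
    last by rewrite /dr; ring.
  apply: sqr_series => //.
  - by apply: sumr_ge0 => i _; rewrite exprn_ge0// ltW.
  - by rewrite exprn_ge0// ltW.
  - by apply: sumr_ge0 => i _; rewrite mulr_ge0 ?sqr_ge0.
  - by rewrite mulr_ge0 ?sqr_ge0.
  - by rewrite mulrA divff ?mul1r// expf_neq0// gt_eqF.
have geo N : \sum_(n < N) r ^+ n <= (1 - r)^-1 by apply: geo_sum_le; rewrite (ltW r0') r1.
have EL0 N : 0 <= EL N.
  apply: addr_ge0; last by rewrite mulr_ge0 ?invr_ge0 ?(ltW r0')// divr_ge0// sqr_ge0.
  by apply: sumr_ge0 => i _; rewrite mulr_ge0 ?sqr_ge0.
have ER0 N : 0 <= ER N by apply: sumr_ge0 => i _; rewrite mulr_ge0 ?sqr_ge0.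
have bound N : k * (g 0%N 0 - g (4 + N)%N 0) ^+ 2 +
    (1 - r) * (g 0%N 0 - g (4 + N)%N (1 - rho ^+ (4 + N))) ^+ 2 <= 2 * lam.
  apply: le_trans (energy N); apply: lerD.
    apply: le_trans (ler_wpM2l k0 (left N.+2)) _.
    rewrite mulrA -[leRHS]mul1r; apply: ler_wpM2r => //.
    by apply: le_trans hk; apply: ler_wpM2l => //; rewrite lerD2r.
  have s1 : 0 <= 1 - r by lra.
  apply: le_trans (ler_wpM2l s1 (right (4 + N)%N)) _.
  rewrite mulrA -[leRHS]mul1r; apply: ler_wpM2r => //.
  by rewrite mulrC -ler_pdivlMr ?mul1r//; lra.
have [g0 g1 g2] := ga; rewrite g0 in bound.
have lim1 : (fun N => k * (1 - g N 0) ^+ 2 + (1 - r) * (1 - g N (1 - rho ^+ N)) ^+ 2) @ \oo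
    --> k * (1 - 0) ^+ 2 + (1 - r) * (1 - 0) ^+ 2.
  have sq (u : nat -> R) : u @ \oo --> (0 : R) ->
      (fun N => (1 - u N) ^+ 2) @ \oo --> ((1 - 0) ^+ 2 : R).
    move=> hu; apply: (@cvg_comp _ _ _ (fun N => 1 - u N) (fun x => x ^+ 2));
      last exact: exprn_continuous.
    by apply: cvgB => //; exact: cvg_cst.
  by apply: cvgD; apply: cvgMr; apply: sq.
suff : k * (1 - 0) ^+ 2 + (1 - r) * (1 - 0) ^+ 2 <= 2 * lam by rewrite subr0 expr1n !mulr1.
apply: (@closed_cvg _ _ _ _ _ (fun x => x <= 2 * lam) _ _ _ lim1); first exact: closed_le.
by exists 4%N => // n /= n4; have := bound (n - 4)%N; rewrite subnKC.
Qed.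

End Fixed.

(** Here [r ^+ 2 = 0.3844], while the two sides alone give only [lam >= 0.38]. With the path the
    left side has conductance at least 0.39, so [2 * lam >= 0.39 + 0.38]. *)
Lemma eig_gt_sqr c lam : 0 <= c -> eig R (31/50) lam 1 1 c -> (31/50) ^+ 2 < lam.
Proof.
move=> c0 el.
have rr : rho < (31/50 : R) < 1 by have /andP[_ ->] := rho_bounds R; lra.
have k0 : 0 <= 39/100 :> R by lra.
have kr : 39/100 * ((1 - 31/50)^-1 - 31/50 / 6) <= 1 :> R.
  by rewrite (_ : (1 - 31/50)^-1 = 50/19 :> R); [lra|field].
have := eig_lower c (31/50) lam c0 rr el (39/100) k0 kr.
by rewrite expr2; lra.
Qed.

End EigenvalueBounds.

(** * The gasket as a network of levels *)

Section Coordinates.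
Variable R : realType.
Implicit Types x y c : R.

Lemma near_fst_gt x y c : c < x -> \forall p \near (x, y), c < p.1.
Proof.
move=> cx; have h : (fun p : R * R => p.1) @ nbhs (x, y) --> x.
  exact: (@cvg_fst _ _ (nbhs x) (nbhs y)).
exact: (cvgr_gt x h _ cx).
Qed.

Lemma near_fst_lt x y c : x < c -> \forall p \near (x, y), p.1 < c.
Proof.
move=> cx; have h : (fun p : R * R => p.1) @ nbhs (x, y) --> x.
  exact: (@cvg_fst _ _ (nbhs x) (nbhs y)).
exact: (cvgr_lt x h _ cx).
Qed.

Lemma near_snd_gt x y c : c < y -> \forall p \near (x, y), c < p.2.
Proof.
move=> cy; have h : (fun p : R * R => p.2) @ nbhs (x, y) --> y.
  exact: (@cvg_snd _ _ (nbhs x) (nbhs y)).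
exact: (cvgr_gt y h _ cy).
Qed.

Lemma near_snd_lt x y c : y < c -> \forall p \near (x, y), p.2 < c.
Proof.
move=> cy; have h : (fun p : R * R => p.2) @ nbhs (x, y) --> y.
  exact: (@cvg_snd _ _ (nbhs x) (nbhs y)).
exact: (cvgr_lt y h _ cy).
Qed.

End Coordinates.

Section Gasket.
Variable R : realType.
Local Notation rho := (rho R).
Local Notation T := (shifts R).
Local Notation FW := (@Fw R).
Local Notation Lev := (lev R).
Local Notation En := (en R).
Implicit Types (n m : nat) (x y : R) (v w : seq 'I_3).

Let i1 : 'I_3 := inord 1.
Let i2 : 'I_3 := inord 2.

Lemma val_i1 : val i1 = 1%N. Proof. by rewrite /i1 /= inordK. Qed.
Lemma val_i2 : val i2 = 2%N. Proof. by rewrite /i2 /= inordK. Qed.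

Lemma ord3P (i : 'I_3) : [\/ i = ord0, i = i1 | i = i2].
Proof.
case: i => -[|[|[|//]]] h; [constructor 1|constructor 2|constructor 3]; apply: val_inj => //=.
  by rewrite val_i1.
by rewrite val_i2.
Qed.

Lemma sum_ord3 (h : 'I_3 -> R) : \sum_(i < 3) h i = h ord0 + h i1 + h i2.
Proof.
rewrite !big_ord_recl big_ord0 addr0 addrA; congr (_ + h _ + h _); apply: val_inj => //=.
  by rewrite val_i1.
by rewrite val_i2.
Qed.

Lemma DformE (a : 'I_3 -> 'I_3 -> R) u : inM a ->
  Dform a u = tri R (a ord0 i1) (a ord0 i2) (a i1 i2) (u ord0) (u i1) (u i2).
Proof.
move=> [sym diag _ _]; rewrite /Dform sum_ord3 !sum_ord3 !diag.
by rewrite (sym i1 ord0) (sym i2 ord0) (sym i2 i1) /tri; field.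
Qed.

(** Irreducibility on the three singletons gives every vertex a positive coefficient, which forces
    two positive ones among the three. *)
Lemma inM_conductances (a : 'I_3 -> 'I_3 -> R) : inM a ->
  conductances R (a ord0 i1) (a ord0 i2) (a i1 i2).
Proof.
move=> [sym diag nn irr]; split => //.
have ex (i : 'I_3) : exists2 j, j != i & 0 < a i j.
  have [||k [j [ki ji kj]]] := irr [set i]%SET; rewrite ?cards1//.
  move: ki ji; rewrite !inE => /eqP ki ji; exists j => //.
  by rewrite -ki.
have e01 : a i1 ord0 = a ord0 i1 by [].
have e02 : a i2 ord0 = a ord0 i2 by [].
have e12 : a i2 i1 = a i1 i2 by [].
have A : 0 < a ord0 i1 \/ 0 < a ord0 i2.
  by have [j j0] := ex ord0; case: (ord3P j) j0 => -> //; [left|right].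
have B : 0 < a ord0 i1 \/ 0 < a i1 i2.
  by have [j j0] := ex i1; case: (ord3P j) j0 => -> //; rewrite ?eqxx// ?e01; [left|right].
have C : 0 < a ord0 i2 \/ 0 < a i1 i2.
  by have [j j0] := ex i2; case: (ord3P j) j0 => -> //; rewrite ?eqxx// ?e02 ?e12; [left|right].
have n1 := nn ord0 i1; have n2 := nn ord0 i2; have n3 := nn i1 i2.
move: (a ord0 i1) (a ord0 i2) (a i1 i2) A B C n1 n2 n3 => p s t A B C p0 s0 t0.
have ps := mulr_ge0 p0 s0; have st := mulr_ge0 s0 t0; have tp := mulr_ge0 t0 p0.
case: A => [P|S].
  case: C => [S|T']; first by have := mulr_gt0 P S; lra.
  by have := mulr_gt0 T' P; lra.
case: B => [P|T']; first by have := mulr_gt0 P S; lra.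
by have := mulr_gt0 S T'; lra.
Qed.

Definition coefs (b : R) (i j : 'I_3) : R :=
  if i == j then 0 else if (i == ord0) || (j == ord0) then 1 else b.

Lemma i1_neq0 : i1 != ord0. Proof. by rewrite -val_eqE /= val_i1. Qed.
Lemma i2_neq0 : i2 != ord0. Proof. by rewrite -val_eqE /= val_i2. Qed.
Lemma i1_neqi2 : i1 != i2. Proof. by rewrite -val_eqE /= val_i1 val_i2. Qed.

Lemma coefs01 b : coefs b ord0 i1 = 1.
Proof. by rewrite /coefs eqxx eq_sym (negbTE i1_neq0). Qed.

Lemma coefs02 b : coefs b ord0 i2 = 1.
Proof. by rewrite /coefs eqxx eq_sym (negbTE i2_neq0). Qed.

Lemma coefs12 b : coefs b i1 i2 = b.
Proof. by rewrite /coefs (negbTE i1_neq0) (negbTE i2_neq0) (negbTE i1_neqi2). Qed.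

Lemma coefs_inMS b : 0 <= b -> inMS (coefs b).
Proof.
move=> b0; split; last first.
  by rewrite -/i1 -/i2 coefs01 coefs02.
split.
- by move=> i j; rewrite /coefs eq_sym orbC.
- by move=> i; rewrite /coefs eqxx.
- by move=> i j; rewrite /coefs; case: ifP => // _; case: ifP.
move=> S S0 S3; have [zS|zS] := boolP (ord0 \in S).
  have [j jS] : exists j : 'I_3, j \notin S.
    apply/existsP; rewrite -negb_forall; apply: contraTN S3 => /forallP h.
    have -> : S = [set: 'I_3]%SET by apply/setP => k; rewrite inE h.
    by rewrite cardsT card_ord.
  exists ord0, j; split => //; rewrite /coefs eqxx/=.
  by case: eqP => // e; rewrite -e zS in jS.
have /card_gt0P [i iS] := S0.
exists i, ord0; split => //; rewrite /coefs eqxx orbT.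
by case: eqP => // e; rewrite -e iS in zS.
Qed.

(* The bottom vertices of a cell are top vertices of cells of the next level, as
   [F 0 (q i) = F i (q 0)]. *)
Definition node n x : pt R := (x + rho ^+ n / 2, rho ^+ n * (Num.sqrt 3 / 2)).

Lemma sqrt3_gt0 : 0 < Num.sqrt 3 / 2 :> R.
Proof. by rewrite divr_gt0// sqrtr_gt0. Qed.

Lemma rhoX_inj n m : rho ^+ n = rho ^+ m -> n = m.
Proof.
have p0 := rho_gt0 R; have p1 : rho < 1 by have /andP[_ h] := rho_bounds R; lra.
move=> e.
have [h|h|//] := ltngtP n m.
  by have := ltr_iXn2l p0 p1 m n; rewrite e ltxx h.
by have := ltr_iXn2l p0 p1 n m; rewrite e ltxx h.
Qed.

(** The height determines the level, and then the abscissa determines the shift. *)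
Lemma node_inj n m x y : node n x = node m y -> n = m /\ x = y.
Proof.
move=> [e1 e2]; have nm : n = m.
  by apply: rhoX_inj; apply: (mulIf _ e2); rewrite gt_eqF// sqrt3_gt0.
by split => //; move: e1; rewrite nm => /addIr.
Qed.

Fixpoint shift v : R :=
  if v is i :: v' then (if i == i2 then rho ^+ 2 else 0) + rho * shift v' else 0.

Lemma Fw_affine v p : all (fun i => i != ord0) v ->
  FW v p = (rho ^+ size v * p.1 + shift v, rho ^+ size v * p.2).
Proof.
elim: v => [_|i v IH /= /andP[i0 /IH]]; first by rewrite /= expr0 !mul1r addr0 -surjective_pairing.
rewrite /Fw /= -/(FW v) => ->; rewrite /F /=.
case: (ord3P i) i0 => -> // _.
  rewrite /q /Defs.ratio !val_i1 /= (negbTE i1_neqi2) exprS.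
  by congr (_, _); ring.
rewrite /q /Defs.ratio !val_i2 /= eqxx exprS rho_sqr.
by congr (_, _); ring.
Qed.

Lemma Fw_rcons v i p : FW (rcons v i) p = FW v (F i p).
Proof. by elim: v => //= j v IH; rewrite /Fw /= -/(FW _) IH. Qed.

Lemma shift_rcons v i :
  shift (rcons v i) = shift v + rho ^+ size v * (if i == i2 then rho ^+ 2 else 0).
Proof.
elim: v => [|j v IH] /=; first by rewrite mulr0 addr0 add0r expr0 mul1r.
rewrite IH (exprS _ (size v)).
move: (if j == _ then _ else _) (if i == _ then _ else _) => X Y.
by ring.
Qed.

(** [Fw] applies the last letter first, so the recursion of [shifts] corresponds to appending a
    letter at the end of the word. *)
Lemma memT_shift n x : x \in T n <->
  exists v, [/\ all (fun i => i != ord0) v, size v = n & shift v = x].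
Proof.
elim: n x => [x|n IH x].
  rewrite inE; split => [/eqP->|[v [_ /size0nil -> <-]]]; first by exists [::].
  by rewrite eqxx.
rewrite memTS; split => [/orP[/IH|/IH] [v [av sv ev]]|[v]].
- exists (rcons v i1); rewrite all_rcons av i1_neq0 size_rcons sv; split => //.
  by rewrite shift_rcons (negbTE i1_neqi2) mulr0 addr0.
- exists (rcons v i2); rewrite all_rcons av i2_neq0 size_rcons sv; split => //.
  by rewrite shift_rcons eqxx ev sv -exprD addn2 subrK.
case/lastP: v => [[]//|v i] [].
rewrite all_rcons size_rcons => /andP[i0 av] [sv].
rewrite shift_rcons => ev; apply/orP; have vT : shift v \in T n by apply/IH; exists v.
move: ev; case: eqP => _ ev; [right|left]; move: ev.
  by rewrite sv -exprD addn2 => <-; rewrite addrK.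
by rewrite mulr0 addr0 => <-.
Qed.

Lemma F0_affine (p : pt R) :
  F ord0 p = (rho ^+ 2 * (p.1 - 1 / 2) + 1 / 2, rho ^+ 2 * (p.2 - Num.sqrt 3 / 2) + Num.sqrt 3 / 2).
Proof. by []. Qed.

Lemma cell_vertices v : all (fun i => i != ord0) v ->
  [/\ FW (rcons v ord0) (q R ord0) = node (size v) (shift v),
      FW (rcons v ord0) (q R i1) = node (size v).+1 (shift v) &
      FW (rcons v ord0) (q R i2) = node (size v).+1 (shift v + rho ^+ (size v).+2)].
Proof.
move=> av; rewrite !Fw_rcons !Fw_affine// !F0_affine /node /q val_i1 val_i2 /=.
have e := rho_sqr R.
have e2 : rho ^+ (size v).+2 = rho ^+ size v * (1 - rho) by rewrite -e -exprD addn2.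
have e1 : rho ^+ (size v).+1 = rho * rho ^+ size v by rewrite exprS.
by split; congr (_, _); rewrite ?e2 ?e1 ?e; field.
Qed.

Section Transversal.
Variable W1 : set (seq 'I_3).
Hypothesis W1v : validW1 R W1.

Let W1_unique w w' : W1 w -> W1 w' -> FW w = FW w' -> w = w'.
Proof.
move=> W1w W1w' e; have [hs hu] := W1v.
have [z [_ zu]] := hu w' (hs _ W1w').
by rewrite -(zu w (conj W1w e)) -(zu w' (conj W1w' erefl)).
Qed.

Lemma W1_shape w : W1 w -> exists v, [/\ all (fun i => i != ord0) v, w = rcons v ord0,
  (size w).-1 = size v & shift v \in T (size v)].
Proof.
move=> /W1v.1[v [av ->]]; exists v; split => //; first by rewrite size_rcons.
by apply/memT_shift; exists v.
Qed.

Lemma same_map v v' : all (fun i => i != ord0) v -> all (fun i => i != ord0) v' ->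
  size v = size v' -> shift v = shift v' -> FW (rcons v ord0) = FW (rcons v' ord0).
Proof.
move=> av av' es et; apply/funext => p.
by rewrite !Fw_rcons !Fw_affine// es et.
Qed.

(** The representative in [W1] may be another word than the one at hand; the position of its top
    vertex shows that length and shift agree. *)
Lemma cell_word n x : x \in T n ->
  exists v, [/\ all (fun i => i != ord0) v, W1 (rcons v ord0), size v = n & shift v = x].
Proof.
move=> /memT_shift[v [av sv ev]].
have [|w [[W1w e] _]] := W1v.2 (rcons v ord0); first by exists v.
have [v' [av' ew _ _]] := W1_shape w W1w; rewrite ew in W1w e.
have [h _ _] := cell_vertices v av; have [h' _ _] := cell_vertices v' av'.
have [e1 e2] : size v' = size v /\ shift v' = shift v.
  by apply: node_inj; rewrite -h -h' e.
by exists v'; rewrite e1 e2.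
Qed.

Lemma V1P p : V1 W1 p <-> exists n x, x \in T n /\ p = node n x.
Proof.
split=> [[w W1w [i ->]]|[n [x [xT ->]]]].
  have [v [av -> _ vT]] := W1_shape w W1w.
  have [h0 h1 h2] := cell_vertices v av; case: (ord3P i) => ->.
  - by exists (size v), (shift v).
  - by exists (size v).+1, (shift v); split => //; apply: memT_left.
  - by exists (size v).+1, (shift v + rho ^+ (size v).+2); split => //; apply: memT_right.
have [v [av W1w <- <-]] := cell_word n x xT.
by exists (rcons v ord0) => //; exists ord0; have [-> _ _] := cell_vertices v av.
Qed.

Definition levels (f : pt R -> R) n x := f (node n x).

Section Coefficients.
Variables (a : 'I_3 -> 'I_3 -> R) (r : R).
Hypotheses (aM : inM a) (r0 : 0 < r).
Local Notation al := (a ord0 i1).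
Local Notation be := (a ord0 i2).
Local Notation ga := (a i1 i2).

Let weight (f : pt R -> R) w : \bar R :=
  (r ^ (1 - (size w)%:Z) * Dform a (fun i => f (FW w (q R i))))%:E.

Let weight_ge0 f w : (0 <= weight f w)%E.
Proof.
rewrite lee_fin mulr_ge0//; first by rewrite exprz_ge0// ltW.
by rewrite DformE// tri_ge0//; apply: inM_conductances.
Qed.

Let weightE f v : all (fun i => i != ord0) v ->
  weight f (rcons v ord0) = (r ^- size v * cell R al be ga (levels f) (size v) (shift v))%:E.
Proof.
move=> av; congr (_ * _)%:E.
  rewrite size_rcons (_ : 1 - (size v).+1%:Z = - (size v)%:Z)%R; first by rewrite exprnN.
  by rewrite -addn1 PoszD opprD addrCA subrr addr0.
rewrite DformE// /cell /levels.
by have [-> -> ->] := cell_vertices v av.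
Qed.

Lemma Psi_sup f :
  Psi W1 r a f = ereal_sup (range (fun N => (En al be ga r (levels f) N)%:E)).
Proof.
have abc := inM_conductances a aM.
(* Because of the final letter 0, level [n] consists of words of length [n.+1], and the exponent
   [1 - size w] is [- n]. *)
pose J n := [set w | W1 w /\ size w = n.+1].
have JW : W1 = \bigcup_(n in setT) J n.
  apply/seteqP; split => [w W1w|w [n _ []//]].
  exists (size w).-1 => //; split => //.
  by have [v [_ -> _ _]] := W1_shape w W1w; rewrite size_rcons.
have JE n : (\esum_(w in J n) weight f w = (r ^- n * Lev al be ga (levels f) n)%:E)%E.
  have wd x : exists w, x \in T n -> exists v, [/\ all (fun i => i != ord0) v,
      W1 w, w = rcons v ord0, size v = n & shift v = x].
    have [xT|xT] := boolP (x \in T n); last by exists [::].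
    by have [v [? ? ? ?]] := cell_word n x xT; exists (rcons v ord0) => _; exists v.
  have [e eP] := choice wd.
  have bij : set_bij [set` T n] (J n) e.
    split.
    - move=> x /= xT; have [v [_ W1w ew sv _]] := eP x xT; split => //.
      by rewrite ew size_rcons sv.
    - move=> x y; rewrite !inE => xT yT exy.
      have [v [av _ ev sv <-]] := eP x xT; have [v' [av' _ ev' sv' <-]] := eP y yT.
      by move: exy; rewrite ev ev' => /rcons_inj[->].
    - move=> w [W1w sw]; have [v [av ew sv vT]] := W1_shape w W1w.
      have svn : size v = n by move: sw; rewrite ew size_rcons => -[].
      rewrite svn in vT; exists (shift v) => //.
      have [v' [av' W1w' ew' sv' st']] := eP _ vT.
      by apply: W1_unique => //; rewrite ew' ew; apply: same_map => //; rewrite svn.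
  rewrite (@reindex_esum _ _ _ _ _ e _ bij).
  rewrite esum_fset; [|exact: finite_seq|by move=> x _; apply: weight_ge0].
  rewrite -fsbig_seq ?T_uniq// /lev mulr_sumr -sumEFin big_seq [RHS]big_seq.
  apply: eq_bigr => x xT; have [v [av _ -> sv <-]] := eP x xT.
  by rewrite weightE// sv.
have triv : trivIset setT J.
  by move=> m n _ _ [w [[_ e1] [_ e2]]]; move: e1; rewrite e2 => -[].
have -> : Psi W1 r a f = \esum_(w in \bigcup_(n in setT) J n) weight f w.
  by rewrite /Psi {1}JW.
rewrite (@esum_bigcupT _ _ _ J (weight f) triv (weight_ge0 f)).
under eq_esum do rewrite JE.
rewrite -nneseries_esumT; last first.
  by move=> n; rewrite lee_fin mulr_ge0 ?lev_ge0// invr_ge0 exprn_ge0// ltW.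
apply/cvg_lim => //.
have -> : (fun N => \sum_(0 <= n < N) (r ^- n * Lev al be ga (levels f) n)%:E)%E =
    (fun N => (En al be ga r (levels f) N)%:E).
  by apply/funext => N; rewrite sumEFin big_mkord.
apply: ereal_nondecreasing_cvgn => N M NM; rewrite lee_fin.
exact: en_nondecreasing.
Qed.

Lemma Psi_le f M : (Psi W1 r a f <= M%:E)%E <-> forall N, En al be ga r (levels f) N <= M.
Proof.
rewrite Psi_sup; split => [h N|h].
  rewrite -lee_fin; apply: le_trans h; apply: ereal_sup_ubound.
  by exists N.
by apply: ge_ereal_sup => _ [N _ <-]; rewrite lee_fin.
Qed.

Lemma Psi_ge0 f : (0 <= Psi W1 r a f)%E.
Proof.
by rewrite Psi_sup; apply: ereal_sup_ubound; exists 0%N => //; rewrite en0.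
Qed.

End Coefficients.

Lemma V1_node n x : x \in T n -> V1 W1 (node n x).
Proof. by move=> xT; apply/V1P; exists n, x. Qed.

Lemma cvg_along_nodes (f : pt R -> R) (p : pt R) (l : R) (x : nat -> R) : (forall n, x n \in T n) ->
  f @ within (V1 W1) (nbhs p) --> l -> (fun n => node n (x n)) @ \oo --> p ->
  (fun n => levels f n (x n)) @ \oo --> l.
Proof.
move=> xT fl np P /fl hP; have hN := np _ hP.
by case: hN => N _ hN; exists N => // n Nn; apply: hN => //; apply: V1_node.
Qed.

Let rhoX_cvg0 (k : R) : (fun n => rho ^+ n * k) @ \oo --> (0 : R).
Proof.
apply: expr_cvg0; apply/andP; split; first by rewrite ltW// rho_gt0.
by have /andP[_ h] := rho_bounds R; lra.
Qed.

Lemma node_left_cvg : (fun n => node n 0) @ \oo --> q R i1.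
Proof.
rewrite /q val_i1 /=.
apply: (@cvg_pair _ _ _ \oo (nbhs (0 : R)) (nbhs (0 : R))) => //=.
by under eq_fun do rewrite add0r; apply: rhoX_cvg0.
Qed.

Lemma node_right_cvg : (fun n => node n (1 - rho ^+ n)) @ \oo --> q R i2.
Proof.
rewrite /q val_i2 /=.
apply: (@cvg_pair _ _ _ \oo (nbhs (1 : R)) (nbhs (0 : R))) => //=.
rewrite (_ : (fun n => _) = (fun n => 1 - rho ^+ n * (1 / 2))); last first.
  by apply/funext => n; field.
have h : (fun n => 1 - rho ^+ n * (1 / 2)) @ \oo --> (1 - 0 : R).
  by apply: cvgB; [exact: cvg_cst|exact: rhoX_cvg0].
by rewrite subr0 in h.
Qed.

Lemma node_root : node 0 0 = q R ord0.
Proof. by rewrite /node expr0 add0r [X in (_, X)]mul1r. Qed.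

Lemma adm_of_limits f (u : 'I_3 -> R) :
  (forall i, f @ within (V1 W1) (nbhs (q R i)) --> u i) ->
  adm R (levels f) (u ord0) (u i1) (u i2).
Proof.
move=> h; split.
(* The top vertex itself lies in [V1], so the limit within [V1] is the value there. *)
- apply/eqP; rewrite -subr_eq0 -normr_le0; apply/ler_addgt0Pr => e e0; rewrite add0r distrC.
  have /cvgrPdist_le/(_ _ e0) := h ord0 => /nbhs_singleton; rewrite /levels node_root.
  by apply; rewrite -node_root; apply: V1_node; apply: memT0.
- exact: (cvg_along_nodes _ _ _ _ (memT0 R) (h i1) node_left_cvg).
- exact: (cvg_along_nodes _ _ _ _ (memT_last R) (h i2) node_right_cvg).
Qed.

Section Limits.
Variables (a b c r M u0 u1 u2 : R) (f : pt R -> R).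
Hypotheses (abc : conductances R a b c) (rr : rho < r < 1).
Hypotheses (adm_f : adm R (levels f) u0 u1 u2) (fM : forall N, En a b c r (levels f) N <= M).

Let r01 : 0 < r < 1.
Proof. by have := rho_gt0 R; case/andP: rr => *; apply/andP; split; lra. Qed.

Let small_level (e : R) : 0 < e -> exists m, r ^+ m * (M / (kap R a b c * (1 - r))) <= (e / 2) ^+ 2.
Proof.
move=> e0; have e2 : 0 < (e / 2) ^+ 2 by rewrite exprn_gt0// divr_gt0.
have r01' : 0 <= r < 1 by case/andP: r01 => *; apply/andP; split; lra.
have /cvgrPdist_le/(_ _ e2) := expr_cvg0 R r (M / (kap R a b c * (1 - r))) r01'.
move=> [m _ hm]; exists m; have := hm m (leqnn m).
by rewrite /= sub0r normrN; apply: le_trans; apply: ler_norm.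
Qed.

Let sqr_split (e s t l : R) : 0 < e -> (s - l) ^+ 2 <= (e / 2) ^+ 2 -> (s - t) ^+ 2 <= (e / 2) ^+ 2 ->
  `|l - t| <= e.
Proof.
move=> e0 h1 h2; have e2 : 0 <= e / 2 by rewrite divr_ge0// ltW.
have H x : x ^+ 2 <= (e / 2) ^+ 2 -> `|x| <= e / 2.
  by move=> h; rewrite -(@ler_pXn2r _ 2)// ?nnegrE// real_normK ?num_real.
rewrite (_ : l - t = (s - t) - (s - l)); last by ring.
by apply: le_trans (ler_normB _ _) _; have := H _ h1; have := H _ h2; lra.
Qed.

Let small_height m n : rho ^+ n * (Num.sqrt 3 / 2) < rho ^+ m * (Num.sqrt 3 / 2) -> (m <= n)%N.
Proof.
rewrite ltr_pM2r ?sqrt3_gt0// => h; rewrite leqNgt; apply/negP => nm.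
have p0 := rho_gt0 R; have p1 : rho < 1 by have /andP[_ h'] := rho_bounds R; lra.
by have := ler_wiXn2l (ltW p0) (ltW p1) (ltnW nm); rewrite leNgt h.
Qed.

(** The top vertex is isolated in [V1]: every other vertex has at most [rho] times its height. *)
Lemma limit_root : f @ within (V1 W1) (nbhs (q R ord0)) --> u0.
Proof.
have p0 := rho_gt0 R; have /andP[_ p1] := rho_bounds R.
have top : rho * (Num.sqrt 3 / 2) < Num.sqrt 3 / 2.
  by have := sqrt3_gt0; move: (Num.sqrt 3 / 2) => s; nra.
apply/cvgrPdist_le => e e0; near=> p.
have /V1P[n [x [xT ep]]] : V1 W1 p by near: p; apply: withinT.
have hp : rho * (Num.sqrt 3 / 2) < p.2.
  by near: p; apply: cvg_within; apply: near_snd_gt.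
have n0 : n = 0%N.
  case: n => // n in ep xT *; move: hp; rewrite ep /node /= ltr_pM2r ?sqrt3_gt0//.
  have rn : rho ^+ n <= 1 by apply: exprn_ile1; lra.
  by rewrite exprS ltr_pMr// ltNge rn.
move: xT; rewrite ep n0 inE => /eqP->; have [g0 _ _] := adm_f.
by rewrite -g0 subrr normr0 ltW.
Unshelve. all: by end_near. Qed.

(** Small height forces a level [n >= m], and a small abscissa a shift below [rho ^+ m.+1]. The
    value there and the limit [u1] are then both close to the value at the left corner of level
    [m]. *)
Lemma limit_left : f @ within (V1 W1) (nbhs (q R i1)) --> u1.
Proof.
rewrite /q val_i1 /=.
apply/cvgrPdist_le => e e0; have [m hm] := small_level e e0.
have s0 : 0 < rho ^+ m * (Num.sqrt 3 / 2) by rewrite mulr_gt0 ?sqrt3_gt0// rhoX_gt0.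
near=> p.
have /V1P[n [x [xT ep]]] : V1 W1 p by near: p; apply: withinT.
have h1 : p.1 < rho ^+ m.+1.
  near: p; apply: cvg_within; apply: near_fst_lt; exact: rhoX_gt0.
have h2 : p.2 < rho ^+ m * (Num.sqrt 3 / 2).
  near: p; apply: cvg_within; apply: near_snd_lt; exact: s0.
rewrite ep /node /= in h1 h2.
have xm : x < rho ^+ m.+1 by have := rhoX_gt0 R n; lra.
have B1 := left_corner_bound R a b c r abc r01 _ M m n x fM (small_height _ _ h2) xT xm.
have B2 := root_corner_left R a b c r abc rr _ _ _ _ M adm_f fM m.
rewrite ep; apply: (sqr_split e (levels f m 0)) => //.
  exact: le_trans B2 hm.
exact: le_trans B1 hm.
Unshelve. all: by end_near. Qed.

Lemma limit_right : f @ within (V1 W1) (nbhs (q R i2)) --> u2.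
Proof.
rewrite /q val_i2 /=.
apply/cvgrPdist_le => e e0; have [m hm] := small_level e e0.
have s0 : 0 < rho ^+ m * (Num.sqrt 3 / 2) by rewrite mulr_gt0 ?sqrt3_gt0// rhoX_gt0.
near=> p.
have /V1P[n [x [xT ep]]] : V1 W1 p by near: p; apply: withinT.
have h1 : 1 - rho ^+ m.+1 < p.1.
  near: p; apply: cvg_within; apply: near_fst_gt; have := rhoX_gt0 R m.+1; lra.
have h2 : p.2 < rho ^+ m * (Num.sqrt 3 / 2).
  near: p; apply: cvg_within; apply: near_snd_lt; exact: s0.
rewrite ep /node /= in h1 h2.
have xm : 1 - rho ^+ n - x < rho ^+ m.+1 by have := rhoX_gt0 R n; lra.
have B1 := right_corner_bound R a b c r abc r01 _ M m n x fM (small_height _ _ h2) xT xm.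
have B2 := root_corner_right R a b c r abc rr _ _ _ _ M adm_f fM m.
rewrite ep; apply: (sqr_split e (levels f m (1 - rho ^+ m))) => //.
  exact: le_trans B2 hm.
exact: le_trans B1 hm.
Unshelve. all: by end_near. Qed.

End Limits.

Lemma levels_surjective (g : nat -> R -> R) : exists f, levels f = g.
Proof.
have H (p : pt R) : exists l : R, forall n x, p = node n x -> l = g n x.
  have [[n [x e]]|no] := pselect (exists n x, p = node n x).
    by exists (g n x) => m y; rewrite e => /node_inj[-> ->].
  by exists 0 => n x e; case: no; exists n, x.
have [f fP] := choice H.
by exists f; apply/funext => n; apply/funext => x; apply: fP.
Qed.

Lemma RrE (a : 'I_3 -> 'I_3 -> R) r u : inM a -> rho < r < 1 ->
  Rr W1 r a u = (tr R (a ord0 i1) (a ord0 i2) (a i1 i2) r (u ord0) (u i1) (u i2))%:E.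
Proof.
move=> aM rr; have abc := inM_conductances a aM.
have r0 : 0 < r by have := rho_gt0 R; case/andP: rr; lra.
apply/eqP; rewrite eq_le; apply/andP; split.
  have [g ga gE] := tr_attained R _ _ _ r abc rr (u ord0) (u i1) (u i2).
  have [f fg] := levels_surjective g; rewrite -fg in ga gE.
  have fE := (Psi_le a r aM r0 f _).2 gE.
  apply: le_trans fE; apply: ereal_inf_lbound; exists f => //; split.
    by apply: le_lt_trans ((Psi_le a r aM r0 f _).2 gE) (ltry _).
  move=> i; case: (ord3P i) => ->.
  - exact: (limit_root _ _ _ f ga).
  - exact: (limit_left _ _ _ r _ _ _ _ f abc rr ga gE).
  - exact: (limit_right _ _ _ r _ _ _ _ f abc rr ga gE).
apply: le_ereal_inf_tmp => _ [f [ffin flim] <-].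
have ge0 := Psi_ge0 a r aM r0 f.
have fin : Psi W1 r a f \is a fin_num by rewrite ge0_fin_numE.
rewrite -(fineK fin) lee_fin; apply: (tr_le R _ _ _ _ _ _ _ _ _ (adm_of_limits f u flim)).
by apply/(Psi_le a r aM r0 f); rewrite fineK.
Qed.

Lemma eigenE (a : 'I_3 -> 'I_3 -> R) r l : inM a -> rho < r < 1 ->
  eigen W1 r l a <-> eig R r l (a ord0 i1) (a ord0 i2) (a i1 i2).
Proof.
move=> aM rr; split => [h u0 u1 u2|h u]; last by rewrite RrE// h DformE.
pose u (i : 'I_3) := if i == ord0 then u0 else if i == i1 then u1 else u2.
have := h u; rewrite RrE// DformE// /u eqxx (negbTE i1_neq0) (negbTE i2_neq0) eqxx.
by rewrite [i2 == i1]eq_sym (negbTE i1_neqi2) => -[].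
Qed.

End Transversal.
End Gasket.

Lemma eigen_coefs (R : realType) (W1 : set (seq 'I_3)) r l b : validW1 R W1 -> 0 <= b ->
  rho R < r < 1 -> eigen W1 r l (coefs R b) <-> eig R r l 1 1 b.
Proof.
move=> W1v b0 rr; have [cM _] := coefs_inMS R b b0.
by rewrite (eigenE R W1 W1v _ _ _ cM rr) coefs01 coefs02 coefs12.
Qed.

Lemma eigen_unique (R : realType) (W1 : set (seq 'I_3)) r l l' a a' : validW1 R W1 ->
  rho R < r < 1 -> inM a -> inM a' -> eigen W1 r l a -> eigen W1 r l' a' ->
  l' = l /\ exists2 c : R, 0 < c & forall u, Dform a' u = c * Dform a u.
Proof.
move=> W1v rr aM aM' /(eigenE R W1 W1v _ _ _ aM rr) e /(eigenE R W1 W1v _ _ _ aM' rr) e'.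
have h := inM_conductances R a aM; have h' := inM_conductances R a' aM'.
have ll : l' = l := eig_unique R r _ _ _ _ _ _ _ _ rr h' h e' e.
split => //; rewrite ll in e'.
have [k k0 [k1 k2 k3]] := eig_proportional R r l _ _ _ _ _ _ rr h' h e' e.
by exists k => // u; rewrite !DformE// k1 k2 k3 /tri; ring.
Qed.

Theorem theorem5p1 (R : realType) (W1 : set (seq 'I_3)) :
  validW1 R W1 ->
  (* (a) *)
  (exists (lam : R -> R) (Dr : R -> 'I_3 -> 'I_3 -> R),
     (forall r : R, rho R < r < 1 ->
        [/\ 0 < lam r, inM (Dr r), eigen W1 r (lam r) (Dr r), inMS (Dr r) &
            forall (l : R) (a : 'I_3 -> 'I_3 -> R),
              0 < l -> inM a -> eigen W1 r l a ->
              l = lam r /\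
              exists2 c : R, 0 < c & forall u, Dform a u = c * Dform (Dr r) u]) /\
     (forall r s : R, rho R < r -> r <= s -> s < 1 -> lam s <= lam r) /\
     {in `]rho R, 1[, continuous lam}) /\
  (* (b) *)
  (exists r : R,
     [/\ rho R < r < 1,
         exists2 a, inM a & eigen W1 r (r ^+ 2) a,
         forall a1 a2, inM a1 -> inM a2 ->
           eigen W1 r (r ^+ 2) a1 -> eigen W1 r (r ^+ 2) a2 ->
           exists2 c : R, 0 < c & forall u, Dform a2 u = c * Dform a1 u &
         forall r' : R, rho R < r' < 1 ->
           (exists2 a, inM a & eigen W1 r' (r' ^+ 2) a) -> r' = r]).
Proof.
move=> W1v.
(* Coefficient and eigenvalue are chosen together; the pair [(0, 0)] is a dummy outside the
   interval. *)
have ex (r : R) : exists bl : R * R, rho R < r < 1 ->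
    [/\ 0 <= bl.1, 0 < bl.2 & eig R r bl.2 1 1 bl.1].
  have [rr|rr] := boolP (rho R < r < 1); last by exists (0, 0).
  by have [b [l [b0 l0 e]]] := eigenform_exists R r rr; exists (b, l).
have [D DP] := choice ex.
pose lam r := (D r).2; pose b r := (D r).1.
have lamP r : rho R < r < 1 -> [/\ 0 <= b r, 0 < lam r & eig R r (lam r) 1 1 (b r)] := DP r.
have eigD r : rho R < r < 1 -> eigen W1 r (lam r) (coefs R (b r)).
  by move=> rr; have [b0 _ e] := lamP r rr; apply/eigen_coefs.
have MD r : rho R < r < 1 -> inMS (coefs R (b r)).
  by move=> rr; have [b0 _ _] := lamP r rr; apply: coefs_inMS.
have mono r s : rho R < r -> r <= s -> s < 1 -> lam s <= lam r.
  move=> r0 rs s1.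
  have rr : rho R < r < 1 by apply/andP; split; lra.
  have ss : rho R < s < 1 by apply/andP; split; lra.
  have [b0 _ e] := lamP r rr; have [c0 _ e'] := lamP s ss.
  by apply: (eig_nonincreasing R r s _ _ 1 1 (b r) 1 1 (b s)) => //; apply: conductances11.
have cont := eigenvalue_continuous R lam b lamP.
split.
  exists lam, (fun r => coefs R (b r)); split=> [r rr|].
    have [b0 l0 _] := lamP r rr; have [cM _] := MD r rr.
    split => //; [exact: eigD|exact: MD|].
    move=> l a l0' aM e.
    exact: (eigen_unique R W1 r (lam r) l _ a W1v rr cM aM (eigD r rr) e).
  split; first exact: mono.
  by move=> r; rewrite in_itv/= => rr; apply: cont.
have /andP[p1 p2] := rho_bounds R.
(* With [l = lam (3/4) < 1] this gives [s < 1] and [lam s <= l <= ((1 + l) / 2) ^+ 2 <= s ^+ 2]. *)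
pose s := Num.max (3/4) ((1 + lam (3/4)) / 2).
have r34 : rho R < (3/4 : R) < 1 by apply/andP; split; lra.
have [b34 l34 e34] := lamP _ r34; have lt1 := eig_lt1 R _ _ _ b34 r34 e34.
have s34 : 3/4 <= s by rewrite le_max lexx.
have sl : (1 + lam (3/4)) / 2 <= s by rewrite le_max lexx orbT.
have s1 : s < 1 by rewrite gt_max; apply/andP; split; lra.
have hs : lam s - s ^+ 2 <= 0.
  have ls : lam s <= lam (3/4) by apply: mono => //; lra.
  by have := sqr_ge0 (1 - lam (3/4)); nra.
have r62 : rho R < (31/50 : R) < 1 by apply/andP; split; lra.
have [b62 _ e62] := lamP _ r62; have gt := eig_gt_sqr R _ _ b62 e62.
have ls : 31/50 <= s by lra.
have cH : {within `[31/50, s], continuous (fun r => lam r - r ^+ 2)}.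
  apply: continuous_in_subspaceT => r; rewrite inE /= in_itv/= => /andP[r1 r2].
  have rr : rho R < r < 1 by apply/andP; split; lra.
  by apply: cvgB; [exact: cont|exact: exprn_continuous].
have [|r] := @IVT R (fun r => lam r - r ^+ 2) (31/50) s 0 ls cH.
  by rewrite ge_min le_max hs orbT/=; apply/orP; left; rewrite subr_ge0 ltW.
rewrite in_itv/= => /andP[r1 r2] /eqP; rewrite subr_eq0 => /eqP lr.
have rr : rho R < r < 1 by apply/andP; split; lra.
exists r; split => //.
- by exists (coefs R (b r)); [case: (MD r rr)|rewrite -lr; apply: eigD].
- move=> a1 a2 M1 M2 e1 e2.
  by have [] := eigen_unique R W1 r _ _ a1 a2 W1v rr M1 M2 e1 e2.
move=> r' rr' [a aM e].
have [cM _] := MD r' rr'.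
have [lr' _] := eigen_unique R W1 r' _ _ _ a W1v rr' cM aM (eigD r' rr') e.
have [q1 q2] := andP rr; have [q3 q4] := andP rr'.
have sq x y : 0 < x -> x < y -> x ^+ 2 < y ^+ 2 :> R.
  by move=> x0 xy; rewrite ltr_pXn2r// nnegrE; lra.
have [lt|lt|//] := ltgtP r' r.
  have := mono _ _ q3 (ltW lt) q2; rewrite lr -lr' leNgt sq//; lra.
have := mono _ _ q1 (ltW lt) q4; rewrite lr -lr' leNgt sq//; lra.
Qed.
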